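(* Let $(G,K)$ be a Gelfand pair and let $\alpha$ be a topological automorphism of $G$. Let $\theta\in L^2(G//K)$ be such that $\|\theta\|_{L^2(G//K)}=1$. If $u\in L^\infty(G\times\mathcal{S}^+)$, then the localization operator $\mathcal{L}_{\theta,\alpha}^{u}:L^2(G//K)\to L^2(G//K)$ is bounded and $$\|\mathcal{L}_{\theta,\alpha}^{u}\|\leq\|u\|_{L^\infty(G\times\mathcal{S}^+)}.$$
   Context: $G$ is a locally compact Hausdorff group with left Haar measure $dx$, and $K$ is a compact subgroup. A function $f$ on $G$ is $K$-bi-invariant if $f(kxk')=f(x)$ for all $x\in G$, $k,k'\in K$. $\mathcal{C}_c(G//K)$ is the space of continuous compactly supported $K$-bi-invariant complex functions, and $L^p(G//K)$ is the space of $K$-bi-invariant elements of $L^p(G)$, with the norm of $L^p(G)$; the inner product $\langle f,g\rangle_{L^2(G//K)}$ means $\int_G f\overline{g}\,dx$. $(G,K)$ is a Gelfand pair if $\mathcal{C}_c(G//K)$ is commutative under convolution $(f\ast g)(x)=\int_G f(y)g(y^{-1}x)dy$ (then $G$ is unimodular). A spherical function is a continuous $K$-bi-invariant function $\varphi$ on $G$ such that $f\mapsto\int_G f(x)\varphi(x)dx$ is a nontrivial character of the convolution algebra $\mathcal{C}_c(G//K)$. $\mathcal{S}_b(G,K)$ is the set of bounded spherical functions, and $\mathcal{S}^+\subset\mathcal{S}_b(G,K)$ is the set of positive-definite spherical functions. The spherical Fourier transform of $f\in L^1(G//K)$ is $\widehat f(\varphi)=\int_G f(x)\varphi(x^{-1})dx$.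 $\mathcal{S}_b(G,K)$ has the weak topology generated by the maps $\widehat f$, $f\in L^1(G//K)$. $\mathcal{S}^+$ carries the Plancherel measure, denoted $d\varphi$: the positive Radon measure such that, whenever $f\in L^1(G//K)$ is a linear combination of positive-definite $K$-bi-invariant functions, $\widehat f\in L^1(\mathcal{S}^+)$ and $f(x)=\int_{\mathcal{S}^+}\widehat f(\varphi)\varphi(x)\,d\varphi$; the map $f\mapsto \widehat f$ on $L^1(G//K)\cap L^2(G//K)$ extends to an isometry of $L^2(G//K)$ onto $L^2(\mathcal{S}^+)$. $L^p(G\times\mathcal{S}^+)$ is taken with respect to $dt\,d\varphi$. For a topological automorphism $\alpha$ of $G$, $\delta_\alpha>0$ is the constant with $d(\alpha(x))=\delta_\alpha dx$, i.e. $\int_G f(\alpha(x))dx=\delta_\alpha^{-1}\int_G f(x)dx$. For $\theta\in L^2(G//K)$, $t\in G$, $\varphi\in\mathcal{S}_b(G,K)$, put $\theta_{\alpha,\varphi,t}(x)=\delta_\alpha^{1/2}\varphi(x)\theta(\alpha(t^{-1}x))$. The Stockwell transform is $S_{\theta,\alpha}f(t,\varphi)=\langle f,\theta_{\alpha,\varphi,t}\rangle_{L^2(G//K)}=\delta_\alpha^{1/2}\int_G f(x)\overline{\varphi(x)\theta(\alpha(t^{-1}x))}\,dx$ for $f\in L^2(G//K)$. For a measurable $u:G\times\mathcal{S}^+\to\mathbb{C}$, the localization operator is defined for $f\in L^2(G//K)$ by $$\mathcal{L}_{\theta,\alpha}^{u}f(x)=\int_{\mathcal{S}^+}\int_G u(t,\varphi)\,S_{\theta,\alpha}f(t,\varphi)\,\theta_{\alpha,\varphi,t}(x)\,dt\,d\varphi,\quad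 x\in G.$$ $\|\cdot\|$ without subscript is the operator norm.
   Formalization: The integral defining the localization operator is taken weakly, by its inner products with elements of L^2(G//K), since the pointwise integral need not converge and need not be K-bi-invariant (e.g. G=Z/2×Z/2, K=Z/2×0, α the swap). *)

(* Defs.v *)
From HB Require Import structures.
From mathcomp Require Import all_boot all_order all_algebra.
From mathcomp Require Import all_classical all_reals all_analysis.
From mathcomp Require Import complex.

Set Implicit Arguments.
Unset Strict Implicit.
Unset Printing Implicit Defensive.

Import Order.TTheory GRing.Theory Num.Theory.
Import numFieldNormedType.Exports.
Import ComplexField.Normc.

Local Open Scope classical_set_scope.
Local Open Scope ring_scope.
Local Open Scope complex_scope.

(* The base point required by [ptopologicalType] carries no meaning; the
   library asks for one in every measurable space. *)
HB.mixin Record isTopologicalGroup G of PointedTopological G & Group G := {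
  mulg_continuous : continuous (fun xy : G * G => (xy.1 * xy.2)%g) ;
  invg_continuous : continuous (fun x : G => (x^-1)%g) }.

#[short(type="topologicalGroupType")]
HB.structure Definition TopologicalGroup :=
  { G of isTopologicalGroup G & PointedTopological G & Group G }.

Definition borel (T : ptopologicalType) := g_sigma_algebraType (@open T).

Section ComplexIntegration.
Context d (T : measurableType d) (R : realType).
Implicit Types (mu : {measure set T -> \bar R}) (f g : T -> R[i]).

Definition cmeasurable f :=
  measurable_fun setT (fun x => complex.Re (f x)) /\
  measurable_fun setT (fun x => complex.Im (f x)).

(* Meaningful for integrable f only: as usual with [Rintegral], divergent
   integrals get a junk value. *)
Definition cintegral mu f : R[i] :=
  (\int[mu]_x complex.Re (f x)) +i* (\int[mu]_x complex.Im (f x)).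

Definition Lpnorm mu (p : R) f : \bar R :=
  'N[mu]_(p%:E)[EFin \o (@normc R \o f)]%E.

(* Elements of L^p are represented by functions; equality of classes is
   equality almost everywhere. *)
Definition isLp mu (p : R) f := cmeasurable f /\ (Lpnorm mu p f < +oo)%E.

Definition aeeq mu f g := {ae mu, forall x, f x = g x}.

Definition inner mu f g : R[i] := cintegral mu (fun x => f x * (g x)^*).

End ComplexIntegration.

Section Iterated.
Context d1 (T1 : measurableType d1) d2 (T2 : measurableType d2) (R : realType).
Variables (m1 : {measure set T1 -> \bar R}) (m2 : {measure set T2 -> \bar R}).
Implicit Types w u : T1 * T2 -> R[i].

(* Neither measure is assumed sigma-finite, so that the product measure of the
   library is not available: integrals with respect to dt dphi are iterated,
   dt inside and dphi outside, and a property holds (dt dphi)-almost everywhere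
   when, for almost every phi, it holds for almost every t. *)
Definition iterated_integral w : R[i] :=
  cintegral m2 (fun y => cintegral m1 (fun x => w (x, y))).

Definition iterated_integrable w :=
  [/\ cmeasurable w,
      m2.-integrable setT (fun y => \int[m1]_x (normc (w (x, y)))%:E)%E &
      cmeasurable (fun y => cintegral m1 (fun x => w (x, y)))].

Definition iterated_ae (P : T1 * T2 -> Prop) :=
  {ae m2, forall y, {ae m1, forall x, P (x, y)}}.

Definition Linfnorm u : \bar R :=
  ereal_inf [set M | (0 <= M)%E /\
                     iterated_ae (fun xy => ((normc (u xy))%:E <= M)%E)].

Definition isLinf u := cmeasurable u /\ (Linfnorm u < +oo)%E.

End Iterated.

(* The conventions are those of Folland: outer regular on Borel sets, inner
   regular on open sets. *)
Definition radon (R : realType) (T : ptopologicalType)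
    (m : {measure set (borel T) -> \bar R}) :=
  [/\ forall C : set T, compact C -> (m C < +oo)%E,
      forall A : set (borel T), measurable A ->
        m A = ereal_inf [set m U | U in [set U : set T | open U /\ A `<=` U]] &
      forall U : set T, open U ->
        m U = ereal_sup [set m C | C in [set C : set T | compact C /\ C `<=` U]]].

Section Group.
Context (R : realType) (G : topologicalGroupType).
Variables (mu : {measure set (borel G) -> \bar R}) (K : set G).
Implicit Types (f g phi : G -> R[i]) (x y t : G).

Definition left_haar :=
  [/\ radon mu,
      forall x (A : set (borel G)), measurable A ->
        mu [set (x * y)%g | y in A] = mu A &
      mu setT != 0%E].

Definition subgroup :=
  [/\ K 1%g, forall x y, K x -> K y -> K (x * y)%g &
      forall x, K x -> K (x^-1)%g].

Definition biinv f :=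
  forall x k k', K k -> K k' -> f (k * x * k')%g = f x.

(* K-bi-invariance of the class of f in L^p(G) *)
Definition biinv_ae f :=
  forall k k', K k -> K k' -> {ae mu, forall x, f (k * x * k')%g = f x}.

Definition LpK (p : R) f := isLp mu p f /\ biinv_ae f.

Definition CcK f :=
  [/\ continuous (f : G -> R[i]^o), compact (closure [set x | f x != 0]) &
      biinv f].

Definition convolution f g x : R[i] :=
  cintegral mu (fun y => f y * g (y^-1 * x)%g).

Definition gelfand_pair :=
  forall f g, CcK f -> CcK g -> convolution f g =1 convolution g f.

Definition char_of phi f : R[i] := cintegral mu (fun x => f x * phi x).

Definition spherical phi :=
  [/\ continuous (phi : G -> R[i]^o), biinv phi,
      forall f g, CcK f -> CcK g ->
        char_of phi (convolution f g) = char_of phi f * char_of phi g &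
      exists2 f, CcK f & char_of phi f != 0].

Definition cbounded phi := exists M : R, forall x, normc (phi x) <= M.

(* [0 <= z] in [R[i]] says that z is real and nonnegative *)
Definition posdef phi :=
  forall (n : nat) (x : 'I_n -> G) (c : 'I_n -> R[i]),
    0 <= \sum_(i < n) \sum_(j < n) c i * (c j)^* * phi ((x j)^-1 * x i)%g.

Definition sft f phi : R[i] := cintegral mu (fun x => f x * phi (x^-1)%g).

(* For a Gelfand pair the constant function 1 is a bounded spherical function,
   its character being the integral. It is named explicitly so that S_b and S^+
   are inhabited by construction, since the measurable spaces of the library
   are pointed; this does not change the set. *)
Definition Sb : set (G -> R[i]) :=
  [set phi | (spherical phi /\ cbounded phi) \/ phi = (fun=> 1)].

Definition L1K : set (G -> R[i]) := [set f | LpK 1 f].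

Definition sft_eval (phi : Sb) : prod_topology (fun _ : L1K => R[i]^o) :=
  fun f : L1K => sft (set_val f) (set_val phi).

Definition SbT := initial_topology sft_eval.
HB.instance Definition _ := Topological.on SbT.

Definition Splus : set SbT := [set phi | posdef (set_val (phi : Sb))].

Lemma Sb_cst1 : (fun=> 1) \in Sb.
Proof. by rewrite inE; right. Qed.

Definition Sb1 : SbT := SigSub Sb_cst1.

Lemma Splus_cst1 : Sb1 \in Splus.
Proof.
rewrite inE /Splus /posdef /= => n x c.
under eq_bigr do under eq_bigr do rewrite mulr1.
under eq_bigr do rewrite -mulr_sumr.
rewrite -mulr_suml -rmorph_sum; exact: mul_conjC_ge0.
Qed.

Definition SplusT : Type := set_type Splus.
HB.instance Definition _ := Topological.on SplusT.
HB.instance Definition _ := isPointed.Build SplusT (SigSub Splus_cst1).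

Definition sph (phi : SplusT) : G -> R[i] :=
  set_val (set_val (phi : Splus) : Sb).

End Group.

Section Plancherel.
Context (R : realType) (G : topologicalGroupType).
Variables (mu : {measure set (borel G) -> \bar R}) (K : set G).
Variable nu : {measure set (borel (SplusT mu K)) -> \bar R}.

Definition span_posdef (f : G -> R[i]) :=
  exists (n : nat) (c : 'I_n -> R[i]) (p : 'I_n -> G -> R[i]),
    (forall i, [/\ continuous (p i : G -> R[i]^o), biinv K (p i) &
                   posdef (p i)]) /\
    (forall x, f x = \sum_(i < n) c i * p i x).

Definition inversion_formula :=
  forall f, LpK mu K 1 f -> span_posdef f ->
    isLp nu 1 (fun phi => sft mu f (sph phi)) /\
    forall x, f x = cintegral nu (fun phi => sft mu f (sph phi) * sph phi x).

Definition plancherel_isometry :=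
  exists F : (G -> R[i]) -> (SplusT mu K -> R[i]),
    [/\ forall f, LpK mu K 1 f -> LpK mu K 2 f ->
          aeeq nu (F f) (fun phi => sft mu f (sph phi)),
        forall f, LpK mu K 2 f ->
          isLp nu 2 (F f) /\ Lpnorm nu 2 (F f) = Lpnorm mu 2 f,
        forall (a : R[i]) f g, LpK mu K 2 f -> LpK mu K 2 g ->
          aeeq nu (F (fun x => a * f x + g x))
                  (fun phi => a * F f phi + F g phi) &
        forall h, isLp nu 2 h -> exists2 f, LpK mu K 2 f & aeeq nu (F f) h].

Definition plancherel_measure :=
  [/\ radon nu, inversion_formula & plancherel_isometry].

End Plancherel.

Definition topological_automorphism (G : topologicalGroupType)
    (alpha : G -> G) :=
  [/\ {morph alpha : x y / (x * y)%g}, continuous alpha &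
      exists beta : G -> G,
        [/\ cancel alpha beta, cancel beta alpha & continuous beta]].

(* d(alpha(x)) = delta dx *)
Definition modulus (R : realType) (G : topologicalGroupType)
    (mu : {measure set (borel G) -> \bar R}) (alpha : G -> G) (delta : R) :=
  0 < delta /\
  forall A : set (borel G), measurable A ->
    mu [set alpha x | x in A] = (delta%:E * mu A)%E.

Section Localization.
Context (R : realType) (G : topologicalGroupType).
Variables (mu : {measure set (borel G) -> \bar R}) (K : set G).
Variable nu : {measure set (borel (SplusT mu K)) -> \bar R}.
Variables (alpha : G -> G) (delta : R) (theta : G -> R[i]).

Definition atom (phi : SplusT mu K) (t x : G) : R[i] :=
  (Num.sqrt delta)%:C * sph phi x * theta (alpha (t^-1 * x)%g).

Definition stockwell (f : G -> R[i]) (tphi : borel G * borel (SplusT mu K)) :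
    R[i] :=
  inner mu f (atom tphi.2 tphi.1).

(* For u in L^oo the integral
     \int \int u(t, phi) S f(t, phi) theta_{alpha, phi, t} dt dphi
   need not converge at a given point x, and theta_{alpha, phi, t} itself is not
   K-bi-invariant. It is the weak integral in the Hilbert space L^2(G//K): the
   element h of that space whose inner products with the elements of the space
   are obtained by integrating those of the integrand. *)
Definition weak_integral (c : borel G * borel (SplusT mu K) -> R[i])
    (v : SplusT mu K -> G -> G -> R[i]) (h : G -> R[i]) :=
  LpK mu K 2 h /\
  forall g, LpK mu K 2 g ->
    let w tphi := c tphi * inner mu (v tphi.2 tphi.1) g in
    iterated_integrable mu nu w /\ inner mu h g = iterated_integral mu nu w.

Definition is_localization_operator (u : borel G * borel (SplusT mu K) -> R[i])
    (L : (G -> R[i]) -> (G -> R[i])) :=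
  forall f, LpK mu K 2 f ->
    weak_integral (fun tphi => u tphi * stockwell f tphi) atom (L f).

End Localization.

Section Operators.
Context (R : realType) (G : topologicalGroupType).
Variables (mu : {measure set (borel G) -> \bar R}) (K : set G).
Variable L : (G -> R[i]) -> (G -> R[i]).

Definition bounded_operator :=
  [/\ forall f, LpK mu K 2 f -> LpK mu K 2 (L f),
      forall (a : R[i]) f g, LpK mu K 2 f -> LpK mu K 2 g ->
        aeeq mu (L (fun x => a * f x + g x)) (fun x => a * L f x + L g x) &
      exists M : R, forall f, LpK mu K 2 f ->
        (Lpnorm mu 2 (L f) <= M%:E * Lpnorm mu 2 f)%E].

Definition opnorm : \bar R :=
  ereal_sup [set Lpnorm mu 2 (L f) | f in
             [set f | LpK mu K 2 f /\ (Lpnorm mu 2 f <= 1)%E]].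

End Operators.

(* Main.v *)
Require Import Defs.
From mathcomp Require Import all_boot all_order all_algebra.
From mathcomp Require Import all_classical all_reals all_analysis.
From mathcomp Require Import complex ring lra measurable_realfun.

Set Implicit Arguments.
Unset Strict Implicit.
Unset Printing Implicit Defensive.

Import Order.TTheory GRing.Theory Num.Theory.
Import numFieldNormedType.Exports.
Import ComplexField.Normc.

Local Open Scope classical_set_scope.
Local Open Scope ring_scope.

(** The operator is defined weakly: L f is the element of L^2(G//K) with
        <L f, g> = int int u(t, phi) S f(t, phi) (S g(t, phi))^* dt dphi,
    where S is the Stockwell transform. Suppose that
        int int |S f(t, phi)|^2 dt dphi <= |f|^2      for all f in L^2(G).   (1)
    If |u| <= M almost everywhere, the pointwise inequality
    2 M a b <= M^2 a^2 + b^2 bounds the integral of |u S f (S g)^*| by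
    (M^2 |f|^2 + |g|^2) / 2 ([iterated_product]). The right-hand side above is
    then a functional of g with a Riesz representative ([riesz]), which is L f,
    and g := L f gives |L f|^2 <= M^2 |f|^2 ([localization_sqnorm_le]). The
    infimum of the numbers M is the essential supremum of |u|.

    The inequality (1) is [tame_ambiguity]. With w(x) = delta^(1/2) theta(alpha x),
    a function of norm 1, S f(t, .) is the spherical transform of
    Phi_t(x) = f(x) (w(t^-1 x))^*, which in general is not K-bi-invariant. For f
    and w continuous with compact support two facts are combined.

    - The spherical transform does not increase the L^2 norm, bi-invariant or
      not ([plancherel_hat]): it factors through the orthogonal projection onto
      L^2(G//K), where it is the Plancherel isometry.
    - int |Phi_t|^2 dt = |f|^2 |w|^2 ([lmul_energy]): by left invariance this is
      |f|^2 times the integral of |w(t^-1)|^2, and the group of a Gelfand pair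
      is unimodular ([unimodular]).

    The integrals of (1) are iterated, dt inside, while the first fact concerns
    one t at a time, and the measures may fail to be sigma-finite. The order is
    changed after Phi_t has been replaced by functions that take finitely many
    values as t varies, for which the integral in t is a finite sum
    ([tame_ambiguity_Ccc]); Fatou's lemma passes to the limit ([tame_limit]).
    The density of the continuous functions with compact support ([L2_dense])
    and Fatou's lemma once more give (1) in general. Each approximation vanishes
    for t off a set of finite measure, so that S f vanishes for t off a
    sigma-finite set; this makes the inner integrals measurable functions of
    phi. *)

Notation rp := complex.Re.
Notation ip := complex.Im.

(** * Complex numbers by coordinates *)

Section ComplexCoordinates.
Context (R : realType).
Implicit Types z w : R[i].

Lemma rpD z w : rp (z + w) = rp z + rp w. Proof. by case: z w => [? ?] []. Qed.
Lemma ipD z w : ip (z + w) = ip z + ip w. Proof. by case: z w => [? ?] []. Qed.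
Lemma rpN z : rp (- z) = - rp z. Proof. by case: z. Qed.
Lemma ipN z : ip (- z) = - ip z. Proof. by case: z. Qed.
Lemma rpM z w : rp (z * w) = rp z * rp w - ip z * ip w.
Proof. by case: z w => [? ?] []. Qed.
Lemma ipM z w : ip (z * w) = rp z * ip w + ip z * rp w.
Proof. by case: z w => [? ?] []. Qed.
Lemma rpJ z : rp z^* = rp z. Proof. by case: z. Qed.
Lemma ipJ z : ip z^* = - ip z. Proof. by case: z. Qed.
Lemma rpC (r : R) : rp r%:C%C = r. Proof. by []. Qed.
Lemma ipC (r : R) : ip r%:C%C = 0. Proof. by []. Qed.
Lemma rp0 : rp (0 : R[i]) = 0. Proof. by []. Qed.
Lemma ip0 : ip (0 : R[i]) = 0. Proof. by []. Qed.

(** The imaginary unit, named so that it stays folded under simplification. *)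
Definition iunit : R[i] := (0 +i* 1)%C.
Lemma rp_iunit : rp iunit = 0. Proof. by []. Qed.
Lemma ip_iunit : ip iunit = 1. Proof. by []. Qed.

Definition coordE := (rp_iunit, ip_iunit, rpD, ipD, rpN, ipN, rpM, ipM,
  rpJ, ipJ, rpC, ipC, rp0, ip0).

Lemma eq_coord z w : rp z = rp w -> ip z = ip w -> z = w.
Proof. by case: z w => [? ?] [? ?] /= -> ->. Qed.

Definition sqn z : R := rp z ^+ 2 + ip z ^+ 2.

Lemma sqn_ge0 z : 0 <= sqn z.
Proof. by rewrite addr_ge0 ?sqr_ge0. Qed.

Lemma normcE z : normc z = Num.sqrt (sqn z). Proof. by case: z. Qed.

Lemma sqr_normc z : normc z ^+ 2 = sqn z.
Proof. by rewrite normcE sqr_sqrtr// sqn_ge0. Qed.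

Lemma normc_ge0 z : 0 <= normc z. Proof. by rewrite normcE sqrtr_ge0. Qed.

Lemma sqnM z w : sqn (z * w) = sqn z * sqn w.
Proof. by rewrite /sqn !coordE; ring. Qed.

Lemma sqnJ z : sqn z^* = sqn z.
Proof. by rewrite /sqn !coordE; ring. Qed.

Lemma sqn0 : sqn 0 = 0. Proof. by rewrite /sqn !coordE expr0n addr0. Qed.

Lemma sqn_eq0 z : (sqn z == 0) = (z == 0).
Proof.
apply/eqP/eqP => [|->]; last exact: sqn0.
move=> /eqP; rewrite /sqn paddr_eq0 ?sqr_ge0// !sqrf_eq0 => /andP[/eqP a /eqP b].
exact: eq_coord.
Qed.

Lemma normcM z w : normc (z * w) = normc z * normc w.
Proof. by rewrite !normcE sqnM sqrtrM// sqn_ge0. Qed.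

Lemma normcJ z : normc z^* = normc z.
Proof. by rewrite !normcE sqnJ. Qed.

Lemma normcN z : normc (- z) = normc z.
Proof. by rewrite !normcE /sqn rpN ipN !sqrrN. Qed.

Lemma normr_rp_le z : `|rp z| <= normc z.
Proof. by rewrite normcE -sqrtr_sqr ler_wsqrtr// lerDl sqr_ge0. Qed.

Lemma normr_ip_le z : `|ip z| <= normc z.
Proof. by rewrite normcE -sqrtr_sqr ler_wsqrtr// lerDr sqr_ge0. Qed.

Lemma normc_le_coord z : normc z <= `|rp z| + `|ip z|.
Proof.
rewrite normcE -[leRHS]ger0_norm ?addr_ge0// -sqrtr_sqr ler_wsqrtr//.
rewrite /sqn -[_ ^+ 2]real_normK ?num_real// -[ip z ^+ 2]real_normK ?num_real//.
by rewrite sqrrD -addrA lerD2l lerDr mulrn_wge0// mulr_ge0.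
Qed.

Lemma normcD_le z w : normc (z + w) <= normc z + normc w.
Proof.
rewrite -(@ler_pXn2r _ 2)// ?nnegrE ?addr_ge0 ?normc_ge0// sqrrD !sqr_normc.
rewrite (_ : sqn (z + w) = sqn z + 2 * rp (z * w^*) + sqn w); last first.
  by rewrite /sqn !coordE; ring.
rewrite lerD2r lerD2l mulr_natl lerMn2r /= -normcM.
have := le_trans (ler_norm _) (normr_rp_le (z * w^*)).
by rewrite !normcM normcJ.
Qed.

(** Integrated with an optimal weight s, this arithmetic-geometric mean
    inequality is Cauchy-Schwarz. *)
Lemma normc_mul_le (s : R) z w : 0 < s ->
  normc (z * w) <= (s * sqn z + s^-1 * sqn w) / 2.
Proof.
move=> s0; rewrite normcM -!sqr_normc.
rewrite ler_pdivlMr// -subr_ge0.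
have -> : s * normc z ^+ 2 + s^-1 * normc w ^+ 2 - normc z * normc w * 2 =
  s^-1 * (s * normc z - normc w) ^+ 2 by field; lra.
by rewrite mulr_ge0 ?sqr_ge0// invr_ge0 ltW.
Qed.

Lemma sqnD_le z w : sqn (z + w) <= 2 * (sqn z + sqn w).
Proof.
rewrite -subr_ge0; have -> : 2 * (sqn z + sqn w) - sqn (z + w) = sqn (z - w).
  by rewrite /sqn !coordE; ring.
exact: sqn_ge0.
Qed.

End ComplexCoordinates.
Arguments sqn {R} z.
Arguments iunit {R}.

Section ComplexMeasure.
Context d (T : measurableType d) (R : realType).
Variable mu : {measure set T -> \bar R}.
Implicit Types f g h : T -> R[i].

Lemma cmeasurable_cst (c : R[i]) : cmeasurable (fun _ : T => c).
Proof. by split; exact: measurable_cst. Qed.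

Lemma cmeasurableD f g : cmeasurable f -> cmeasurable g ->
  cmeasurable (fun x => f x + g x).
Proof.
move=> [? ?] [? ?]; split.
  under eq_fun do rewrite rpD; exact: measurable_funD.
under eq_fun do rewrite ipD; exact: measurable_funD.
Qed.

Lemma cmeasurableM f g : cmeasurable f -> cmeasurable g ->
  cmeasurable (fun x => f x * g x).
Proof.
move=> [? ?] [? ?]; split.
  under eq_fun do rewrite rpM.
  by apply: measurable_funB; exact: measurable_funM.
under eq_fun do rewrite ipM.
by apply: measurable_funD; exact: measurable_funM.
Qed.

Lemma cmeasurableJ f : cmeasurable f -> cmeasurable (fun x => (f x)^*).
Proof.
move=> [? ?]; split; first by under eq_fun do rewrite rpJ.
by under eq_fun do rewrite ipJ; exact: measurable_funN.
Qed.

Lemma cmeasurableZ (c : R[i]) f : cmeasurable f ->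
  cmeasurable (fun x => c * f x).
Proof. by apply: cmeasurableM; exact: cmeasurable_cst. Qed.

Lemma cmeasurable_real (r : T -> R) : measurable_fun setT r ->
  cmeasurable (fun x => (r x)%:C%C).
Proof. by move=> mr; split => //=; exact: measurable_cst. Qed.

Lemma measurable_sqn f : cmeasurable f ->
  measurable_fun setT (fun x => sqn (f x)).
Proof.
by move=> [mr mi]; apply: measurable_funD; apply: measurable_funX.
Qed.

Lemma measurable_normc f : cmeasurable f ->
  measurable_fun setT (fun x => normc (f x)).
Proof.
move=> mf; under eq_fun do rewrite normcE.
rewrite (_ : (fun _ => _) = (fun x => sqn (f x) `^ 2^-1)).
  by apply: (measurableT_comp (measurable_powR _)); exact: measurable_sqn.
by apply/funext => x; rewrite powR12_sqrt// sqn_ge0.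
Qed.

Definition cintegrable f :=
  mu.-integrable setT (EFin \o (fun x => rp (f x))) /\
  mu.-integrable setT (EFin \o (fun x => ip (f x))).

Lemma integrable_dom (r : T -> R) (b : T -> \bar R) : measurable_fun setT r ->
  mu.-integrable setT b -> (forall x, (`|r x|%:E <= b x)%E) ->
  mu.-integrable setT (EFin \o r).
Proof.
move=> mr ib rb; apply: (le_integrable measurableT _ _ ib).
  exact/measurable_EFinP.
by move=> x _ /=; rewrite (le_trans (rb x))// lee_abs.
Qed.

Lemma cintegrable_dom f (b : T -> \bar R) : cmeasurable f ->
  mu.-integrable setT b -> (forall x, ((normc (f x))%:E <= b x)%E) ->
  cintegrable f.
Proof.
move=> [mr mi] ib fb; split; apply: (integrable_dom _ ib) => // x;
  apply: le_trans (fb x); rewrite lee_fin.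
  exact: normr_rp_le.
exact: normr_ip_le.
Qed.

Lemma cintegrableP f : cmeasurable f ->
  (\int[mu]_x (normc (f x))%:E < +oo)%E -> cintegrable f.
Proof.
move=> mf fi.
apply: (cintegrable_dom (b := fun x => (normc (f x))%:E)) => //.
apply/integrableP; split; first by apply/measurable_EFinP; exact: measurable_normc.
apply: le_lt_trans fi; apply: ge0_le_integral => //=.
- by apply/measurable_EFinP; apply: measurableT_comp => //; exact: measurable_normc.
- apply/measurable_EFinP; exact: measurable_normc.
- by move=> x _; rewrite lee_fin ger0_norm// normc_ge0.
Qed.

Lemma cintegrable_meas f : cintegrable f -> cmeasurable f.
Proof.
by move=> [/measurable_int/measurable_EFinP ? /measurable_int/measurable_EFinP].
Qed.

Lemma cintegrable_normc f : cintegrable f ->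
  mu.-integrable setT (fun x => (normc (f x))%:E).
Proof.
move=> fi; have [fr fj] := fi.
apply: (@integrable_dom _ (fun x => ((`|rp (f x)|)%:E + (`|ip (f x)|)%:E)%E)).
- exact/measurable_normc/cintegrable_meas.
- by apply: integrableD => //; [exact: (integrable_norm fr)|exact: (integrable_norm fj)].
- by move=> x; rewrite -EFinD lee_fin ger0_norm ?normc_ge0// normc_le_coord.
Qed.

Lemma cintegralD f g : cintegrable f -> cintegrable g ->
  cintegral mu (fun x => f x + g x) = cintegral mu f + cintegral mu g.
Proof.
move=> [fr fj] [gr gj]; apply: eq_coord; rewrite ?rpD ?ipD /cintegral /=.
  by under eq_Rintegral do rewrite rpD; rewrite RintegralD.
by under eq_Rintegral do rewrite ipD; rewrite RintegralD.
Qed.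

Lemma cintegrableZ (c : R[i]) f : cintegrable f ->
  cintegrable (fun x => c * f x).
Proof.
move=> fi; apply: (cintegrable_dom (b := fun x => ((normc c)%:E * (normc (f x))%:E)%E)).
- exact/cmeasurableZ/cintegrable_meas.
- by apply: integrableZl => //; exact: cintegrable_normc.
- by move=> x; rewrite normcM EFinM.
Qed.

Lemma cintegralZ (c : R[i]) f : cintegrable f ->
  cintegral mu (fun x => c * f x) = c * cintegral mu f.
Proof.
move=> [fr fj].
have iZ (a : R) (r : T -> R) : mu.-integrable setT (EFin \o r) ->
    mu.-integrable setT (EFin \o (fun x => a * r x)).
  move=> ir; rewrite (_ : _ \o _ = (fun x => a%:E * (EFin \o r) x)%E).
    exact: integrableZl.
  by apply/funext => x /=; rewrite EFinM.
apply: eq_coord; rewrite ?rpM ?ipM /cintegral /=.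
  under eq_Rintegral do rewrite rpM.
  by rewrite RintegralB ?RintegralZl//; exact: iZ.
under eq_Rintegral do rewrite ipM.
by rewrite RintegralD ?RintegralZl//; exact: iZ.
Qed.

Lemma cintegralJ f : cintegrable f ->
  cintegral mu (fun x => (f x)^*) = (cintegral mu f)^*.
Proof.
move=> [fr fj]; apply: eq_coord; rewrite ?rpJ ?ipJ /cintegral /=.
  by apply: eq_Rintegral => x _; rewrite rpJ.
under eq_Rintegral do rewrite ipJ -mulN1r.
by rewrite RintegralZl// mulN1r.
Qed.

Lemma eq_cintegral f g : f =1 g -> cintegral mu f = cintegral mu g.
Proof. by move=> /funext ->. Qed.

Lemma cintegral_rp_le f : cintegrable f ->
  ((`|rp (cintegral mu f)|)%:E <= \int[mu]_x (normc (f x))%:E)%E.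
Proof.
move=> fi; have [fr fj] := fi; rewrite /cintegral /=.
have fn := cintegrable_normc fi.
rewrite EFin_normr_Rintegral//.
apply: le_trans (le_abse_integral _ _ _) _ => //; first exact: measurable_int fr.
apply: ge0_le_integral => //=.
- by apply/measurable_EFinP; apply: measurableT_comp => //; exact: (cintegrable_meas fi).1.
- exact: measurable_int fn.
- by move=> x _; rewrite lee_fin normr_rp_le.
Qed.

Lemma cintegral_ip_le f : cintegrable f ->
  ((`|ip (cintegral mu f)|)%:E <= \int[mu]_x (normc (f x))%:E)%E.
Proof.
move=> fi; have [fr fj] := fi; rewrite /cintegral /=.
have fn := cintegrable_normc fi.
rewrite EFin_normr_Rintegral//.
apply: le_trans (le_abse_integral _ _ _) _ => //; first exact: measurable_int fj.
apply: ge0_le_integral => //=.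
- by apply/measurable_EFinP; apply: measurableT_comp => //; exact: (cintegrable_meas fi).2.
- exact: measurable_int fn.
- by move=> x _; rewrite lee_fin normr_ip_le.
Qed.

(** * The space of square-integrable functions *)

Definition energy f : \bar R := \int[mu]_x (sqn (f x))%:E.

Definition L2 f := cmeasurable f /\ (energy f < +oo)%E.

Lemma L2_integrable_sqn f : L2 f -> mu.-integrable setT (EFin \o (sqn \o f)).
Proof.
move=> [mf fE]; apply/integrableP; split.
  apply/measurable_EFinP; exact: measurable_sqn.
rewrite (eq_integral (fun x => (sqn (f x))%:E))// => x _ /=.
by rewrite ger0_norm// sqn_ge0.
Qed.

Lemma L2P f : cmeasurable f -> mu.-integrable setT (EFin \o (sqn \o f)) -> L2 f.
Proof.
move=> mf /integrableP[_]; rewrite (eq_integral (fun x => (sqn (f x))%:E))// => x _ /=.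
by rewrite ger0_norm// sqn_ge0.
Qed.

Lemma L2_dom f (b : T -> R) : cmeasurable f -> mu.-integrable setT (EFin \o b) ->
  (forall x, sqn (f x) <= b x) -> L2 f.
Proof.
move=> mf ib fb; apply: L2P => //; apply: (integrable_dom _ ib).
  exact: measurable_sqn.
by move=> x /=; rewrite lee_fin ger0_norm ?sqn_ge0.
Qed.

(** The squared L^2 norm, the real value of [energy]. *)
Definition sqnorm f : R := \int[mu]_x sqn (f x).

Lemma sqnormE f : L2 f -> energy f = (sqnorm f)%:E.
Proof.
move=> fL; rewrite /energy /sqnorm /Rintegral fineK//.
by apply: integrable_fin_num => //; exact: L2_integrable_sqn.
Qed.

Lemma sqnorm_ge0 f : 0 <= sqnorm f.
Proof. by apply: Rintegral_ge0 => x _; exact: sqn_ge0. Qed.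

Lemma L2_mul f g : L2 f -> L2 g -> cintegrable (fun x => f x * (g x)^*).
Proof.
move=> fL gL.
apply: (cintegrable_dom (b := fun x => ((sqn (f x))%:E + (sqn (g x))%:E)%E)).
- by apply: cmeasurableM; [case: fL|apply: cmeasurableJ; case: gL].
- by apply: integrableD => //; exact: L2_integrable_sqn.
- move=> x; rewrite -EFinD lee_fin.
  apply: le_trans (normc_mul_le _ _ ltr01) _.
  rewrite invr1 !mul1r sqnJ ler_pdivrMr// ler_peMr ?ler1n//.
  by rewrite addr_ge0// sqn_ge0.
Qed.

Lemma L2D f g : L2 f -> L2 g -> L2 (fun x => f x + g x).
Proof.
move=> fL gL.
apply: (L2_dom (b := fun x => 2 * (sqn (f x) + sqn (g x)))).
- by apply: cmeasurableD; [case: fL|case: gL].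
- rewrite (_ : _ \o _ = fun x => (2%:E * ((sqn (f x))%:E + (sqn (g x))%:E))%E)//.
  apply: integrableZl => //.
  by apply: integrableD => //; exact: L2_integrable_sqn.
- by move=> x; exact: sqnD_le.
Qed.

Lemma L2Z (c : R[i]) f : L2 f -> L2 (fun x => c * f x).
Proof.
move=> fL.
apply: (L2_dom (b := fun x => sqn c * sqn (f x))).
- by apply: cmeasurableZ; case: fL.
- rewrite (_ : _ \o _ = fun x => ((sqn c)%:E * (sqn (f x))%:E)%E)//.
  by apply: integrableZl => //; exact: L2_integrable_sqn.
- by move=> x; rewrite sqnM.
Qed.

Lemma L2N f : L2 f -> L2 (fun x => - f x).
Proof. by move=> fL; under eq_fun do rewrite -mulN1r; exact: L2Z. Qed.

Lemma L2B f g : L2 f -> L2 g -> L2 (fun x => f x - g x).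
Proof. by move=> fL gL; apply: L2D => //; exact: L2N. Qed.

Lemma innerDl f g h : L2 f -> L2 g -> L2 h ->
  inner mu (fun x => f x + g x) h = inner mu f h + inner mu g h.
Proof.
move=> fL gL hL; rewrite /inner -cintegralD; [|exact: L2_mul..].
by apply: eq_cintegral => x; rewrite mulrDl.
Qed.

Lemma innerZl (c : R[i]) f h : L2 f -> L2 h ->
  inner mu (fun x => c * f x) h = c * inner mu f h.
Proof.
move=> fL hL; rewrite /inner -cintegralZ; last exact: L2_mul.
by apply: eq_cintegral => x; rewrite mulrA.
Qed.

Lemma innerJ f g : L2 f -> L2 g -> inner mu g f = (inner mu f g)^*.
Proof.
move=> fL gL; rewrite /inner -cintegralJ; last exact: L2_mul.
by apply: eq_cintegral => x; rewrite rmorphM /= conjCK mulrC.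
Qed.

Lemma innerDr f g h : L2 f -> L2 g -> L2 h ->
  inner mu h (fun x => f x + g x) = inner mu h f + inner mu h g.
Proof.
by move=> fL gL hL; rewrite !(innerJ _ hL) ?innerDl ?rmorphD//; exact: L2D.
Qed.

Lemma innerZr (c : R[i]) f h : L2 f -> L2 h ->
  inner mu h (fun x => c * f x) = c^* * inner mu h f.
Proof.
by move=> fL hL; rewrite !(innerJ _ hL) ?innerZl ?rmorphM//; exact: L2Z.
Qed.

Lemma inner_self f : inner mu f f = (sqnorm f)%:C%C.
Proof.
apply: eq_coord; rewrite /inner /cintegral /=.
  by apply: eq_Rintegral => x _; rewrite /sqn !coordE; ring.
rewrite (@eq_Rintegral _ _ _ mu _ (cst 0)) => [|x _]; last first.
  by rewrite !coordE /=; ring.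
by rewrite /Rintegral integral0.
Qed.

Lemma sqnormD f g : L2 f -> L2 g ->
  sqnorm (fun x => f x + g x) = sqnorm f + sqnorm g + 2 * rp (inner mu f g).
Proof.
move=> fL gL; rewrite -[LHS]rpC -inner_self innerDl ?innerDr//; [|exact: L2D..].
by rewrite (innerJ fL gL) !inner_self !coordE; ring.
Qed.

Lemma sqnormZ (c : R[i]) f : L2 f -> sqnorm (fun x => c * f x) = sqn c * sqnorm f.
Proof.
move=> fL; rewrite -[LHS]rpC -inner_self innerZl ?innerZr//; last exact: L2Z.
by rewrite inner_self /sqn !coordE; ring.
Qed.

(** [normc_mul_le], integrated. *)
Lemma L2_mul_normc_le (s : R) f g : 0 < s -> L2 f -> L2 g ->
  (\int[mu]_x (normc (f x * (g x)^*)%R)%:E <=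
   ((s * sqnorm f + s^-1 * sqnorm g) / 2)%:E)%E.
Proof.
move=> s0 fL gL; have fg := L2_mul fL gL.
have iZ (a : R) h : L2 h ->
    mu.-integrable setT (fun x => (a%:E * (sqn (h x))%:E)%E).
  by move=> hL; apply: integrableZl => //; exact: L2_integrable_sqn.
have -> : ((s * sqnorm f + s^-1 * sqnorm g) / 2)%:E = (\int[mu]_x
    ((s / 2)%:E * (sqn (f x))%:E + (s^-1 / 2)%:E * (sqn (g x))%:E))%E.
  rewrite integralD//; [|exact: iZ..].
  rewrite !integralZl//; [|exact: L2_integrable_sqn..].
  rewrite -/(energy f) -/(energy g) !sqnormE// -!EFinM -EFinD; congr EFin.
  by rewrite mulrDl mulrAC [in X in _ + X]mulrAC.
apply: ge0_le_integral => //=.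
- by move=> x _; rewrite lee_fin normc_ge0.
- by apply/measurable_EFinP/measurable_normc; exact: cintegrable_meas.
- apply: measurable_int (integrableD _ _ _) => //; exact: iZ.
- move=> x _; rewrite -!EFinM -EFinD lee_fin.
  apply: le_trans (normc_mul_le _ _ s0) _.
  by rewrite sqnJ mulrDl mulrAC [in X in _ + X]mulrAC.
Qed.

Lemma inner_rp_le (s : R) f g : 0 < s -> L2 f -> L2 g ->
  `|rp (inner mu f g)| <= (s * sqnorm f + s^-1 * sqnorm g) / 2.
Proof.
move=> s0 fL gL; rewrite -lee_fin.
apply: le_trans (cintegral_rp_le (L2_mul fL gL)) _; exact: L2_mul_normc_le.
Qed.

Lemma sqnorm_eq0 f : L2 f -> sqnorm f = 0 -> {ae mu, forall x, f x = 0}.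
Proof.
move=> fL f0; have fi := L2_integrable_sqn fL.
have : ae_eq mu setT (EFin \o (sqn \o f)) (cst 0%E).
  apply/ae_eq_integral_abs => //; first exact: measurable_int fi.
  rewrite (eq_integral (fun x => (sqn (f x))%:E)).
    by move: (sqnormE fL); rewrite /energy f0.
  by move=> x _ /=; rewrite ger0_norm// sqn_ge0.
apply: filterS => x /(_ I) /= [] /eqP; rewrite sqn_eq0 => /eqP.
exact.
Qed.

End ComplexMeasure.

Section ComplexLimits.
Context (R : realType).

Definition ccvg (z : nat -> R[i]) (l : R[i]) :=
  (rp (z n) @[n --> \oo] --> rp l) /\ (ip (z n) @[n --> \oo] --> ip l).

Lemma ccvg_cst (c : R[i]) : ccvg (fun=> c) c.
Proof. by split; exact: cvg_cst. Qed.

Lemma ccvgD z l w m : ccvg z l -> ccvg w m -> ccvg (fun n => z n + w n) (l + m).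
Proof.
move=> [zr zi] [wr wi]; split; rewrite /comp /= ?rpD ?ipD.
  by under eq_fun do rewrite rpD; exact: cvgD.
by under eq_fun do rewrite ipD; exact: cvgD.
Qed.

Lemma ccvgM z l w m : ccvg z l -> ccvg w m -> ccvg (fun n => z n * w n) (l * m).
Proof.
move=> [zr zi] [wr wi]; split; rewrite /comp /= ?rpM ?ipM.
  by under eq_fun do rewrite rpM; apply: cvgB; exact: cvgM.
by under eq_fun do rewrite ipM; apply: cvgD; exact: cvgM.
Qed.

Lemma ccvgZ c z l : ccvg z l -> ccvg (fun n => c * z n) (c * l).
Proof. by apply: ccvgM; exact: ccvg_cst. Qed.

Lemma ccvgB z l w m : ccvg z l -> ccvg w m -> ccvg (fun n => z n - w n) (l - m).
Proof.
move=> zl wm; apply: ccvgD => //; rewrite -mulN1r.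
by under eq_fun do rewrite -mulN1r; exact: ccvgZ.
Qed.

Lemma cvg_sqn z l : ccvg z l -> sqn (z n) @[n --> \oo] --> sqn l.
Proof.
move=> [zr zi]; rewrite /sqn.
by apply: cvgD; rewrite expr2; under eq_fun do rewrite expr2; exact: cvgM.
Qed.

Lemma ccvg_normc z l : normc (z n - l) @[n --> \oo] --> 0 -> ccvg z l.
Proof.
move=> zl; split; apply/subr_cvg0; apply/norm_cvg0P;
  (apply: (squeeze_cvgr _ (cvg_cst 0) zl); near=> n; rewrite normr_ge0/=).
  by apply: le_trans (normr_rp_le _); rewrite !coordE.
by apply: le_trans (normr_ip_le _); rewrite !coordE.
Unshelve. all: by end_near. Qed.

(** A pointwise defined candidate for the limit of a sequence of functions; it
    is measurable whatever the sequence does, and it depends only on the values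
    of the sequence at the point, so that it inherits every pointwise symmetry
    of the sequence. *)
Definition clim (z : nat -> R[i]) : R[i] :=
  (fine (limn_esup (fun n => (rp (z n))%:E)) +i*
   fine (limn_esup (fun n => (ip (z n))%:E)))%C.

Lemma cvg_EFinn (r : nat -> R) (l : R) : r n @[n --> \oo] --> l ->
  (r n)%:E @[n --> \oo] --> l%:E.
Proof. by move=> rl; apply/fine_cvgP; split; [exact: nearW|exact: rl]. Qed.

Lemma climE z l : ccvg z l -> clim z = l.
Proof.
have H (r : nat -> R) m : r n @[n --> \oo] --> m ->
    fine (limn_esup (fun n => (r n)%:E)) = m.
  move=> rm; have /cvg_limn_einf_sup[_ ->//] : (r n)%:E @[n --> \oo] --> m%:E.
  exact: cvg_EFinn.
by move=> [zr zi]; apply: eq_coord; rewrite /clim /=; exact: H.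
Qed.

Lemma limn_einf_le (a b : nat -> \bar R) (c : \bar R) :
  (forall n, (a n <= b n)%E) -> b n @[n --> \oo] --> c -> (limn_einf a <= c)%E.
Proof.
move=> ab bc; rewrite limn_einf_lim -(cvg_lim _ bc)//.
apply: lee_lim; [exact: is_cvg_einfs|by apply/cvg_ex; exists c|].
apply: nearW => n; apply: le_trans (ab n).
by apply: ereal_inf_lbound; exists n => /=.
Qed.

Lemma limn_einf_ge0 (a : nat -> \bar R) :
  (forall n, (0 <= a n)%E) -> (0 <= limn_einf a)%E.
Proof.
move=> a0; rewrite limn_einf_lim; apply: lime_ge; first exact: is_cvg_einfs.
by apply: nearW => n; apply/ereal_infP => _ [k _ <-].
Qed.

End ComplexLimits.

Section Completeness.
Context d (T : measurableType d) (R : realType).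
Implicit Types g : nat -> T -> R[i].

Lemma cmeasurable_clim g : (forall n, cmeasurable (g n)) ->
  cmeasurable (fun x => clim (g ^~ x)).
Proof.
move=> mg; split.
  apply: (measurableT_comp (f:=fine)) => //.
  apply: measurable_fun_limn_esup => n; apply/measurable_EFinP.
  exact: (mg n).1.
apply: (measurableT_comp (f:=fine)) => //.
apply: measurable_fun_limn_esup => n; apply/measurable_EFinP.
exact: (mg n).2.
Qed.

Lemma cmeasurable_cvg g (f : T -> R[i]) : (forall n, cmeasurable (g n)) ->
  (forall x, ccvg (g ^~ x) (f x)) -> cmeasurable f.
Proof.
move=> mg gf; rewrite (_ : f = fun x => clim (g ^~ x)).
  exact: cmeasurable_clim.
by apply/funext => x; rewrite (climE (gf x)).
Qed.

Variable mu : {measure set T -> \bar R}.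

Lemma summable_ae (a : nat -> T -> R) (c : nat -> R) :
  (forall n, measurable_fun setT (a n)) -> (forall n x, 0 <= a n x) ->
  (forall n, (\int[mu]_x (a n x)%:E <= (c n)%:E)%E) ->
  (\sum_(0 <= n <oo) (c n)%:E < +oo)%E ->
  {ae mu, forall x, exists S : R, forall n, a n x <= S}.
Proof.
move=> ma a0 ac csum.
pose s x := (\sum_(0 <= n <oo) (a n x)%:E)%E.
have s0 x : (0 <= s x)%E by apply: nneseries_ge0 => n _ _; rewrite lee_fin.
have ms : measurable_fun setT s.
  apply: ge0_emeasurable_sum => // n *; first by rewrite lee_fin.
  exact/measurable_EFinP.
have is_ : mu.-integrable setT s.
  apply/integrableP; split => //.
  rewrite (eq_integral s) => [|x _]; last by rewrite gee0_abs.
  rewrite /s integral_nneseries//.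
  - apply: le_lt_trans csum; apply: lee_nneseries => n *; last exact: ac.
    by apply: integral_ge0 => x _; rewrite lee_fin.
  - by move=> n; exact/measurable_EFinP.
  - by move=> n x _; rewrite lee_fin.
have := integrable_ae measurableT is_.
apply: filterS => x /(_ I) sfin; exists (fine (s x)) => n.
rewrite -lee_fin fineK// /s.
apply: le_trans (nneseries_lim_ge n.+1 _); last by move=> k _; rewrite lee_fin.
rewrite big_nat_recr//= leeDr// sume_ge0// => k _.
by rewrite lee_fin.
Qed.

Local Notation L2 := (L2 mu).
Local Notation sqnorm := (sqnorm mu).
Local Notation energy := (energy mu).

(** With squared norms below 8^-n, the sum of 4^n |g_(n+1) - g_n|^2 is finite
    almost everywhere, so that |g_(n+1) - g_n| is there at most of order 2^-n. *)
Lemma L2_cauchy_ae g : (forall n, L2 (g n)) ->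
  (forall n, sqnorm (fun x => g n.+1 x - g n x) <= 8^-1 ^+ n) ->
  {ae mu, forall x, ccvg (g ^~ x) (clim (g ^~ x))}.
Proof.
move=> gL gc.
pose a n x := 4 ^+ n * sqn (g n.+1 x - g n x).
have : {ae mu, forall x, exists S : R, forall n, a n x <= S}.
  apply: (@summable_ae _ (fun n => 2^-1 ^+ n)).
  - move=> n; apply: measurable_funM => //; apply: measurable_sqn.
    by case: (L2B (gL n.+1) (gL n)).
  - by move=> n x; rewrite mulr_ge0 ?exprn_ge0// sqn_ge0.
  - move=> n; rewrite /a; under eq_integral do rewrite EFinM.
    rewrite ge0_integralZl//.
    + rewrite -/(energy _) (sqnormE (L2B (gL n.+1) (gL n))) -EFinM lee_fin.
      rewrite (_ : 2^-1 = 4 * 8^-1); last by field.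
      by rewrite exprMn ler_wpM2l// exprn_ge0.
    + by apply/measurable_EFinP/measurable_sqn; case: (L2B (gL n.+1) (gL n)).
    + by move=> x _; rewrite lee_fin sqn_ge0.
  - have := @cvg_geometric_series R 1 2^-1.
    rewrite ger0_norm// invf_lt1// ltr1n => /(_ isT) cg.
    rewrite (_ : (\sum_(0 <= n <oo) _)%E = (1 / (1 - 2^-1))%:E) ?ltry//.
    apply/cvg_lim => //.
    rewrite (_ : (fun _ => _) = EFin \o series (geometric 1 2^-1)).
      exact: cvg_EFinn.
    apply/funext => n /=; rewrite -sumEFin; apply: eq_bigr => k _.
    by rewrite /geometric /= mul1r.
apply: filterS => x [S aS].
have S0 : 0 <= S.
  by apply: le_trans (aS 0%N); rewrite mulr_ge0 ?exprn_ge0// sqn_ge0.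
have dS n : sqn (g n.+1 x - g n x) <= (Num.sqrt S * 2^-1 ^+ n) ^+ 2.
  rewrite exprMn sqr_sqrtr// -exprM mulnC exprM.
  have -> : 2^-1 ^+ 2 = 4^-1 :> R by field.
  by rewrite exprVn ler_pdivlMr ?exprn_gt0// [leLHS]mulrC; exact: aS.
have H (r : nat -> R) :
    (forall n, `|r n.+1 - r n| <= Num.sqrt S * 2^-1 ^+ n) -> cvgn r.
  move=> rS.
  have -> : r = (fun n => r 0%N + series (telescope r) n).
    by apply/funext => n; rewrite -eq_sum_telescope.
  apply: is_cvgD; first exact: is_cvg_cst.
  apply: normed_cvg; apply: (@series_le_cvg _ _ (geometric (Num.sqrt S) 2^-1)).
  - by move=> n; rewrite normr_ge0.
  - by move=> n; rewrite /geometric mulr_ge0 ?sqrtr_ge0// exprn_ge0.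
  - exact: rS.
  - by apply: is_cvg_geometric_series; rewrite ger0_norm// invf_lt1// ltr1n.
have S2 n : 0 <= Num.sqrt S * 2^-1 ^+ n.
  by rewrite mulr_ge0 ?sqrtr_ge0// exprn_ge0.
have nS n : normc (g n.+1 x - g n x) <= Num.sqrt S * 2^-1 ^+ n.
  rewrite -(@ler_pXn2r _ 2)// ?nnegrE ?normc_ge0//.
  by rewrite sqr_normc.
have cr : cvgn (fun n => rp (g n x)).
  by apply: H => n; apply: le_trans (nS n); rewrite -rpN -rpD normr_rp_le.
have ci : cvgn (fun n => ip (g n x)).
  by apply: H => n; apply: le_trans (nS n); rewrite -ipN -ipD normr_ip_le.
have cg : ccvg (g ^~ x)
    (limn (fun n => rp (g n x)) +i* limn (fun n => ip (g n x)))%C.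
  by split.
by rewrite (climE cg).
Qed.

Lemma energy_fatou g (f : T -> R[i]) (c : nat -> R) (l : R) :
  (forall n, cmeasurable (g n)) -> cmeasurable f ->
  {ae mu, forall x, ccvg (g ^~ x) (f x)} ->
  (forall n, (energy (g n) <= (c n)%:E)%E) -> c n @[n --> \oo] --> l ->
  (energy f <= l%:E)%E.
Proof.
move=> mg mf gf gc cl; rewrite /energy.
have msg n : measurable_fun setT (fun x => (sqn (g n x))%:E).
  exact/measurable_EFinP/measurable_sqn.
rewrite (@ge0_ae_eq_integral _ _ _ _ _ _
  (fun x => limn_einf (fun n => (sqn (g n x))%:E)))//.
- apply: le_trans (fatou _ _ _ _) _ => //.
    by move=> n x _; rewrite lee_fin sqn_ge0.
  by apply: limn_einf_le gc _; exact: cvg_EFinn.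
- exact/measurable_EFinP/measurable_sqn.
- apply: measurableT_comp => //; apply: measurable_fun_limn_esup => n.
  by apply: measurableT_comp.
- by move=> x _; rewrite lee_fin sqn_ge0.
- by move=> x _; apply: limn_einf_ge0 => n; rewrite lee_fin sqn_ge0.
- apply: filterS gf => x /cvg_sqn gfx _.
  by have [-> _] := cvg_limn_einf_sup (cvg_EFinn gfx).
Qed.

(** Riesz-Fischer: the bound of the squared distance to h is that of the
    Cauchy condition, by Fatou's lemma. *)
Theorem L2_complete g : (forall n, L2 (g n)) ->
  (forall n k, (n <= k)%N -> sqnorm (fun x => g k x - g n x) <= 8^-1 ^+ n) ->
  let h x := clim (g ^~ x) in
  L2 h /\ forall n, L2 (fun x => h x - g n x) /\
    sqnorm (fun x => h x - g n x) <= 8^-1 ^+ n.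
Proof.
move=> gL gc h.
have mh : cmeasurable h by apply: cmeasurable_clim => n; case: (gL n).
have gh : {ae mu, forall x, ccvg (g ^~ x) (h x)}.
  by apply: L2_cauchy_ae => // n; exact: gc.
have hn n : L2 (fun x => h x - g n x) /\ sqnorm (fun x => h x - g n x) <= 8^-1 ^+ n.
  have mhn : cmeasurable (fun x => h x - g n x).
    apply: cmeasurableD => //; under eq_fun do rewrite -mulN1r.
    by apply: cmeasurableZ; case: (gL n).
  have En : (energy (fun x => h x - g n x)%R <= (8^-1 ^+ n)%:E)%E.
    apply: (@energy_fatou (fun k x => g (k + n)%N x - g n x) _
              (fun=> 8^-1 ^+ n)) => //.
    - by move=> k; case: (L2B (gL (k + n)%N) (gL n)).
    - apply: filterS gh => x [gr gi]; apply: ccvgB; last exact: ccvg_cst.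
      split; [have := gr|have := gi];
        by rewrite -(cvg_shiftn n).
    - by move=> k; rewrite (sqnormE (L2B (gL (k + n)%N) (gL n))) lee_fin gc// leq_addl.
    - exact: cvg_cst.
  have Ln : L2 (fun x => h x - g n x).
    by split => //; apply: le_lt_trans En _; rewrite ltry.
  by split=> //; rewrite -lee_fin -sqnormE.
split=> //; have := L2D (hn 0%N).1 (gL 0%N).
by under eq_fun do rewrite subrK.
Qed.

(** ** Riesz representation *)

Implicit Types (X : set (T -> R[i])) (l : (T -> R[i]) -> R).

(** A linear subspace of L^2, stable under the pointwise limits [clim]; the
    closedness in norm follows from [L2_complete]. *)
Definition L2_subspace X :=
  [/\ X `<=` L2, X (fun=> 0),
      forall (c : R[i]) (f g : T -> R[i]), X f -> X g -> X (fun x => f x + c * g x) &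
      forall g, (forall n, X (g n)) -> L2 (fun x => clim (g ^~ x)) ->
        X (fun x => clim (g ^~ x))].

(** The functional f |-> |f|^2 - 2 l f is bounded below; by the parallelogram
    identity a minimizing sequence is Cauchy, and the vanishing of the first
    variation at its limit h says that h represents l. The first variation is
    estimated at the members of the sequence and passes to the limit through
    inner products, which are continuous, while l is linear only. *)
Theorem riesz X l (B : R) : L2_subspace X ->
  (forall (r : R) (f g : T -> R[i]), X f -> X g ->
    l (fun x => f x + r%:C%C * g x) = l f + r * l g) ->
  (forall f, X f -> 2 * l f <= sqnorm f + B) ->
  exists2 h, X h & forall f, X f -> rp (inner mu h f) = l f.
Proof.
move=> [XL X0 XD Xlim] lD lB.
pose J f := sqnorm f - 2 * l f.
have JD (r : R) (f g : T -> R[i]) : X f -> X g -> J (fun x => f x + r%:C%C * g x) =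
    J f + 2 * r * (rp (inner mu f g) - l g) + r ^+ 2 * sqnorm g.
  move=> Xf Xg; have [fL gL] := (XL _ Xf, XL _ Xg).
  rewrite /J lD// sqnormD//; last exact: L2Z.
  by rewrite sqnormZ// innerZr// /sqn !coordE; ring.
pose m := inf [set J f | f in X].
have Jm f : X f -> m <= J f.
  move=> Xf; apply: ge_inf; last by exists f.
  by exists (- B) => _ [g Xg <-]; rewrite /J; have := lB _ Xg; lra.
have mP n : exists f, X f /\ J f < m + 8^-1 ^+ n / 4.
  have : has_inf [set J f | f in X].
    split; first by exists (J (fun=> 0)), (fun=> 0).
    by exists (- B) => _ [g Xg <-]; rewrite /J; have := lB _ Xg; lra.
  move=> /(inf_adherent (_ : 0 < 8^-1 ^+ n / 4))[].
    by rewrite divr_gt0// exprn_gt0.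
  by move=> _ [f Xf <-] Jf; exists f.
have [g gP] := choice mP.
have gX n : X (g n) by case: (gP n).
have gL n : L2 (g n) by exact: XL.
have par n k : sqnorm (fun x => g k x - g n x) <= 8^-1 ^+ n / 2 + 8^-1 ^+ k / 2.
  have Xnk : X (fun x => g k x + (- 1)%:C%C * g n x) by exact: XD.
  have -> : (fun x => g k x - g n x) = (fun x => g k x + (- 1)%:C%C * g n x).
    by apply/funext => x; rewrite rmorphN mulN1r.
  have := Jm _ (XD (- 2^-1)%:C%C _ _ (gX k) Xnk).
  rewrite JD//.
  have [_ Jn] := gP n; have [_ Jk] := gP k.
  have Jn' : J (g n) = J (fun x => g k x + (-1)%:C%C * (g k x + (-1)%:C%C * g n x)).
    by congr J; apply/funext => x; rewrite rmorphN; ring.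
  move: Jn; rewrite Jn' JD//.
  set e := sqnorm _; set p := _ - _.
  by lra.
have gc n k : (n <= k)%N -> sqnorm (fun x => g k x - g n x) <= 8^-1 ^+ n.
  move=> nk; apply: le_trans (par n k) _.
  have : 8^-1 ^+ k <= 8^-1 ^+ n :> R.
    by rewrite ler_wiXn2l// invf_le1// ler1n.
  lra.
have [hL hn] := L2_complete gL gc.
set h := (fun x => clim (g ^~ x)) in hL hn.
have hX : X h by exact: Xlim.
exists h => // f fX; have fL := XL _ fX.
suff H (r : R) : 0 <= 2 * r * (rp (inner mu h f) - l f) + r ^+ 2 * sqnorm f.
  set p := rp _ - l f in H.
  suff p2 : p ^+ 2 <= 0.
    have : p = 0 by apply/eqP; rewrite -sqrf_eq0 eq_le p2 sqr_ge0.
    by move=> /eqP; rewrite subr_eq0 => /eqP.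
  have [e0|e0] := eqVneq (sqnorm f) 0.
    have := H (- p); rewrite e0 mulr0 addr0.
    by rewrite (_ : 2 * - p * p = - (2 * p ^+ 2)); [lra|ring].
  have e0' : 0 < sqnorm f by rewrite lt_neqAle eq_sym e0 sqnorm_ge0.
  have := H (- p / sqnorm f).
  have -> : 2 * (- p / sqnorm f) * p + (- p / sqnorm f) ^+ 2 * sqnorm f = - (p ^+ 2 / sqnorm f).
    by field.
  by rewrite oppr_ge0 pmulr_lle0 ?invr_gt0.
(* the first variation at g n, up to an error that vanishes with n *)
have Hn n : - (8^-1 ^+ n / 4) <=
    2 * r * (rp (inner mu (g n) f) - l f) + r ^+ 2 * sqnorm f.
  have := Jm _ (XD r%:C%C _ _ (gX n) fX); rewrite JD//.
  by have [_] := gP n; lra.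
(* |<h - g n, f>| <= (2^n |h - g n|^2 + 2^-n |f|^2) / 2 <= 2^-n (1 + |f|^2) / 2 *)
have In n : `|rp (inner mu h f) - rp (inner mu (g n) f)| <=
    2^-1 ^+ n * (1 + sqnorm f).
  have [dL dn] := hn n.
  have -> : rp (inner mu h f) - rp (inner mu (g n) f) =
      rp (inner mu (fun x => h x - g n x) f).
    rewrite (_ : inner mu h f = inner mu (fun x => (h x - g n x) + g n x) f).
      by rewrite innerDl// rpD addrK.
    by congr inner; apply/funext => x; rewrite subrK.
  apply: le_trans (inner_rp_le _ _ (s := 2 ^+ n) _) _ => //.
  have : 2 ^+ n * sqnorm (fun x => h x - g n x) <= 2^-1 ^+ n.
    apply: le_trans (ler_wpM2l _ dn) _; first by rewrite exprn_ge0.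
    rewrite -exprMn; have -> : 2 * 8^-1 = 4^-1 :> R by field.
    by rewrite lerXn2r ?nnegrE//; lra.
  rewrite -exprVn; have := sqnorm_ge0 mu f.
  have : 0 <= 2^-1 ^+ n :> R by rewrite exprn_ge0.
  nra.
have cvg2 : 2^-1 ^+ n @[n --> \oo] --> (0 : R).
  by apply: cvg_expr; rewrite ger0_norm// invf_lt1// ltr1n.
have c1 : 2 * r * (rp (inner mu (g n) f) - l f) + r ^+ 2 * sqnorm f @[n --> \oo] -->
    2 * r * (rp (inner mu h f) - l f) + r ^+ 2 * sqnorm f.
  apply: cvgD; last exact: cvg_cst.
  apply: cvgMr; apply: cvgB; last exact: cvg_cst.
  apply/subr_cvg0; apply/norm_cvg0P.
  apply: (squeeze_cvgr (f := fun=> 0) (h := fun n => 2^-1 ^+ n * (1 + sqnorm f))).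
  - by apply: nearW => n; rewrite normr_ge0 distrC In.
  - exact: cvg_cst.
  - by rewrite -[X in _ --> X](mul0r (1 + sqnorm f)); exact: cvgMl.
have c2 : - (8^-1 ^+ n / 4) @[n --> \oo] --> (0 : R).
  rewrite -oppr0; apply: cvgN; rewrite -[X in _ --> X](mul0r 4^-1); apply: cvgMl.
  by apply: cvg_expr; rewrite ger0_norm// invf_lt1// ltr1n.
rewrite -(cvg_lim _ c2)// -(cvg_lim _ c1)//.
apply: ler_lim; [by apply/cvg_ex; exists 0|by apply/cvg_ex; eexists; exact: c1|].
by apply: nearW => n; exact: Hn.
Qed.

End Completeness.

(** * L^p seminorms and energies *)

Section LpEnergy.
Context d (T : measurableType d) (R : realType).
Variable mu : {measure set T -> \bar R}.
Implicit Types f : T -> R[i].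

Lemma Lpnorm2X f : (Lpnorm mu 2 f `^ 2)%E = energy mu f.
Proof.
rewrite /Lpnorm (poweR_Lnorm mu _ (r := 2))//.
apply: eq_integral => x _ /=.
rewrite ger0_norm ?normc_ge0//; congr EFin.
by rewrite -sqr_normc powR_mulrn// normc_ge0.
Qed.

Lemma Lpnorm2E f : L2 mu f -> Lpnorm mu 2 f = (Num.sqrt (sqnorm mu f))%:E.
Proof.
move=> fL; have := poweRrM (Lpnorm mu 2 f) 2 2^-1.
rewrite divff// poweRe1 ?Lnorm_ge0// => ->.
by rewrite Lpnorm2X sqnormE// poweR_EFin powR12_sqrt// sqnorm_ge0.
Qed.

Lemma isLp2P f : isLp mu 2 f <-> L2 mu f.
Proof.
split=> [[mf fN]|fL].
  split=> //; rewrite -Lpnorm2X.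
  move: fN; have := Lnorm_ge0 mu 2%:E (EFin \o (@normc R \o f)).
  rewrite -/(Lpnorm mu 2 f).
  by case: (Lpnorm mu 2 f) => [r| |]// _ _; rewrite poweR_EFin ltry.
by split; [case: fL|rewrite Lpnorm2E// ltry].
Qed.

Lemma isLp1P f : isLp mu 1 f <-> cintegrable mu f.
Proof.
rewrite /isLp /Lpnorm Lnorm1.
have -> : (\int[mu]_x `|(EFin \o (@normc R \o f)) x| = \int[mu]_x (normc (f x))%:E)%E.
  by apply: eq_integral => x _ /=; rewrite ger0_norm// normc_ge0.
split=> [[mf fi]|fi]; first exact: cintegrableP.
split; first exact: cintegrable_meas fi.
have /integrableP[_] := cintegrable_normc fi.
rewrite (eq_integral (fun x => (normc (f x))%:E))// => x _ /=.
by rewrite ger0_norm// normc_ge0.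
Qed.

Lemma ae_mono (P Q : T -> Prop) : (forall x, P x -> Q x) ->
  {ae mu, forall x, P x} -> {ae mu, forall x, Q x}.
Proof. exact: filterS. Qed.

Lemma ae_mono2 (P P' Q : T -> Prop) : (forall x, P x -> P' x -> Q x) ->
  {ae mu, forall x, P x} -> {ae mu, forall x, P' x} -> {ae mu, forall x, Q x}.
Proof. exact: filterS2. Qed.

End LpEnergy.

(** * Continuity of complex functions *)

Section ComplexContinuity.
Context (T : topologicalType) (R : realType).
Implicit Types f : T -> R[i].

Definition ccont f :=
  continuous (fun x => rp (f x) : R) /\ continuous (fun x => ip (f x) : R).

Lemma normcC (z : R[i]) : `|z| = (normc z)%:C%C.
Proof. by []. Qed.

Lemma ltcR_normc (z : R[i]) (e : R) : (`|z| < e%:C%C) = (normc z < e).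
Proof. by rewrite normcC ltcR. Qed.

Lemma continuous_ccont f : continuous (f : T -> R[i]^o) <-> ccont f.
Proof.
have posC (e : R) : 0 < e -> (0 : R[i]) < e%:C%C by move=> e0; rewrite ltcR.
split=> [cf|[cr ci]].
  split=> x; apply/cvgrPdist_lt => e e0;
    have /(@cvgrPdist_lt _ R[i]^o) := cf x => /(_ _ (posC _ e0));
    apply: filterS => y; rewrite ltcR_normc; apply: le_lt_trans.
    by rewrite -rpN -rpD normr_rp_le.
  by rewrite -ipN -ipD normr_ip_le.
move=> x; apply/(@cvgrPdist_lt _ R[i]^o) => e e0.
have eE : e = (rp e)%:C%C.
  by move: e0; case: (e) => a b; rewrite ltcE /= => /andP[/eqP -> _].
have e0' : 0 < rp e by rewrite -ltcR -eE.
have half0 : 0 < rp e / 2 by rewrite divr_gt0.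
have /cvgrPdist_lt/(_ _ half0) h1 := cr x; have /cvgrPdist_lt/(_ _ half0) h2 := ci x.
near=> y; rewrite eE ltcR_normc.
apply: le_lt_trans (normc_le_coord _) _; rewrite !coordE.
rewrite [ltRHS]splitr ltrD//; first by near: y.
by near: y.
Unshelve. all: by end_near. Qed.

Lemma ccont_cst (c : R[i]) : ccont (fun=> c).
Proof. by split=> x; exact: cvg_cst. Qed.

Lemma ccontM f g : ccont f -> ccont g -> ccont (fun x => f x * g x).
Proof.
move=> [fr fi] [gr gi]; split=> x; rewrite /continuous_at ?rpM ?ipM.
  under eq_fun do rewrite rpM.
  by apply: cvgB; apply: cvgM; [exact: fr|exact: gr|exact: fi|exact: gi].
under eq_fun do rewrite ipM.
by apply: cvgD; apply: cvgM; [exact: fr|exact: gi|exact: fi|exact: gr].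
Qed.

Lemma ccontJ f : ccont f -> ccont (fun x => (f x)^*).
Proof.
move=> [fr fi]; split=> x; rewrite /continuous_at ?rpJ ?ipJ.
  by under eq_fun do rewrite rpJ; exact: fr.
by under eq_fun do rewrite ipJ; apply: cvgN; exact: fi.
Qed.

Lemma ccont_real (r : T -> R) : continuous r -> ccont (fun x => (r x)%:C%C).
Proof. by move=> cr; split=> //= x; exact: cvg_cst. Qed.

Lemma ccont_sqn f : ccont f -> continuous (fun x => sqn (f x)).
Proof.
move=> [fr fi] x; rewrite /sqn /continuous_at.
apply: cvgD; rewrite !expr2; under eq_fun do rewrite expr2; apply: cvgM;
  [exact: fr|exact: fr|exact: fi|exact: fi].
Qed.

End ComplexContinuity.

Lemma ccont_comp (R : realType) (S T : topologicalType) (f : T -> R[i]) (h : S -> T) :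
  ccont f -> continuous h -> ccont (f \o h).
Proof.
move=> [fr fi] ch; split=> x.
  by apply: (@continuous_comp _ _ _ h (fun y => rp (f y) : R)); [exact: ch|exact: fr].
by apply: (@continuous_comp _ _ _ h (fun y => ip (f y) : R)); [exact: ch|exact: fi].
Qed.

(** * Borel measurability of continuous functions *)

Section BorelContinuity.
Context (R : realType) (T : ptopologicalType).

Lemma open_borel (U : set T) : open U -> measurable (U : set (borel T)).
Proof. by move=> oU; apply: sub_sigma_algebra. Qed.

Lemma compact_borel (C : set T) : hausdorff_space T -> compact C ->
  measurable (C : set (borel T)).
Proof.
move=> hT /(compact_closed hT) cC; rewrite -[C]setCK; apply: measurableC.
by apply: open_borel; exact: closed_openC.
Qed.

Lemma continuous_borel (S : ptopologicalType) (f : T -> S) : continuous f ->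
  measurable_fun setT (f : borel T -> borel S).
Proof.
move=> /continuousP cf; apply: (@measurability _ _ (borel T) (borel S) setT f (@open S)) => //.
by move=> _ [U oU <-]; rewrite setTI; apply: open_borel; exact: cf.
Qed.

Lemma continuous_borelR (f : T -> R) : continuous f ->
  measurable_fun setT (f : borel T -> R).
Proof.
move=> /continuousP cf; apply: (measurability _ (RGenOpens.measurableE R)).
move=> _ [_ [a [b ->] <-]]; rewrite setTI; apply: open_borel.
exact/cf/interval_open.
Qed.

Lemma ccont_cmeasurable (f : T -> R[i]) : ccont f ->
  @cmeasurable _ (borel T) R f.
Proof. by move=> [fr fi]; split; exact: continuous_borelR. Qed.

End BorelContinuity.

(** * The space L^2(G//K) *)

Section BiinvariantL2.
Context (R : realType) (G : topologicalGroupType).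
Variables (mu : {measure set (borel G) -> \bar R}) (K : set G).

Lemma LpK2P (f : G -> R[i]) : LpK mu K 2 f <-> L2 mu f /\ biinv_ae mu K f.
Proof. by rewrite /LpK; split=> -[/isLp2P]. Qed.

Lemma LpK2_subspace : L2_subspace mu (LpK mu K 2).
Proof.
split.
- by move=> f /LpK2P[].
- apply/LpK2P; split; last by move=> *; apply: aeW.
  split; first exact: cmeasurable_cst.
  by rewrite /energy; under eq_integral do rewrite sqn0; rewrite integral0 ltry.
- move=> c f g /LpK2P[fL fK] /LpK2P[gL gK]; apply/LpK2P; split.
    by apply: L2D => //; exact: L2Z.
  move=> k k' Kk Kk'; have := fK _ _ Kk Kk'; have := gK _ _ Kk Kk'.
  by apply: ae_mono2 => x -> ->.
- move=> g gX hL; apply/LpK2P; split=> // k k' Kk Kk'.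
  have : {ae mu, forall x, forall n, g n (k * x * k')%g = g n x}.
    by apply: ae_foralln => n; have /LpK2P[_] := gX n; exact.
  by apply: ae_mono => x gx; congr clim; apply/funext => n; exact: gx.
Qed.

(** Orthogonal projection onto L^2(G//K), which plays the part of the average
    of h over K x K. *)
Lemma LpK2_projection (h : G -> R[i]) : L2 mu h ->
  exists2 p, LpK mu K 2 p &
    (forall g, LpK mu K 2 g -> inner mu p g = inner mu h g) /\
    sqnorm mu p <= sqnorm mu h.
Proof.
move=> hL; have X := LpK2_subspace; have [XL X0 XD _] := X.
have [p pX pE] : exists2 p, LpK mu K 2 p &
    forall f, LpK mu K 2 f -> rp (inner mu p f) = rp (inner mu h f).
  apply: (riesz (B := sqnorm mu h) X) => [r f g fX gX|f fX].
    by rewrite innerDr ?innerZr ?coordE//;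
      [ring|exact: XL..|apply: L2Z; exact: XL].
  have := inner_rp_le ltr01 hL (XL _ fX); rewrite invr1 !mul1r => H.
  by have := ler_norm (rp (inner mu h f)); lra.
have pL := XL _ pX.
exists p => //; split.
  move=> g gX; have gL := XL _ gX.
  apply: eq_coord; first exact: pE.
  have igX : LpK mu K 2 (fun x => iunit * g x).
    by have := XD iunit _ _ X0 gX; under eq_fun do rewrite add0r; exact.
  by have := pE _ igX; rewrite !innerZr// !coordE; lra.
have := pE _ pX; rewrite inner_self rpC => pp.
have := inner_rp_le ltr01 hL pL; rewrite invr1 !mul1r -pp.
by rewrite ger0_norm ?sqnorm_ge0//; lra.
Qed.

End BiinvariantL2.

(** * Compact sets *)

Section CompactSets.
Context (T : ptopologicalType).

(** Finitely many of the neighbourhoods that satisfy P cover C. *)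
Lemma compact_induction (P : set T -> Prop) (C : set T) :
  P set0 -> (forall A B, P A -> P B -> P (A `|` B)) ->
  (forall A B, A `<=` B -> P B -> P A) ->
  (forall x, C x -> exists2 U, nbhs x U & P U) -> compact C -> P C.
Proof.
move=> P0 PU PS PC; rewrite compact_cover => cC.
have /choice[U UP] : forall x, exists U, C x -> nbhs x U /\ P U.
  move=> x; have [Cx|nCx] := pselect (C x); last by exists set0.
  by have [U ? ?] := PC _ Cx; exists U.
have [|x Cx|D DC CD] := cC T C (fun x => interior (U x)).
- by move=> x _; exact: open_interior.
- by exists x => //; exact: (UP x Cx).1.
apply: (PS _ _ CD); rewrite /cover bigcup_fset.
rewrite big_seq; apply: big_ind => // x xD.
have Cx : C x by apply/set_mem; exact: DC.
by have [_] := UP _ Cx; apply: PS; exact: interior_subset.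
Qed.

(** Such a map replaces a continuous parameter by finitely many values, so that
    integrals over the parameter become finite sums. *)
Definition finite_map (tau : T -> T) := (exists s : seq T, forall t, tau t \in s) /\
  forall y, measurable (tau @^-1` [set y] : set (borel T)).

(** A compact set is decomposed into finitely many Borel pieces on each of which
    a locally satisfiable closeness requirement holds between the points of the
    piece and one reference point. *)
Lemma finite_selection (E : T -> T -> Prop) (C : set T) : compact C ->
  (forall y, \forall t \near y, E y t) ->
  exists2 tau, finite_map tau & forall t, C t -> E (tau t) t.
Proof.
move=> cC HE.
suff [A [tau [_ CA ft At]]] : exists A tau, [/\ measurable (A : set (borel T)),
    C `<=` A, finite_map tau & forall t, A t -> E (tau t) t].
  by exists tau => // t /CA/At.
have fc (x : T) : finite_map (fun=> x).
  split; first by exists [:: x] => t; rewrite mem_head.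
  move=> y; have [->|xy] := pselect (x = y).
    by rewrite (_ : _ @^-1` _ = setT); [exact: measurableT|apply/seteqP; split].
  by rewrite (_ : _ @^-1` _ = set0); [exact: measurable0|apply/seteqP; split].
pose P (B : set T) := exists A tau, [/\ measurable (A : set (borel T)),
    B `<=` A, finite_map tau & forall t, A t -> E (tau t) t].
suff : P C by [].
apply: (compact_induction _ _ _ _ cC).
- by exists set0, (fun=> point); split.
- move=> B B' [A [tau [mA BA [[s sP] mtau] At]]] [A' [tau' [mA' BA' [[s' sP'] mtau'] At']]].
  exists (A `|` A'), (fun t => if t \in A then tau t else tau' t); split.
  + exact: measurableU.
  + exact: setUSS.
  + split.
      exists (s ++ s') => t; rewrite mem_cat.
      by case: ifP; rewrite ?sP ?sP' ?orbT.
    move=> y; rewrite (_ : _ @^-1` _ =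
        (A `&` tau @^-1` [set y]) `|` (~` A `&` tau' @^-1` [set y])).
      exact: measurableU (measurableI _ _ mA (mtau y))
        (measurableI _ _ (measurableC mA) (mtau' y)).
    apply/seteqP; split=> t /=.
      case: ifPn => [/set_mem tA <-|]; first by left.
      by rewrite notin_setE => nAt <-; right.
    move=> [[/mem_set -> //]|[nAt]].
    by rewrite ifF//; apply: contra_notF nAt => /set_mem.
  + move=> t; case: ifPn => [/set_mem /At//|].
    by rewrite notin_setE => nAt [//|/At'].
- move=> B B' BB' [A [tau [mA BA ft At]]]; exists A, tau; split=> //.
  exact: subset_trans BA.
- move=> x _; exists [set t | E x t]°.
    by apply: nbhs_interior; exact: HE.
  exists [set t | E x t]°, (fun=> x); split=> //.
    by apply: open_borel; exact: open_interior.
  by move=> t /interior_subset.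
Qed.

End CompactSets.

(** The tube lemma, in terms of the near-covering property of D. *)
Lemma compact_tube (S T : topologicalType) (D : set T) (E : S -> T -> Prop) (s : S) :
  compact D -> (forall x, D x -> \forall x' \near x & t \near s, E t x') ->
  \forall t \near s, forall x, D x -> E t x.
Proof.
move=> /compact_near_coveringP cD HE.
have := cD S (nbhs s) E (nbhs_filter s) HE.
by apply: filterS => t Dt x /Dt.
Qed.

(** * Continuous functions with compact support *)

Section CompactSupport.
Context (R : realType) (T : ptopologicalType).
Implicit Types (r : T -> R) (C D U : set T).

Definition supported (V : nmodType) (f : T -> V) D := forall x, ~ D x -> f x = 0.

Hypothesis hausdorffT : hausdorff_space T.
Hypothesis lcT : locally_compact [set: T].

Lemma compact_nbhs (x : T) U : nbhs x U ->
  exists D, [/\ nbhs x D, compact D & D `<=` U].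
Proof.
move=> Ux; have [D] := @lcT x I; rewrite withinET => Dx [cD clD].
have [V Vx VU] := compact_regular hausdorffT cD Dx (filterI Ux Dx).
exists (closure V); split.
- by apply: filterS Vx; exact: subset_closure.
- apply: (subclosed_compact _ cD); first exact: closed_closure.
  by move=> y /VU[].
- by move=> y /VU[].
Qed.

(** Urysohn's lemma. Near a point, min 1 (2 (1 - f)) is built from a function f
    that vanishes at the point and is 1 off a compact neighbourhood; a maximum
    combines finitely many of these functions. *)
Lemma bump C U : compact C -> open U -> C `<=` U ->
  exists b : T -> R, exists D, [/\ continuous b, forall x, 0 <= b x <= 1,
    forall x, C x -> b x = 1, compact D & D `<=` U /\ supported b D].
Proof.
move=> cC oU CU.
pose P A := exists b : T -> R, exists D, [/\ continuous b, forall x, 0 <= b x <= 1,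
    forall x, A x -> b x = 1, compact D & D `<=` U /\ supported b D].
suff : P C by [].
apply: (compact_induction _ _ _ _ cC).
- exists (fun=> 0), set0; split=> //.
  + by move=> x; exact: cvg_cst.
  + by move=> x; rewrite lexx ler01.
  + exact: compact0.
  + by split=> // x.
- move=> A A' [b [D [cb b01 b1 cD [DU bD]]]] [b' [D' [cb' b01' b1' cD' [DU' bD']]]].
  exists (fun x => Num.max (b x) (b' x)), (D `|` D'); split.
  + by move=> x; apply: continuous_max; [exact: cb|exact: cb'].
  + move=> x; have /andP[h1 h2] := b01 x; have /andP[h1' h2'] := b01' x.
    by rewrite le_max h1 ge_max h2.
  + move=> x; have /andP[h1 h2] := b01 x; have /andP[h1' h2'] := b01' x.
    by move=> [/b1|/b1'] e; apply/eqP; rewrite eq_le ge_max h2 h2' le_max e lexx ?orbT.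
  + exact: compactU.
  + split; first by rewrite subUset.
    by move=> x /not_orP[/bD -> /bD' ->]; rewrite maxxx.
- by move=> A A' AA' [b [D [cb b01 b1 cD DU]]]; exists b, D; split=> // x /AA'/b1.
- move=> x /CU Ux.
  have [D [Dx cD DU]] := compact_nbhs (open_nbhs_nbhs (conj oU Ux)).
  have cl : closed (~` D°) by apply: open_closedC; exact: open_interior.
  have := locally_compact_completely_regular (R := R) lcT hausdorffT cl.
  move=> /(_ x (fun h => h Dx)) /(uniform_separatorP (R := R))[f [cf f01 f0 f1]].
  have f01' y : 0 <= f y <= 1.
    by have /(_ (f y)) := f01; rewrite /= in_itv /=; apply; exists y.
  have fx : f x = 0 by apply: f0; exists x.
  exists (f @^-1` [set r | r < 2^-1]).
    apply: cf; rewrite fx; apply: open_nbhs_nbhs; split; last by rewrite /= invr_gt0.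
    exact: open_lt.
  exists (fun y => Num.min 1 (2 * (1 - f y))), D; split.
  + move=> y; apply: (@continuous_min _ _ (fun=> 1) (fun z => 2 * (1 - f z))).
      exact: cvg_cst.
    by apply: cvgMr; apply: cvgB; [exact: cvg_cst|exact: cf].
  + move=> y; have /andP[h1 h2] := f01' y.
    by rewrite le_min ge_min ler01 lexx /= andbT mulr_ge0// subr_ge0.
  + by move=> y /= fy; apply/min_idPl; lra.
  + exact: cD.
  + split=> // y nDy; have -> : f y = 1.
      by apply: f1; exists y => // /interior_subset.
    by rewrite subrr mulr0 min_r.
Qed.

Definition Cc (r : T -> R) := continuous r /\ exists2 D, compact D & supported r D.

Definition Ccc (f : T -> R[i]) := ccont f /\ exists2 D, compact D & supported f D.

Lemma CcM (r b : T -> R) : continuous r -> Cc b -> Cc (fun x => r x * b x).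
Proof.
move=> cr [cb [D cD bD]]; split; first by move=> x; apply: cvgM; [exact: cr|exact: cb].
by exists D => // x /bD ->; rewrite mulr0.
Qed.

Lemma Cc_bounded r : Cc r -> exists2 M, 0 < M & forall x, `|r x| <= M.
Proof.
move=> [cr [D cD rD]].
have [M [Mr MD]] : bounded_set (r @` D).
  apply: compact_bounded; apply: continuous_compact cD.
  exact: continuous_subspaceT.
exists (Num.max (M + 1) 1) => [|x]; first by rewrite lt_max ltr01 orbT.
have [Dx|/rD ->] := pselect (D x); last by rewrite normr0 le_max ler01 orbT.
rewrite le_max; apply/orP; left; apply: MD; first by rewrite ltrDl.
by exists x.
Qed.

End CompactSupport.

(** * Integrals over a restricted measure and over a product *)

Section Restriction.
Context d (T : measurableType d) (R : realType).
Variable mu : {measure set T -> \bar R}.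

Lemma integrable_indicator (A : set T) : measurable A -> (mu A < +oo)%E ->
  mu.-integrable setT (fun x => (\1_A x)%:E).
Proof.
move=> mA Afin; apply/integrableP; split.
  by apply/measurable_EFinP; exact: measurable_indic.
rewrite (eq_integral (fun x => (\1_A x)%:E)) => [|x _].
  by rewrite integral_indic// setIT.
by rewrite gee0_abs// lee_fin.
Qed.

Lemma integral_mfrestr (A : set T) (mA : measurable A) (Afin : (mu A < +oo)%E)
    (f : T -> \bar R) : (forall x, ~ A x -> f x = 0%E) ->
  (\int[mu]_x f x = \int[mfrestr mA Afin]_x f x)%E.
Proof.
move=> fA; have fE : f \_ A = f.
  apply/funext => x; rewrite patchE; case: ifPn => //.
  by rewrite notin_setE => /fA ->.
rewrite -fE -!integral_mkcond; apply: eq_measure_integral => B mB BA /=.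
by rewrite /mfrestr /mrestr setIidl.
Qed.

End Restriction.

Lemma ge0_integral_image d d' (T : measurableType d) (S : measurableType d')
    (R : realType) (m : {measure set T -> \bar R}) (m' : {measure set S -> \bar R})
    (phi : T -> S) (f : S -> \bar R) : measurable_fun setT phi ->
  (forall A, measurable A -> m (phi @^-1` A) = m' A) ->
  measurable_fun setT f -> (forall y, (0 <= f y)%E) ->
  (\int[m]_x f (phi x) = \int[m']_y f y)%E.
Proof.
move=> mphi mm' mf f0.
have := ge0_integral_pushforward mphi m measurableT mf (fun y _ => f0 y).
rewrite preimage_setT => <-; apply: eq_measure_integral => A mA _.
exact: mm'.
Qed.

Section ProductMeasurability.
Context (R : realType) (T : ptopologicalType) d (S : measurableType d).

Lemma measurable_finite_map (tau : T -> T) (F : T -> S -> R) : finite_map tau ->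
  (forall y, measurable_fun setT (F y)) ->
  measurable_fun setT (fun p : borel T * S => F (tau p.1) p.2).
Proof.
move=> [[s sP] mtau] mF _ B mB; rewrite setTI.
rewrite (_ : _ @^-1` B =
    \big[setU/set0]_(y <- s) ((tau @^-1` [set y] : set (borel T)) `*` F y @^-1` B)).
  apply: bigsetU_measurable => y _; apply: measurableX; first exact: mtau.
  by rewrite -[X in measurable X]setTI; exact: mF.
rewrite -bigcup_seq; apply/seteqP; split=> -[t x] /=.
  by move=> h; exists (tau t) => //=; rewrite sP.
by move=> [y _ [/= <-]].
Qed.

Lemma cmeasurable_finite_map (tau : T -> T) (F : T -> S -> R[i]) : finite_map tau ->
  (forall y, cmeasurable (F y)) ->
  cmeasurable (fun p : borel T * S => F (tau p.1) p.2).
Proof.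
move=> ft mF; split.
  by apply: (measurable_finite_map (F := fun y x => rp (F y x))) => // y; case: (mF y).
by apply: (measurable_finite_map (F := fun y x => ip (F y x))) => // y; case: (mF y).
Qed.

Lemma measurable_indic_fst (C : set (borel T)) : measurable C ->
  measurable_fun setT (fun p : borel T * S => \1_C p.1 : R).
Proof.
move=> mC; apply: (measurableT_comp (f := \1_C : borel T -> R)).
  exact: measurable_indic.
exact: measurable_fst.
Qed.

End ProductMeasurability.

(** * Continuous functions on a topological group *)

Section GroupContinuity.
Context (G : topologicalGroupType).

Lemma continuous_mulg (S : topologicalType) (f g : S -> G) :
  continuous f -> continuous g -> continuous (fun x => (f x * g x)%g).
Proof.
move=> cf cg x.
apply: (@continuous_comp _ _ _ (fun x => (f x, g x)) (fun p : G * G => (p.1 * p.2)%g)).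
  by apply: cvg_pair; [exact: cf|exact: cg].
exact: mulg_continuous.
Qed.

Lemma continuous_invg (S : topologicalType) (f : S -> G) :
  continuous f -> continuous (fun x => (f x)^-1%g).
Proof. by move=> cf x; apply: continuous_comp; [exact: cf|exact: invg_continuous]. Qed.

Lemma continuous_lmul (x : G) : continuous (fun y : G => (x * y)%g).
Proof. by apply: continuous_mulg => y; [exact: cvg_cst|exact: cvg_id]. Qed.

Lemma continuous_rmul (x : G) : continuous (fun y : G => (y * x)%g).
Proof. by apply: continuous_mulg => y; [exact: cvg_id|exact: cvg_cst]. Qed.

Lemma compact_image2 (f : G * G -> G) (C D : set G) : continuous f ->
  compact C -> compact D -> compact (f @` (C `*` D)).
Proof.
move=> cf cC cD; apply: continuous_compact; last exact: compact_setX.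
exact: continuous_subspaceT.
Qed.

Lemma compact_image (f : G -> G) (C : set G) : continuous f ->
  compact C -> compact (f @` C).
Proof.
by move=> cf cC; apply: continuous_compact => //; exact: continuous_subspaceT.
Qed.

End GroupContinuity.

(** * Haar integrals *)

Section Haar.
Context (R : realType) (G : topologicalGroupType).
Variable mu : {measure set (borel G) -> \bar R}.
Hypothesis hausdorffG : hausdorff_space G.
Hypothesis lcG : locally_compact [set: G].
Hypothesis haar : left_haar mu.
Implicit Types (r b : G -> R) (C D : set G).

Lemma haar_compact C : compact C -> (mu C < +oo)%E.
Proof. by case: haar => -[+ _ _] _ _; exact. Qed.

Lemma Cc_integrable r : Cc r -> mu.-integrable setT (EFin \o r).
Proof.
move=> rC; have [M M0 rM] := Cc_bounded rC; have [cr [D cD rD]] := rC.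
have iD := integrable_indicator (compact_borel hausdorffG cD) (haar_compact cD).
apply: (integrable_dom (mu := mu) (b := fun x => (M%:E * (\1_D x)%:E)%E)).
- exact: continuous_borelR.
- exact: integrableZl.
- move=> x; rewrite -EFinM lee_fin indicE.
  have [Dx|nDx] := boolP (x \in D); first by rewrite mulr1.
  by rewrite mulr0 rD ?normr0// -notin_setE.
Qed.

Lemma Cc_measurable r : Cc r -> measurable_fun setT (EFin \o r : borel G -> \bar R).
Proof. by move=> [cr _]; apply/measurable_EFinP; exact: continuous_borelR. Qed.

Lemma measurable_lmul (x : G) :
  measurable_fun setT ((fun y => (x * y)%g) : borel G -> borel G).
Proof. by apply: continuous_borel; exact: continuous_lmul. Qed.

Lemma haar_preimage (x : G) (A : set (borel G)) : measurable A ->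
  mu ((fun y => (x * y)%g) @^-1` A) = mu A.
Proof.
move=> mA; have [_ H _] := haar; rewrite -(H x); last first.
  by rewrite -[X in measurable X]setTI; exact: measurable_lmul.
congr (mu _); apply/seteqP; split=> [_ [y /= Ay <-]//|y Ay].
by exists (x^-1 * y)%g; rewrite /= mulgA mulgV mul1g.
Qed.

Lemma haar_integral_ge0 (x : G) (F : borel G -> \bar R) : measurable_fun setT F ->
  (forall y, (0 <= F y)%E) -> (\int[mu]_y F (x * y)%g = \int[mu]_y F y)%E.
Proof.
move=> mF F0.
apply: (ge0_integral_image (measurable_lmul x)) => // A mA.
exact: haar_preimage.
Qed.

(** Finitely many translates of U cover a compact set: if U were null, so would
    be every compact set, hence the whole group by inner regularity. *)
Lemma haar_open_gt0 (U : set G) : open U -> U !=set0 -> (0 < mu U)%E.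
Proof.
move=> oU [u Uu]; rewrite lt0e measure_ge0 andbT; apply/eqP => U0.
have [[_ _ innerR] invl mu0] := haar.
have H (C : set G) : compact C -> mu C = 0%E.
  move=> cC; suff : exists A : set (borel G), [/\ measurable A, C `<=` A & mu A = 0%E].
    move=> [A [mA CA A0]]; apply/eqP; rewrite eq_le measure_ge0 andbT -A0.
    exact: (le_measure mu (mem_set (compact_borel hausdorffG cC)) (mem_set mA) CA).
  pose P (C : set G) := exists A : set (borel G), [/\ measurable A, C `<=` A & mu A = 0%E].
  suff : P C by [].
  apply: (compact_induction _ _ _ _ cC).
  - by exists set0; split.
  - move=> B B' [A [mA BA A0]] [A' [mA' BA' A0']]; exists (A `|` A'); split.
    + exact: measurableU.
    + exact: setUSS.
    + by rewrite measureU0.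
  - by move=> B B' BB' [A [mA BA A0]]; exists A; split=> //; exact: subset_trans BA.
  - move=> x _.
    have oV : open ((fun y => (u * x^-1 * y)%g) @^-1` U).
      by move/continuousP: (@continuous_lmul G (u * x^-1)%g); apply.
    exists ((fun y => (u * x^-1 * y)%g) @^-1` U).
      by apply: open_nbhs_nbhs; split=> //=; rewrite -mulgA mulVg mulg1.
    exists ((fun y => (u * x^-1 * y)%g) @^-1` U); split=> //.
      exact: open_borel.
    by rewrite haar_preimage//; exact: open_borel.
move/eqP: mu0; apply; apply/eqP; rewrite eq_le measure_ge0 andbT innerR; last exact: openT.
by apply: ge_ereal_sup => _ [C [cC _] <-]; rewrite H.
Qed.

(** If r x > 0, then r > r x / 2 on an open set, which has positive measure. *)
Lemma Cc_integral_eq0 r : Cc r -> (forall x, 0 <= r x) -> \int[mu]_x r x = 0 ->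
  forall x, r x = 0.
Proof.
move=> rC r0 I0 x; apply/eqP/negPn/negP => rx.
have rx0 : 0 < r x by rewrite lt_neqAle eq_sym rx r0.
pose U := [set y | r x / 2 < r y].
have oU : open U.
  have /continuousP cr := rC.1.
  exact: (cr [set a | r x / 2 < a] (@open_gt _ (r x / 2))).
have mU : measurable (U : set (borel G)) := open_borel oU.
have mI : measurable_fun setT (\1_U : borel G -> R) by exact: measurable_indic.
have Ux : U x by rewrite /U /=; lra.
have : ((r x / 2)%:E * mu U <= 0)%E.
  rewrite -(setIT U) -(integral_indic mu measurableT mU) -ge0_integralZl//.
  - have <- : (\int[mu]_y (r y)%:E)%E = 0%E.
      rewrite -[RHS](f_equal EFin I0) /Rintegral fineK//.
      by apply: integrable_fin_num => //; exact: Cc_integrable.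
    apply: ge0_le_integral => //.
    + by move=> y _; rewrite -EFinM lee_fin mulr_ge0// divr_ge0// ltW.
    + apply/measurable_EFinP; apply: measurable_funM => //; exact: mI.
    + exact: Cc_measurable.
    + move=> y _; rewrite -EFinM lee_fin indicE.
      have [|_] := boolP (y \in U); last by rewrite mulr0.
      by move=> /set_mem; rewrite /U /= mulr1 => /ltW.
  - by apply/measurable_EFinP; exact: mI.
  - by rewrite lee_fin divr_ge0// ltW.
apply/negP; rewrite -ltNge mule_gt0// ?lte_fin ?divr_gt0//.
by apply: haar_open_gt0 => //; exists x.
Qed.

Lemma Cc_integralZ_sub (r s : G -> R) (a c : R) : Cc r -> Cc s ->
  \int[mu]_x (a * r x - c * s x) = a * \int[mu]_x r x - c * \int[mu]_x s x.
Proof.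
move=> rC sC.
have iZ k q : Cc q -> mu.-integrable setT (EFin \o (fun x => k * q x)).
  move=> qC; rewrite (_ : _ \o _ = fun x => (k%:E * (EFin \o q) x)%E).
    by apply: integrableZl => //; exact: Cc_integrable.
  by apply/funext => x /=; rewrite EFinM.
rewrite RintegralB//; [|exact: iZ..].
by rewrite !RintegralZl//; exact: Cc_integrable.
Qed.

End Haar.

(** * Parameter-dependent Haar integrals *)

Section JointContinuity.
Context (R : realType) (S T : topologicalType).
Implicit Types Phi : S -> T -> R.

Definition jcont Phi := continuous (fun p : S * T => Phi p.1 p.2).

Lemma jcont_slice Phi t : jcont Phi -> continuous (Phi t).
Proof.
move=> cP x; apply: (@continuous_comp _ _ _ (fun y => (t, y))
  (fun p : S * T => Phi p.1 p.2)); last exact: cP.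
by apply: cvg_pair; [exact: cvg_cst|exact: cvg_id].
Qed.

Lemma jcont_swap Phi : jcont Phi -> continuous (fun p : T * S => Phi p.2 p.1).
Proof.
move=> cP p; apply: (@continuous_comp _ _ _ (fun q : T * S => (q.2, q.1))
  (fun p : S * T => Phi p.1 p.2)); last exact: cP.
by apply: cvg_pair; [exact: cvg_snd|exact: cvg_fst].
Qed.

End JointContinuity.

Lemma jcont_tube (R : realType) (S T : topologicalType)
    (Phi : S -> T -> R) (D : set T) (s : S) (e : R) : jcont Phi -> compact D ->
  0 < e -> \forall t \near s, forall x, D x -> `|Phi t x - Phi s x| < e.
Proof.
move=> cP cD e0; apply: (compact_tube (E := fun t x => `|Phi t x - Phi s x| < e)) => //.
move=> x Dx.
have c1 : continuous (fun p : T * S => Phi p.2 p.1 - Phi s p.1).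
  move=> p; apply: cvgB; first exact: (jcont_swap cP).
  by apply: continuous_comp; [exact: cvg_fst|exact: jcont_slice].
have := c1 (x, s); rewrite /continuous_at /= subrr => /cvgr0_norm_lt/(_ e e0).
exact.
Qed.

Section Haar.
Context (R : realType) (G : topologicalGroupType).
Variable mu : {measure set (borel G) -> \bar R}.
Hypothesis hausdorffG : hausdorff_space G.
Hypothesis lcG : locally_compact [set: G].
Hypothesis haar : left_haar mu.
Implicit Types (r b f g : G -> R) (C D : set G) (Phi : G -> G -> R).

Lemma jcont_Cc Phi t D : jcont Phi -> compact D -> supported (Phi t) D -> Cc (Phi t).
Proof. by move=> cP cD PD; split; [exact: jcont_slice|exists D]. Qed.

(** Near t0 the supports stay in one compact set, on which the slices converge
    uniformly. *)
Lemma continuous_integral Phi : jcont Phi ->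
  (forall t0 : G, exists2 D, compact D & \forall t \near t0, supported (Phi t) D) ->
  continuous (fun t => \int[mu]_x Phi t x).
Proof.
move=> cP sP t0; have [D cD PD] := sP t0.
have PD0 := nbhs_singleton PD.
have mD := compact_borel hausdorffG cD.
have Dfin := haar_compact haar cD.
have iD := integrable_indicator mD Dfin.
have iP t : supported (Phi t) D -> mu.-integrable setT (EFin \o Phi t).
  by move=> Pt; apply: Cc_integrable => //; exact: jcont_Cc cD Pt.
apply/cvgrPdist_lt => e e0.
pose M := fine (mu D) + 1.
have M0 : 0 < M by rewrite ltr_wpDl// fine_ge0.
have eM0 : 0 < e / M by rewrite divr_gt0.
have tub := jcont_tube t0 cP cD eM0.
near=> t.
have Pt : supported (Phi t) D by near: t.
have dt : forall x, D x -> `|Phi t x - Phi t0 x| < e / M by near: t; exact: tub.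
rewrite -RintegralB//; [|exact: iP..].
have iB : mu.-integrable setT (EFin \o (fun x => Phi t0 x - Phi t x)).
  rewrite (_ : _ \o _ = (EFin \o Phi t0) \- (EFin \o Phi t))%E.
    by apply: integrableB => //; exact: iP.
  by apply/funext => x /=; rewrite EFinB.
apply: (le_lt_trans (le_normr_Rintegral _ iB)) => //.
apply: (@le_lt_trans _ _ (\int[mu]_x (e / M * \1_D x))).
  apply: le_Rintegral => //.
  - exact: (integrable_norm iB).
  - rewrite (_ : _ \o _ = fun x => ((e / M)%:E * (\1_D x)%:E)%E).
      exact: integrableZl.
    by apply/funext => x /=; rewrite EFinM.
  - move=> x _; rewrite indicE; have [Dx|nDx] := pselect (D x).
      by rewrite mem_set// mulr1 distrC; exact/ltW/dt.
    by rewrite memNset// mulr0 PD0// Pt// subrr normr0.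
rewrite RintegralZl// /Rintegral integral_indic// setIT.
rewrite mulrAC ltr_pdivrMr// ltr_pM2l// /M ltrDl//.
Unshelve. all: by end_near. Qed.

(** In general the product of the Borel sigma-algebras is too small for
    continuous functions to be measurable; one with compact support is a uniform
    limit of finite sums of products. *)
Lemma jcont_measurable Phi C D : jcont Phi -> compact C -> compact D ->
  (forall t x, ~ C t -> Phi t x = 0) -> (forall t, supported (Phi t) D) ->
  measurable_fun setT (fun p : borel G * borel G => Phi p.1 p.2).
Proof.
move=> cP cC cD PC PD.
have /choice[tau tauP] (n : nat) : exists tau : G -> G, finite_map tau /\
    forall t, C t -> forall x, D x -> `|Phi t x - Phi (tau t) x| < n.+1%:R^-1.
  have n0 : 0 < n.+1%:R^-1 :> R by rewrite invr_gt0.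
  have [tau ft tE] := finite_selection
    (E := fun s t => forall x, D x -> `|Phi t x - Phi s x| < n.+1%:R^-1) cC
    (fun s => jcont_tube s cP cD n0).
  by exists tau.
apply: (@measurable_fun_cvg _ _ _ _
    (fun n (p : borel G * borel G) => \1_C p.1 * Phi (tau n p.1) p.2)).
  move=> n; apply: measurable_funM.
    by apply: measurable_indic_fst; exact: compact_borel.
  apply: (@measurable_finite_map _ _ _ (borel G) (tau n) Phi); first exact: (tauP n).1.
  by move=> y; apply: continuous_borelR; exact: jcont_slice.
move=> [t x] _ /=; have [Ct|nCt] := pselect (C t); last first.
  by rewrite PC//; under eq_fun do rewrite indicE memNset// mul0r; exact: cvg_cst.
under eq_fun do rewrite indicE mem_set// mul1r.
have [Dx|nDx] := pselect (D x); last first.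
  by rewrite PD//; under eq_fun do rewrite PD//; exact: cvg_cst.
apply/subr_cvg0/norm_cvg0P.
apply: (squeeze_cvgr _ (cvg_cst 0) (@cvg_harmonic R)); apply: nearW => n.
by rewrite normr_ge0 distrC ltW//; exact: (tauP n).2.
Qed.

(** Restricted to compact supports, the Haar measure is finite. *)
Lemma tonelli Phi C D : jcont Phi -> compact C -> compact D ->
  (forall t x, 0 <= Phi t x) ->
  (forall t x, ~ C t -> Phi t x = 0) -> (forall t, supported (Phi t) D) ->
  (\int[mu]_t \int[mu]_x (Phi t x)%:E = \int[mu]_x \int[mu]_t (Phi t x)%:E)%E.
Proof.
move=> cP cC cD P0 PC PD.
have mC := compact_borel hausdorffG cC.
have mD := compact_borel hausdorffG cD.
have finC := haar_compact haar cC; have finD := haar_compact haar cD.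
transitivity (\int[mfrestr mC finC]_t \int[mfrestr mD finD]_x (Phi t x)%:E)%E.
  rewrite (integral_mfrestr mC finC) => [|t nCt].
    by apply: eq_integral => t _; rewrite -integral_mfrestr// => x nDx; rewrite PD.
  by under eq_integral do rewrite PC//; rewrite integral0.
rewrite (fubini_tonelli (fun p : borel G * borel G => (Phi p.1 p.2)%:E))/=.
- rewrite [RHS](integral_mfrestr mD finD) => [|x nDx].
    by apply: eq_integral => x _; rewrite -integral_mfrestr// => t nCt; rewrite PC.
  by under eq_integral do rewrite PD//; rewrite integral0.
- by apply/measurable_EFinP; exact: jcont_measurable cC cD PC PD.
- by move=> [t x]; rewrite lee_fin.
Qed.

Lemma Cc_integralE r : Cc r -> (\int[mu]_x (r x)%:E)%E = (\int[mu]_x r x)%:E.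
Proof.
move=> rC; rewrite /Rintegral fineK//.
by apply: integrable_fin_num => //; exact: Cc_integrable.
Qed.

Lemma Cc_comp_inv r : Cc r -> Cc (fun x => r x^-1%g).
Proof.
move=> [cr [D cD rD]]; split.
  by move=> x; apply: continuous_comp; [exact: invg_continuous|exact: cr].
exists ((fun x : G => x^-1%g) @` D).
  by apply: compact_image => //; exact: invg_continuous.
by move=> x nDx; apply: rD => Dx; apply: nDx; exists x^-1%g; rewrite ?invgK.
Qed.

(** This is Delta(x^-1) int f, where Delta is the modular function. *)
Definition rint f x := \int[mu]_y f (y * x)%g.

Lemma rint_jcont f : continuous f -> jcont (fun x y => f (y * x)%g).
Proof.
move=> cf p; apply: (@continuous_comp _ _ _ (fun p : G * G => (p.2 * p.1)%g) f);
  last exact: cf.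
by apply: continuous_mulg => q; [exact: cvg_snd|exact: cvg_fst].
Qed.

Lemma rint_continuous f : Cc f -> continuous (rint f).
Proof.
move=> [cf [D cD fD]]; apply: continuous_integral; first exact: rint_jcont.
move=> x0; have [N [Nx cN _]] := compact_nbhs hausdorffG lcG (filterT : nbhs x0 setT).
exists ((fun p : G * G => (p.1 * p.2^-1)%g) @` (D `*` N)).
  apply: compact_image2 => //.
  apply: continuous_mulg => q; first exact: cvg_fst.
  by apply: continuous_invg => q'; exact: cvg_snd.
apply: filterS Nx => x Nx y nDy; apply: fD => Dyx; apply: nDy.
by exists ((y * x)%g, x) => //=; rewrite -mulgA mulgV mulg1.
Qed.

Lemma Cc_rmul f x : Cc f -> Cc (fun y => f (y * x)%g).
Proof.
move=> [cf [D cD fD]]; split.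
  by move=> y; apply: continuous_comp; [exact: continuous_rmul|exact: cf].
exists ((fun y => (y * x^-1)%g) @` D).
  by apply: compact_image => //; exact: continuous_rmul.
move=> y nDy; apply: fD => Dyx; apply: nDy.
by exists (y * x)%g => //; rewrite -mulgA mulgV mulg1.
Qed.

Definition quotients (D E : set G) : set G :=
  (fun p : G * G => (p.1 * p.2^-1)%g) @` (D `*` E).

Lemma compact_quotients D E : compact D -> compact E -> compact (quotients D E).
Proof.
move=> cD cE; apply: compact_image2 => //.
apply: continuous_mulg => q; first exact: cvg_fst.
by apply: continuous_invg => q'; exact: cvg_snd.
Qed.

Lemma quotients_lmul D E x y : D x -> E (y^-1 * x)%g -> quotients D E y.
Proof.
move=> Dx Eyx; exists (x, (y^-1 * x)%g) => //=.
by rewrite invgM invgK mulgA mulgV mul1g.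
Qed.

Lemma quotients_rmul D E x y : D (y * x)%g -> E x -> quotients D E y.
Proof.
by move=> Dyx Ex; exists ((y * x)%g, x) => //=; rewrite -mulgA mulgV mulg1.
Qed.

Lemma lmul_jcont f g : continuous f -> continuous g ->
  jcont (fun y x => f x * g (y^-1 * x)%g).
Proof.
move=> cf cg p; apply: cvgM.
  by apply: continuous_comp; [exact: cvg_snd|exact: cf].
apply: continuous_comp; last exact: cg.
apply: continuous_mulg => q; last exact: cvg_snd.
by apply: continuous_invg => q'; exact: cvg_fst.
Qed.

(** Exchange the integrals and substitute y := x y in g(y^-1 x). *)
Lemma integral_lmul_ge0 f g : Cc f -> (forall x, 0 <= f x) -> Cc g -> (forall x, 0 <= g x) ->
  ((\int[mu]_x f x)%:E * (\int[mu]_y g y^-1%g)%:E =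
   \int[mu]_y \int[mu]_x (f x * g (y^-1 * x)%g)%:E)%E.
Proof.
move=> fC f0 gC g0; have [cf [D cD fD]] := fC; have [cg [E cE gE]] := gC.
have giC := Cc_comp_inv gC.
rewrite (tonelli (Phi := fun y x => f x * g (y^-1 * x)%g) (C := quotients D E) (D := D))//.
- rewrite -!Cc_integralE//.
    rewrite -ge0_integralZr//.
    - apply: eq_integral => x _.
      rewrite -ge0_integralZl ?lee_fin//.
      + rewrite -(haar_integral_ge0 haar x (F := fun y => (f x * g (y^-1 * x)%g)%:E)).
        * by apply: eq_integral => y _; rewrite invgM -mulgA mulVg mulg1 EFinM.
        * apply/measurable_EFinP; apply: continuous_borelR => y.
          apply: cvgM; first exact: cvg_cst.
          apply: continuous_comp; last exact: cg.
          apply: continuous_mulg => z; last exact: cvg_cst.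
          exact: invg_continuous.
        * by move=> y; rewrite lee_fin mulr_ge0.
      + exact: Cc_measurable giC.
      + by move=> y _; rewrite lee_fin.
    - exact: Cc_measurable fC.
    - by move=> x _; rewrite lee_fin.
    - by apply: integral_ge0 => y _; rewrite lee_fin.
- exact: lmul_jcont.
- exact: compact_quotients.
- by move=> y x; rewrite mulr_ge0.
- move=> y x nCy; have [Dx|nDx] := pselect (D x); last by rewrite fD// mul0r.
  by rewrite gE ?mulr0// => Eyx; apply: nCy; exact: quotients_lmul Dx Eyx.
- by move=> y x nDx; rewrite fD// mul0r.
Qed.

(** Both sides are the double integral of f(x) g(y^-1 x): the substitution
    y := x y separates the variables, and x := y x produces the right translates
    of f. Hence, for every f, the measure d(y^-1) has the density
    [rint f] / int f. *)
Lemma rint_swap_ge0 f g : Cc f -> (forall x, 0 <= f x) -> Cc g -> (forall x, 0 <= g x) ->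
  \int[mu]_x f x * \int[mu]_y g y^-1%g = \int[mu]_x (g x * rint f x).
Proof.
move=> fC f0 gC g0; have [cf [D cD fD]] := fC; have [cg [E cE gE]] := gC.
have rC : Cc (fun x => g x * rint f x).
  rewrite (_ : (fun _ => _) = fun x => rint f x * g x); last first.
    by apply/funext => x; rewrite mulrC.
  by apply: CcM => //; exact: rint_continuous.
apply: EFin_inj; rewrite EFinM integral_lmul_ge0// -Cc_integralE//.
transitivity (\int[mu]_y \int[mu]_x (f (y * x)%g * g x)%:E)%E.
  apply: eq_integral => y _.
  rewrite -(haar_integral_ge0 haar y (F := fun x => (f x * g (y^-1 * x)%g)%:E)).
  - by apply: eq_integral => x _; rewrite mulgA mulVg mul1g.
  - apply/measurable_EFinP; apply: continuous_borelR.
    exact: (@jcont_slice _ _ _ (fun y x : G => f x * g (y^-1 * x)%g) y (lmul_jcont cf cg)).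
  - by move=> x; rewrite lee_fin mulr_ge0.
rewrite (tonelli (Phi := fun y x => f (y * x)%g * g x) (C := quotients D E) (D := E))//.
- apply: eq_integral => x _; rewrite EFinM /rint -Cc_integralE; last exact: Cc_rmul.
  rewrite muleC -ge0_integralZr ?lee_fin//.
    exact: Cc_measurable (Cc_rmul x fC).
  by move=> y _; rewrite lee_fin.
- move=> p; apply: cvgM; first exact: (jcont_swap (rint_jcont cf)).
  by apply: continuous_comp; [exact: cvg_snd|exact: cg].
- exact: compact_quotients.
- by move=> y x; rewrite mulr_ge0.
- move=> y x nCy; have [Ex|nEx] := pselect (E x); last by rewrite gE// mulr0.
  by rewrite fD ?mul0r// => Dyx; apply: nCy; exact: quotients_rmul Dyx Ex.
- by move=> y x nEx; rewrite gE// mulr0.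
Qed.

Lemma Cc_max0 g : Cc g -> Cc (fun x => Num.max (g x) 0).
Proof.
move=> [cg [E cE gE]]; split.
  move=> x; apply: (@continuous_max _ _ g (fun=> 0)); [exact: cg|exact: cvg_cst].
by exists E => // x nEx; rewrite gE// maxxx.
Qed.

Lemma CcN g : Cc g -> Cc (fun x => - g x).
Proof.
move=> [cg [E cE gE]]; split; first by move=> x; apply: cvgN; exact: cg.
by exists E => // x nEx; rewrite gE// oppr0.
Qed.

Lemma rint_swap f g : Cc f -> (forall x, 0 <= f x) -> Cc g ->
  \int[mu]_x f x * \int[mu]_y g y^-1%g = \int[mu]_x (g x * rint f x).
Proof.
move=> fC f0 gC.
pose gp (x : G) : R := Num.max (g x) 0; pose gn (x : G) : R := @Order.max _ R (- g x) 0.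
have gpC : Cc gp by exact: Cc_max0.
have gnC : Cc gn by apply: Cc_max0; exact: CcN.
have gE x : g x = 1 * gp x - 1 * gn x.
  by rewrite /gp /gn !mul1r !maxEle; case: ifP => [|/negbT]; case: ifP => [|/negbT];
    rewrite -?ltNge; lra.
have gp0 x : 0 <= gp x by rewrite le_max lexx orbT.
have gn0 x : 0 <= gn x by rewrite le_max lexx orbT.
have rC q : Cc q -> Cc (fun x => q x * rint f x).
  move=> qC; rewrite (_ : (fun _ => _) = fun x => rint f x * q x); last first.
    by apply/funext => x; rewrite mulrC.
  by apply: CcM => //; exact: rint_continuous.
have -> : \int[mu]_y g y^-1%g = \int[mu]_y (1 * gp y^-1%g - 1 * gn y^-1%g).
  by apply: eq_Rintegral => y _; exact: gE.
have -> : \int[mu]_x (g x * rint f x) =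
    \int[mu]_x (1 * (gp x * rint f x) - 1 * (gn x * rint f x)).
  by apply: eq_Rintegral => x _; rewrite (gE x); ring.
rewrite (Cc_integralZ_sub hausdorffG haar 1 1 (Cc_comp_inv gpC) (Cc_comp_inv gnC)).
rewrite (Cc_integralZ_sub hausdorffG haar 1 1 (rC _ gpC) (rC _ gnC)).
by rewrite -!rint_swap_ge0//; ring.
Qed.

End Haar.

(** * Unimodularity of a Gelfand pair *)

Section Unimodular.
Context (R : realType) (G : topologicalGroupType).
Variable mu : {measure set (borel G) -> \bar R}.
Variable K : set G.
Hypothesis hausdorffG : hausdorff_space G.
Hypothesis lcG : locally_compact [set: G].
Hypothesis haar : left_haar mu.
Hypothesis subgroupK : subgroup K.
Hypothesis compactK : compact K.
Implicit Types (r b f g : G -> R) (C D : set G).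

Definition rbiinv r := forall x k k', K k -> K k' -> r (k * x * k')%g = r x.

(** The supremum over the double coset replaces the average over K x K. *)
Lemma biinv_bump C : compact C -> exists b, exists D,
  [/\ continuous b, rbiinv b, forall x, 0 <= b x <= 1, forall x, C x -> b x = 1 &
      compact D /\ supported b D].
Proof.
move=> cC; have [K1 KM KV] := subgroupK.
have [b0 [D0 [cb0 b01 b0C cD0 [_ b0D]]]] := bump R hausdorffG lcG cC openT (@subsetT _ C).
pose Phi x (p : G * G) := b0 (p.1 * x * p.2)%g.
pose b x : R := sup (Phi x @` (K `*` K)).
have hs x : has_sup (Phi x @` (K `*` K)).
  split; first by exists (Phi x (1, 1)%g), (1, 1)%g.
  by exists 1 => _ [p _ <-]; case/andP: (b01 (p.1 * x * p.2)%g).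
have Phib x p : (K `*` K) p -> Phi x p <= b x.
  by move=> Kp; apply: ub_le_sup; [case: (hs x)|exists p].
have bP x M : (forall p, (K `*` K) p -> Phi x p <= M) -> b x <= M.
  move=> PM; apply: ge_sup; first by case: (hs x).
  by move=> _ [p Kp <-]; exact: PM.
have jP : jcont Phi.
  move=> q; apply: (@continuous_comp _ _ _
    (fun q : G * (G * G) => (q.2.1 * q.1 * q.2.2)%g) b0); last exact: cb0.
  apply: continuous_mulg; last first.
    by move=> z; apply: continuous_comp; [exact: cvg_snd|exact: cvg_snd].
  apply: continuous_mulg; last by move=> z; exact: cvg_fst.
  by move=> z; apply: continuous_comp; [exact: cvg_snd|exact: cvg_fst].
exists b, ((fun p : G * G => (p.1 * p.2)%g) @` (((fun p : G * G => (p.1 * p.2)%g) @`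
  (K `*` D0)) `*` K)); split.
- move=> x0; apply/cvgrPdist_le => e e0.
  have := jcont_tube x0 jP (compact_setX compactK compactK) e0.
  apply: filterS => x Px.
  rewrite ler_distl; apply/andP; split.
    rewrite lerBlDr; apply: bP => p Kp.
    have := Phib x0 _ Kp; have := Px _ Kp; rewrite ltr_distl => /andP[_ /ltW]; lra.
  apply: bP => p Kp.
  by have := Phib x _ Kp; have := Px _ Kp; rewrite ltr_distl => /andP[/ltW + _]; lra.
- move=> x k k' Kk Kk'; apply/eqP; rewrite eq_le; apply/andP; split; apply: bP => -[l l'] [/= Kl Kl'].
    have -> : Phi (k * x * k')%g (l, l') = Phi x (l * k, k' * l')%g.
      by rewrite /Phi /= !mulgA.
    by apply: Phib; split; exact: KM.
  have -> : Phi x (l, l') = Phi (k * x * k')%g (l * k^-1, k'^-1 * l')%g.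
    by rewrite /Phi /= -!mulgA mulKg mulVKg.
  by apply: Phib; split=> /=; apply: KM => //; exact: KV.
- move=> x; apply/andP; split.
    apply: le_trans (Phib x (1, 1)%g _) => //.
    by case/andP: (b01 (1 * x * 1)%g).
  by apply: bP => p _; case/andP: (b01 (p.1 * x * p.2)%g).
- move=> x Cx; apply/eqP; rewrite eq_le; apply/andP; split.
    by apply: bP => p _; case/andP: (b01 (p.1 * x * p.2)%g).
  apply: le_trans (Phib x (1, 1)%g _) => //.
  by rewrite /Phi /= mulg1 mul1g b0C.
- split.
    do 2 (apply: compact_image2 => //; first exact: mulg_continuous).
  move=> x nDx; apply/eqP; rewrite eq_le; apply/andP; split.
    apply: bP => -[k k'] [/= Kk Kk']; rewrite /Phi /= b0D// => Dx; apply: nDx.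
    exists (k^-1 * (k * x * k'), k'^-1)%g => /=.
      split=> /=; last exact: KV.
      by exists (k^-1, k * x * k')%g => //; split=> //=; exact: KV.
    by rewrite !mulgA mulVg mul1g -mulgA mulgV mulg1.
  apply: le_trans (Phib x (1, 1)%g _) => //.
  by case/andP: (b01 (1 * x * 1)%g).
Qed.

Lemma cintegral_real d (T : measurableType d) (m : {measure set T -> \bar R})
    (r : T -> R) : cintegral m (fun x => (r x)%:C%C) = (\int[m]_x r x)%:C%C.
Proof.
apply: eq_coord; rewrite /cintegral //=.
by rewrite /Rintegral integral0.
Qed.

Local Notation rint := (rint mu).

(** By [rint_swap], the difference q of the two sides is orthogonal to all test
    functions; tested against q b, with b x = 1, it vanishes at x. *)
Lemma rint_unique f g x : Cc f -> (forall y, 0 <= f y) -> Cc g -> (forall y, 0 <= g y) ->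
  \int[mu]_y g y * rint f x = \int[mu]_y f y * rint g x.
Proof.
move=> fC f0 gC g0.
set cf := \int[mu]_y f y; set cg := \int[mu]_y g y.
pose q y := cg * rint f y - cf * rint g y.
have rf := rint_continuous hausdorffG lcG haar fC.
have rg := rint_continuous hausdorffG lcG haar gC.
have cq : continuous q.
  by move=> y; apply: cvgB; apply: cvgM; [exact: cvg_cst|exact: rf|exact: cvg_cst|exact: rg].
have [b [D [cb b01 bx cD [_ bD]]]] :=
  bump R hausdorffG lcG (@compact_set1 _ x) openT (@subsetT _ [set x]).
have bC : Cc b by split=> //; exists D.
have qbC : Cc (fun y => q y * b y) by exact: CcM.
have qqbC : Cc (fun y => q y * (q y * b y)) by exact: CcM.
have hC (r : G -> R) : continuous r -> Cc (fun y => (q y * b y) * r y).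
  move=> cr; rewrite (_ : (fun _ => _) = fun y => r y * (q y * b y)).
    exact: CcM.
  by apply/funext => y; rewrite mulrC.
have I0 : \int[mu]_y (q y * (q y * b y)) = 0.
  have -> : \int[mu]_y (q y * (q y * b y)) =
      \int[mu]_y (cg * (q y * b y * rint f y) - cf * (q y * b y * rint g y)).
    by apply: eq_Rintegral => y _; rewrite {1}/q; ring.
  rewrite (Cc_integralZ_sub hausdorffG haar _ _ (hC _ rf) (hC _ rg)).
  by rewrite -!(rint_swap hausdorffG lcG haar)// -/cf -/cg; ring.
have := Cc_integral_eq0 hausdorffG haar qqbC _ I0 => /(_ _ x).
rewrite bx// mulr1 => H; have /eqP : q x * q x = 0.
  apply: H => y; rewrite mulrA mulr_ge0//; last by case/andP: (b01 y).
  by rewrite -expr2 sqr_ge0.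
by rewrite -expr2 sqrf_eq0 /q subr_eq0 => /eqP.
Qed.

Hypothesis gelfandGK : gelfand_pair mu K.

Lemma CcK_real r D : continuous r -> compact D -> supported r D -> rbiinv r ->
  CcK K (fun x => (r x)%:C%C).
Proof.
move=> cr cD rD rK; split.
- by apply/continuous_ccont; exact: ccont_real.
- apply: (subclosed_compact _ cD); first exact: closed_closure.
  have /closure_id -> : closed D by exact: compact_closed.
  apply: closureS => x /= /eqP rx; apply: contrapT => nDx; apply: rx.
  by rewrite rD.
- by move=> x k k' Kk Kk'; rewrite rK.
Qed.

(** Commutativity at the identity of the convolution of r with a bi-invariant
    function b equal to 1 on the support of r and on its inverse:
    (r * b)(1) and (b * r)(1) are the two integrals. *)
Lemma gelfand_integral_inv r D : continuous r -> compact D -> supported r D ->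
  rbiinv r -> \int[mu]_y r y^-1%g = \int[mu]_y r y.
Proof.
move=> cr cD rD rK.
pose D' := D `|` (fun y : G => y^-1%g) @` D.
have cD' : compact D'.
  by apply: compactU => //; apply: compact_image => //; exact: invg_continuous.
have [b [E [cb bK b01 bD' [cE bE]]]] := biinv_bump cD'.
have := gelfandGK (CcK_real cr cD rD rK) (CcK_real cb cE bE bK) => /(_ 1%g).
rewrite /convolution.
have -> : cintegral mu (fun y => (r y)%:C%C * (b (y^-1 * 1)%g)%:C%C) =
    (\int[mu]_y r y)%:C%C.
  rewrite -cintegral_real; apply: eq_cintegral => y; rewrite mulg1 -rmorphM /=.
  have [Dy|/rD ->] := pselect (D y); last by rewrite mul0r.
  by rewrite bD' ?mulr1//; right; exists y.
have -> : cintegral mu (fun y => (b y)%:C%C * (r (y^-1 * 1)%g)%:C%C) =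
    (\int[mu]_y r y^-1%g)%:C%C.
  rewrite -cintegral_real; apply: eq_cintegral => y; rewrite mulg1 -rmorphM /=.
  have [Dy|/rD ->] := pselect (D y^-1%g); last by rewrite mulr0.
  by rewrite bD' ?mul1r//; right; exists y^-1%g => //; rewrite invgK.
by move=> [].
Qed.

(** For a bi-invariant f of integral c, [rint f] / c is the modular function
    Delta(x^-1). It is a homomorphism by [rint_unique] and 1 on K, thus bi-invariant, and by
    [gelfand_integral_inv] and [rint_swap] the bi-invariant q = [rint f] - c is
    orthogonal to the bi-invariant test functions. Tested against q b, with b
    bi-invariant and 1 at x, q vanishes at x. *)
Theorem unimodular g : Cc g -> \int[mu]_y g y^-1%g = \int[mu]_y g y.
Proof.
move=> gC; have [K1 KM KV] := subgroupK.
have [f [D [cf fK f01 f1 [cD fD]]]] := biinv_bump (@compact_set1 _ 1%g).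
have f0 x : 0 <= f x by case/andP: (f01 x).
have fC : Cc f by split=> //; exists D.
set c := \int[mu]_y f y.
have c0 : c != 0.
  apply/eqP => c0; have := Cc_integral_eq0 hausdorffG haar fC f0 c0 1%g.
  by rewrite f1// => /eqP; rewrite oner_eq0.
have rC := rint_continuous hausdorffG lcG haar fC.
have rM x z : rint f z * rint f x = c * rint f (x * z)%g.
  have fzC := Cc_rmul z fC.
  rewrite -[rint f z]/(\int[mu]_y f (y * z)%g) rint_unique//; congr (_ * _).
  by apply: eq_Rintegral => y _; rewrite mulgA.
have rK1 x k : K k -> rint f (x * k)%g = rint f x.
  move=> Kk; apply: eq_Rintegral => y _.
  by rewrite -[in RHS](fK (y * x)%g 1%g k K1 Kk) mul1g mulgA.
have rKr k : K k -> rint f k = c.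
  move=> Kk; rewrite -(mul1g k) rK1//; apply: eq_Rintegral => y _.
  by rewrite mulg1.
have rKl k x : K k -> rint f (k * x)%g = rint f x.
  by move=> Kk; apply: (mulfI c0); rewrite -rM (rKr k)// mulrC.
have rc x : rint f x = c.
  have [b [E [cb bK b01 bx [cE bE]]]] := biinv_bump (@compact_set1 _ x).
  pose q y := rint f y - c.
  have cq : continuous q by move=> y; apply: cvgB; [exact: rC|exact: cvg_cst].
  have bC : Cc b by split=> //; exists E.
  have qbC : Cc (fun y => q y * b y) by exact: CcM.
  have qqbC : Cc (fun y => q y * (q y * b y)) by exact: CcM.
  have qbE : supported (fun y => q y * b y) E by move=> y /bE ->; rewrite mulr0.
  have qbK : rbiinv (fun y => q y * b y).
    by move=> y k k' Kk Kk'; rewrite bK// /q rK1// rKl.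
  have inv := gelfand_integral_inv qbC.1 cE qbE qbK.
  have sw := rint_swap hausdorffG lcG haar fC f0 qbC.
  have rqC : Cc (fun y => q y * b y * rint f y).
    rewrite (_ : (fun _ => _) = fun y => rint f y * (q y * b y)); first exact: CcM.
    by apply/funext => y; rewrite mulrC.
  have I0 : \int[mu]_y (q y * (q y * b y)) = 0.
    have -> : \int[mu]_y (q y * (q y * b y)) =
        \int[mu]_y (1 * (q y * b y * rint f y) - c * (q y * b y)).
      by apply: eq_Rintegral => y _; rewrite {1}/q; ring.
    rewrite (Cc_integralZ_sub hausdorffG haar _ _ rqC qbC) -sw inv -/c.
    by rewrite mul1r subrr.
  have := Cc_integral_eq0 hausdorffG haar qqbC _ I0 => /(_ _ x).
  rewrite bx// mulr1 => H; have /eqP : q x * q x = 0.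
    apply: H => y; rewrite mulrA mulr_ge0//; last by case/andP: (b01 y).
    by rewrite -expr2 sqr_ge0.
  by rewrite -expr2 sqrf_eq0 /q subr_eq0 => /eqP.
apply: (mulfI c0); rewrite (rint_swap hausdorffG lcG haar fC f0 gC).
under eq_Rintegral do rewrite rc.
by rewrite RintegralZr// 1?mulrC//; exact: Cc_integrable.
Qed.

End Unimodular.

(** * Density of the continuous functions with compact support *)

Section Density.
Context (R : realType) (G : topologicalGroupType).
Variable mu : {measure set (borel G) -> \bar R}.
Hypothesis hausdorffG : hausdorff_space G.
Hypothesis lcG : locally_compact [set: G].
Hypothesis haar : left_haar mu.
Implicit Types (f g h : G -> R[i]) (r : G -> R).

Lemma Ccc_bounded h : Ccc h -> exists2 M, 0 < M & forall x, normc (h x) <= M.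
Proof.
move=> [[hr hi] [D cD hD]].
have [M M0 HM] : exists2 M, 0 < M & forall x, `|rp (h x)| <= M.
  by apply: (@Cc_bounded R G); split=> //; exists D => // x /hD ->.
have [N N0 HN] : exists2 M, 0 < M & forall x, `|ip (h x)| <= M.
  by apply: (@Cc_bounded R G); split=> //; exists D => // x /hD ->.
exists (M + N); first exact: addr_gt0.
by move=> x; apply: le_trans (normc_le_coord _) _; exact: lerD.
Qed.

Lemma Ccc_L2 h : Ccc h -> L2 mu h.
Proof.
move=> hC; have [ch [D cD hD]] := hC; have [M M0 hM] := Ccc_bounded hC.
have iD := integrable_indicator (compact_borel hausdorffG cD) (haar_compact haar cD).
apply: (L2_dom (mu := mu) (b := fun x => M ^+ 2 * \1_D x)).
- exact: ccont_cmeasurable.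
- rewrite (_ : _ \o _ = fun x => ((M ^+ 2)%:E * (\1_D x)%:E)%E).
    exact: integrableZl.
  by apply/funext => x /=; rewrite EFinM.
- move=> x; rewrite indicE; have [Dx|nDx] := pselect (D x).
    rewrite mem_set// mulr1 -sqr_normc.
    by rewrite lerXn2r ?nnegrE ?normc_ge0// ltW.
  by rewrite hD// sqn0 mulr_ge0// sqr_ge0.
Qed.

Lemma CccD f g : Ccc f -> Ccc g -> Ccc (fun x => f x + g x).
Proof.
move=> [[fr fi] [D cD fD]] [[gr gi] [E cE gE]]; split.
  split=> x; rewrite /continuous_at ?rpD ?ipD.
    by under eq_fun do rewrite rpD; apply: cvgD; [exact: fr|exact: gr].
  by under eq_fun do rewrite ipD; apply: cvgD; [exact: fi|exact: gi].
exists (D `|` E); first exact: compactU.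
by move=> x /not_orP[nD nE]; rewrite fD// gE// addr0.
Qed.

Lemma CccM f g : ccont f -> Ccc g -> Ccc (fun x => f x * g x).
Proof.
move=> cf [cg [D cD gD]]; split; first exact: ccontM.
by exists D => // x /gD ->; rewrite mulr0.
Qed.

Lemma CccB f g : Ccc f -> Ccc g -> Ccc (fun x => f x - g x).
Proof.
move=> fC gC; under eq_fun do rewrite -mulN1r.
by apply: CccD => //; apply: CccM => //; exact: ccont_cst.
Qed.

Lemma sqnormD_le d (T : measurableType d) (m : {measure set T -> \bar R}) (f g : T -> R[i]) :
  L2 m f -> L2 m g -> sqnorm m (fun x => f x + g x) <= 2 * (sqnorm m f + sqnorm m g).
Proof.
move=> fL gL; rewrite sqnormD//.
have := inner_rp_le ltr01 fL gL; rewrite invr1 !mul1r.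
by have := ler_norm (rp (inner m f g)); lra.
Qed.

Definition approximable f :=
  L2 mu f /\ forall e, 0 < e -> exists2 h, Ccc h & sqnorm mu (fun x => f x - h x) < e.

Lemma approximable_closed f : L2 mu f ->
  (forall e, 0 < e -> exists2 g, approximable g & sqnorm mu (fun x => f x - g x) < e) ->
  approximable f.
Proof.
move=> fL Hf; split=> // e e0.
have e4 : 0 < e / 4 by rewrite divr_gt0.
have [g [gL Hg] fg] := Hf _ e4; have [h hC gh] := Hg _ e4.
exists h => //; have hL := Ccc_L2 hC.
rewrite (_ : (fun _ => _) = fun x => (f x - g x) + (g x - h x)).
  by apply: le_lt_trans (sqnormD_le (L2B fL gL) (L2B gL hL)) _; lra.
by apply/funext => x; rewrite addrA subrK.
Qed.

Lemma approximableD f g : approximable f -> approximable g ->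
  approximable (fun x => f x + g x).
Proof.
move=> [fL Hf] [gL Hg]; split; first exact: L2D.
move=> e e0; have e4 : 0 < e / 4 by rewrite divr_gt0.
have [h hC fh] := Hf _ e4; have [k kC gk] := Hg _ e4.
exists (fun x => h x + k x); first exact: CccD.
rewrite (_ : (fun _ => _) = fun x => (f x - h x) + (g x - k x)).
  by apply: le_lt_trans (sqnormD_le (L2B fL (Ccc_L2 hC)) (L2B gL (Ccc_L2 kC))) _; lra.
by apply/funext => x; ring.
Qed.

Lemma approximableZ (c : R[i]) f : approximable f -> approximable (fun x => c * f x).
Proof.
move=> [fL Hf]; split; first exact: L2Z.
move=> e e0; have sc : 0 < sqn c + 1 by have := sqn_ge0 c; lra.
have e1 : 0 < e / (sqn c + 1) by rewrite divr_gt0.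
have [h hC fh] := Hf _ e1; have hL := Ccc_L2 hC.
exists (fun x => c * h x); first by apply: CccM => //; exact: ccont_cst.
rewrite (_ : (fun _ => _) = fun x => c * (f x - h x)); last first.
  by apply/funext => x; rewrite mulrBr.
rewrite sqnormZ; last exact: L2B.
have := sqnorm_ge0 mu (fun x => f x - h x); move: fh; rewrite ltr_pdivlMr//.
by have := sqn_ge0 c; nra.
Qed.

Lemma approximable0 : approximable (fun=> 0).
Proof.
have zC : Ccc (fun _ : G => 0 : R[i]).
  by split; [exact: ccont_cst|exists set0 => //; exact: compact0].
split=> [|e e0]; first exact: Ccc_L2.
exists (fun=> 0) => //; rewrite /sqnorm (_ : (fun _ => _) = cst 0).
  by rewrite /Rintegral integral0.
by apply/funext => x; rewrite subrr sqn0.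
Qed.

Lemma approximable_sum (I : Type) (s : seq I) (F : I -> G -> R[i]) :
  (forall i, approximable (F i)) -> approximable (fun x => \sum_(i <- s) F i x).
Proof.
move=> aF; elim: s => [|i s ih].
  by under eq_fun do rewrite big_nil; exact: approximable0.
by under eq_fun do rewrite big_cons; exact: approximableD.
Qed.

(** By regularity there are a compact C and an open U containing A, with C in U,
    such that U \ A and U \ C are small; a Urysohn function of C in U differs from
    the indicator of A on the union of these two sets only. *)
Lemma approximable_indic (A : set (borel G)) : measurable A -> (mu A < +oo)%E ->
  approximable (fun x => (\1_A x)%:C%C).
Proof.
move=> mA Afin; split.
  apply: (L2_dom (mu := mu) (b := \1_A)).
  - by apply: cmeasurable_real; exact: measurable_indic.
  - exact: integrable_indicator.
  - move=> x; rewrite /sqn rpC ipC expr0n addr0 indicE.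
    by case: (x \in A); rewrite /= ?expr1n ?expr0n.
move=> e e0; have [[_ outer inner] _ _] := haar.
have Afn : mu A \is a fin_num by rewrite ge0_fin_numE.
have eh : 0 < e / 2 by rewrite divr_gt0.
have [_ [U [oU AU] <-] UA] : exists2 x,
    [set mu U | U in [set U : set G | open U /\ A `<=` U]] x &
    (x < ereal_inf [set mu U | U in [set U : set G | open U /\ A `<=` U]] + (e / 2)%:E)%E.
  by apply: lb_ereal_inf_adherent => //; rewrite -outer.
rewrite -outer// in UA.
have mU := open_borel oU.
have Ufn : mu U \is a fin_num.
  rewrite ge0_fin_numE//; apply: lt_trans UA _.
  by rewrite -(fineK Afn) -EFinD ltry.
have [_ [C [cC CU] <-] UC] : exists2 x,
    [set mu C | C in [set C : set G | compact C /\ C `<=` U]] x &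
    (ereal_sup [set mu C | C in [set C : set G | compact C /\ C `<=` U]] - (e / 2)%:E < x)%E.
  by apply: ub_ereal_sup_adherent => //; rewrite -inner.
rewrite -inner// in UC.
have mC := compact_borel hausdorffG cC.
have [b [D [cb b01 bC cD [DU bD]]]] := bump R hausdorffG lcG cC oU CU.
have bCc : Ccc (fun x => (b x)%:C%C).
  by split; [exact: ccont_real|exists D => // x /bD ->].
exists (fun x => (b x)%:C%C) => //.
have mUA : (mu (U `\` A) < (e / 2)%:E)%E.
  rewrite measureD//; last by rewrite ltey_eq Ufn.
  by rewrite (setIidr AU) lteBlDl.
have mUC : (mu (U `\` C) < (e / 2)%:E)%E.
  rewrite measureD//; last by rewrite ltey_eq Ufn.
  rewrite (setIidr CU) lteBlDl ?ge0_fin_numE ?(haar_compact haar cC)//.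
  by move: UC; rewrite lteBlDr.
have mUA' : measurable (U `\` A : set (borel G)) by exact: measurableD.
have mUC' : measurable (U `\` C : set (borel G)) by exact: measurableD.
have iUA := integrable_indicator mUA' (lt_trans mUA (ltry _)).
have iUC := integrable_indicator mUC' (lt_trans mUC (ltry _)).
pose s (x : G) := sqn ((\1_A x)%:C%C - (b x)%:C%C).
have s_le x : s x <= \1_(U `\` A) x + \1_(U `\` C) x.
  have /andP[b0 b1] := b01 x.
  have sE : s x = (\1_A x - b x) ^+ 2 by rewrite /s /sqn !coordE; ring.
  have [Ux|nUx] := pselect (U x); last first.
    have nA : ~ A x by move/AU.
    have nD : ~ D x by move/DU.
    by rewrite sE bD// indicE memNset// subrr expr0n addr_ge0.
  have [Ax|nAx] := pselect (A x); have [Cx|nCx] := pselect (C x).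
  - by rewrite sE bC// indicE mem_set// subrr expr0n addr_ge0.
  - have -> : \1_(U `\` C) x = 1 :> R by rewrite indicE mem_set.
    have -> : \1_(U `\` A) x = 0 :> R by rewrite indicE memNset// => -[].
    by rewrite sE indicE mem_set//= add0r; nra.
  - have -> : \1_(U `\` A) x = 1 :> R by rewrite indicE mem_set.
    have -> : \1_(U `\` C) x = 0 :> R by rewrite indicE memNset// => -[].
    by rewrite sE indicE memNset//= addr0; nra.
  - have -> : \1_(U `\` A) x = 1 :> R by rewrite indicE mem_set.
    have -> : \1_(U `\` C) x = 1 :> R by rewrite indicE mem_set.
    by rewrite sE indicE memNset//=; nra.
have iB : mu.-integrable setT (EFin \o (fun x => \1_(U `\` A) x + \1_(U `\` C) x)).
  rewrite (_ : _ \o _ = fun x => ((\1_(U `\` A) x)%:E + (\1_(U `\` C) x)%:E)%E).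
    exact: integrableD.
  by apply/funext => x /=; rewrite EFinD.
have iS : mu.-integrable setT (EFin \o s).
  apply: (integrable_dom (mu := mu) _ iB).
    apply: measurable_sqn; apply: cmeasurableD.
      by apply: cmeasurable_real; exact: measurable_indic.
    under eq_fun do rewrite -mulN1r.
    apply: cmeasurableZ; exact: ccont_cmeasurable bCc.1.
  by move=> x; rewrite lee_fin ger0_norm ?sqn_ge0// s_le.
apply: (@le_lt_trans _ _ (\int[mu]_x (\1_(U `\` A) x + \1_(U `\` C) x))).
  by apply: le_Rintegral => // x _; exact: s_le.
rewrite RintegralD//.
rewrite /Rintegral !integral_indic// !setIT.
rewrite -lte_fin EFinD !fineK ?ge0_fin_numE ?(lt_trans mUA (ltry _)) ?(lt_trans mUC (ltry _))//.
by rewrite [in ltRHS](splitr e) EFinD lteD.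
Qed.

Import HBNNSimple.

(** A level set of g of positive value y has finite measure, since r^2 >= y^2
    on it. *)
Lemma approximable_nnsfun (g : {nnsfun borel G >-> R}) (r : G -> R) :
  mu.-integrable setT (EFin \o (fun x => r x ^+ 2)) -> (forall x, g x <= r x) ->
  approximable (fun x => (g x)%:C%C).
Proof.
move=> ir gr.
have fin y : 0 < y -> (mu (g @^-1` [set y]) < +oo)%E.
  move=> y0; have mg : measurable (g @^-1` [set y]) by exact: measurable_sfunP.
  have : ((y ^+ 2)%:E * mu (g @^-1` [set y]) < +oo)%E.
    rewrite -(setIT (g @^-1` _)) -(integral_indic mu measurableT mg) -ge0_integralZl//.
    - apply: le_lt_trans (integrable_lty measurableT ir).
      apply: ge0_le_integral => //.
      + by move=> x _; rewrite -EFinM lee_fin mulr_ge0 ?sqr_ge0.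
      + apply/measurable_EFinP; apply: measurable_funM => //; exact: measurable_indic.
      + exact: measurable_int ir.
      + move=> x _; rewrite -EFinM lee_fin indicE.
        have [gx|ngx] := pselect ((g @^-1` [set y]) x).
          rewrite mem_set// mulr1 -gx lerXn2r ?nnegrE ?gr//.
          exact: le_trans (gr x).
        by rewrite memNset// mulr0 sqr_ge0.
    - by apply/measurable_EFinP; exact: measurable_indic.
    - by rewrite lee_fin sqr_ge0.
  have y2 : 0 < y ^+ 2 by rewrite exprn_gt0.
  have := measure_ge0 mu (g @^-1` [set y]).
  by case: (mu _) => [a| |]//; rewrite ?ltry// gt0_muley// lte_fin.
rewrite (_ : (fun _ => _) = fun x => \sum_(y <- finmap.enum_fset (fset_set (range g)))
    (if 0 < y then y%:C%C * (\1_(g @^-1` [set y]) x)%:C%C else 0)).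
  apply: approximable_sum => y; have [y0|_] := boolP (0 < y); last exact: approximable0.
  apply: approximableZ; apply: approximable_indic; last exact: fin.
  exact: measurable_sfunP.
apply/funext => x; rewrite fimfunE fsbig_finite//= rmorph_sum /=.
apply: eq_big_seq => y; rewrite in_fset_set// => /set_mem[x' _ <-].
case: ifPn => [_|]; first by rewrite rmorphM.
rewrite -leNgt => gx; have -> : g x' = 0 by apply/eqP; rewrite eq_le gx /=.
by rewrite mul0r.
Qed.

Lemma approximable_ge0 (r : G -> R) : measurable_fun setT (r : borel G -> R) ->
  (forall x, 0 <= r x) -> mu.-integrable setT (EFin \o (fun x => r x ^+ 2)) ->
  approximable (fun x => (r x)%:C%C).
Proof.
move=> mr r0 ir.
have rL : L2 mu (fun x => (r x)%:C%C).
  apply: (L2_dom (mu := mu) (b := fun x => r x ^+ 2)) => //.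
  by move=> x; rewrite /sqn rpC ipC expr0n addr0.
apply: approximable_closed => // e e0.
have mr' : measurable_fun setT (EFin \o r : borel G -> \bar R) by exact/measurable_EFinP.
pose g := nnsfun_approx measurableT mr'.
have gr n x : g n x <= r x.
  by rewrite -lee_fin nnsfun_approxE; apply: le_approx => // y _; rewrite lee_fin.
have cg x : g n x @[n --> \oo] --> r x.
  have := @cvg_nnsfun_approx _ _ _ _ measurableT _ mr' (fun y _ => r0 y) x I.
  by move=> /fine_cvg.
have dom := @dominated_convergence _ _ _ mu setT measurableT
  (fun n x => ((r x - g n x) ^+ 2)%:E) (cst 0%E) (EFin \o (fun x => r x ^+ 2)).
have [|||//||_ _] := dom.
- move=> n; apply/measurable_EFinP; apply: measurable_funX; apply: measurable_funB => //.
- exact: measurable_cst.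
- apply: aeW => x _; apply: cvg_EFinn; rewrite -[X in _ --> X](expr0n R 2).
  rewrite -(subrr (r x)).
  under eq_fun do rewrite expr2; rewrite expr2.
  by apply: cvgM; apply: cvgB => //; exact: cvg_cst.
- apply: aeW => x n _; rewrite lee_fin ger0_norm ?sqr_ge0//.
  rewrite lerXn2r ?nnegrE// ?subr_ge0// lerBlDr lerDl.
  by [].
rewrite integral0 => /fine_cvg /cvgr0_norm_lt /(_ e e0) [N _ HN].
have gN := HN N (leqnn N).
exists (fun x => (g N x)%:C%C); first exact: (approximable_nnsfun ir (gr N)).
apply: le_lt_trans gN; apply: le_trans (ler_norm _).
rewrite /sqnorm /Rintegral /= le_eqVlt; apply/orP; left; apply/eqP; congr fine.
by apply: eq_integral => x _; congr EFin; rewrite /sqn !coordE; ring.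
Qed.

(** Split into coordinates, and those into positive and negative parts; a
    nonnegative function is a limit of simple functions by dominated
    convergence. *)
Theorem L2_dense f : L2 mu f -> forall e, 0 < e ->
  exists2 h, Ccc h & sqnorm mu (fun x => f x - h x) < e.
Proof.
move=> fL; suff : approximable f by case.
have [mf mf'] := fL.1.
have fi := L2_integrable_sqn fL.
have H (r : G -> R) : measurable_fun setT (r : borel G -> R) ->
    (forall x, r x ^+ 2 <= sqn (f x)) -> approximable (fun x => (r x)%:C%C).
  move=> mr rf.
  have part (q : G -> R) : measurable_fun setT (q : borel G -> R) ->
      (forall x, 0 <= q x <= `|r x|) -> approximable (fun x => (q x)%:C%C).
    move=> mq q0; apply: approximable_ge0 => //.
      by move=> x; case/andP: (q0 x).
    apply: (integrable_dom (mu := mu) _ fi); first exact: measurable_funX.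
    move=> x /=; rewrite lee_fin ger0_norm ?sqr_ge0//.
    apply: le_trans (rf x); rewrite -(real_normK (num_real (r x))).
    have /andP[? ?] := q0 x; by rewrite lerXn2r ?nnegrE.
  have a1 := part (fun x => (`|r x| + r x) / 2).
  have a2 := part (fun x => (`|r x| - r x) / 2).
  have -> : (fun x => (r x)%:C%C) = (fun x => ((`|r x| + r x) / 2)%:C%C +
      (-1) * ((`|r x| - r x) / 2)%:C%C).
    by apply/funext => x; apply: eq_coord; rewrite !coordE /=; lra.
  have mn : measurable_fun setT (fun x : borel G => `|r x|).
    by apply: measurableT_comp => //; exact: normr_measurable.
  apply: approximableD; last apply: approximableZ.
    apply: a1 => [|x]; first by apply: measurable_funM => //; exact: measurable_funD.
    by have := ler_norm (r x); have := ler_norm (- r x); rewrite normrN; lra.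
  apply: a2 => [|x]; first by apply: measurable_funM => //; exact: measurable_funB.
  by have := ler_norm (r x); have := ler_norm (- r x); rewrite normrN; lra.
rewrite (_ : f = fun x => (rp (f x))%:C%C + iunit * (ip (f x))%:C%C).
  apply: approximableD; last apply: approximableZ.
    by apply: H => // x; rewrite lerDl sqr_ge0.
  by apply: H => // x; rewrite lerDr sqr_ge0.
by apply/funext => x; apply: eq_coord; rewrite !coordE; ring.
Qed.

End Density.

(** * The Plancherel inequality for functions that are not bi-invariant *)

(** The Hermitian forms of the families (1) and (1, x) take real values. *)
Lemma posdef_inv (R : realType) (G : topologicalGroupType) (phi : G -> R[i]) (x : G) :
  posdef phi -> phi x^-1%g = (phi x)^*.
Proof.
move=> pd.
have i0 (z : R[i]) : 0 <= z -> ip z = 0.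
  by case: z => a b; rewrite lecE /= => /andP[/eqP -> _].
have p1 : ip (phi 1%g) = 0.
  have := pd 1 (fun=> 1%g) (fun=> 1); rewrite !big_ord1 mul1r rmorph1 mul1r => /i0.
  by rewrite mulVg.
have two (c : R[i]) : ip (c^* * phi x^-1%g + c * phi x) = 0.
  have := pd 2 (fun i => if i == ord0 then 1%g else x) (fun i => if i == ord0 then 1 else c).
  rewrite !big_ord_recl !big_ord0 /= => /i0.
  rewrite rmorph1 !mul1r !mulr1 !addr0 invg1 !mulg1 mul1g mulVg.
  by rewrite !coordE !p1; lra.
have h1 := two 1; have h2 := two iunit.
by apply: eq_coord; move: h1 h2; rewrite rmorph1 !mul1r !coordE; lra.
Qed.

Section Hat.
Context (R : realType) (G : topologicalGroupType).
Variables (mu : {measure set (borel G) -> \bar R}) (K : set G).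
Implicit Types (f g h : G -> R[i]) (phi : SplusT mu K).

Lemma sphP phi :
  (spherical mu K (sph phi) /\ cbounded (sph phi)) \/ sph phi = (fun=> 1).
Proof. exact: (set_valP (set_val phi)). Qed.

Lemma sph_ccont phi : ccont (sph phi).
Proof.
by case: (sphP phi) => [[[/continuous_ccont]]//|->]; exact: ccont_cst.
Qed.

Lemma sph_biinv phi : biinv K (sph phi).
Proof.
by case: (sphP phi) => [[[]]//|->].
Qed.

Lemma sph_bounded phi : exists2 M, 0 < M & forall x, normc (sph phi x) <= M.
Proof.
case: (sphP phi) => [[_ [M HM]]|->].
  exists (Num.max M 1); first by rewrite lt_max ltr01 orbT.
  by move=> x; rewrite le_max HM.
by exists 1 => // x; rewrite normcE /sqn /= expr1n expr0n addr0 sqrtr1.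
Qed.

Lemma sph_posdef phi : posdef (sph phi).
Proof. exact: (set_valP phi). Qed.

(** Since phi is positive-definite, this is the spherical transform ([hat_sft]),
    in the form of an inner product with phi. *)
Definition hat h phi : R[i] := cintegral mu (fun x => h x * (sph phi x)^*).

Lemma hat_sft h phi : hat h phi = sft mu h (sph phi).
Proof.
by apply: eq_cintegral => x; rewrite posdef_inv//; exact: sph_posdef.
Qed.

Lemma cintegrable_sph h phi : cintegrable mu h ->
  cintegrable mu (fun x => h x * (sph phi x)^*).
Proof.
move=> hi; have [M M0 HM] := sph_bounded phi.
apply: (cintegrable_dom (mu := mu) (b := fun x => (M%:E * (normc (h x))%:E)%E)).
- apply: cmeasurableM; first exact: cintegrable_meas hi.
  by apply: cmeasurableJ; apply: ccont_cmeasurable; exact: sph_ccont.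
- by apply: integrableZl => //; exact: cintegrable_normc.
- by move=> x; rewrite -EFinM lee_fin normcM normcJ mulrC ler_wpM2r ?normc_ge0.
Qed.

(** The topology of the spherical functions is generated by these maps. *)
Lemma continuous_sft f : LpK mu K 1 f ->
  continuous ((fun phi => sft mu f (sph phi)) : SplusT mu K -> R[i]^o).
Proof.
move=> fL.
pose j : L1K mu K := SigSub (mem_set fL).
have c1 : continuous (set_val : SplusT mu K -> SbT mu K) by exact: initial_continuous.
have c2 : continuous (@sft_eval R G mu K : SbT mu K -> prod_topology _).
  exact: initial_continuous.
have c3 := @proj_continuous _ (fun _ : L1K mu K => R[i]^o) j.
move=> phi.
have := continuous_comp (c1 phi) (continuous_comp (c2 _) (c3 _)).
exact.
Qed.

Lemma cmeasurable_sft f : LpK mu K 1 f ->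
  cmeasurable (fun phi : borel (SplusT mu K) => sft mu f (sph phi)).
Proof.
by move=> fL; apply: ccont_cmeasurable; apply/continuous_ccont; exact: continuous_sft.
Qed.

End Hat.

Section PlancherelInequality.
Context (R : realType) (G : topologicalGroupType).
Variables (mu : {measure set (borel G) -> \bar R}) (K : set G).
Variable nu : {measure set (borel (SplusT mu K)) -> \bar R}.
Hypothesis hausdorffG : hausdorff_space G.
Hypothesis haar : left_haar mu.
Hypothesis subgroupK : subgroup K.
Hypothesis compactK : compact K.
Hypothesis isometry : plancherel_isometry nu.
Implicit Types (f g h : G -> R[i]) (phi : SplusT mu K).

Definition double_coset (D : set G) : set G :=
  [set x | exists k k' y, [/\ K k, K k', D y & x = k * y * k']%g].

Lemma double_coset_compact D : compact D -> compact (double_coset D).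
Proof.
move=> cD; pose m (p : G * G) := (p.1 * p.2)%g.
rewrite (_ : double_coset D = m @` ((m @` (K `*` D)) `*` K)).
  by do 2 (apply: compact_image2 => //; first exact: mulg_continuous).
apply/seteqP; split=> [_ [k [k' [y [Kk Kk' Dy ->]]]]|].
  by exists (k * y, k')%g => //; split=> //; exists (k, y).
by move=> _ [[_ k'] [/= [[k y] [/= Kk Dy] <-] Kk'] <-]; exists k, k', y.
Qed.

Lemma double_coset_sub D : D `<=` double_coset D.
Proof.
by move=> x Dx; have [K1 _ _] := subgroupK; exists 1%g, 1%g, x; rewrite mul1g mulg1.
Qed.

Lemma double_coset_inv D x k k' : K k -> K k' ->
  double_coset D (k * x * k')%g <-> double_coset D x.
Proof.
have [K1 KM KV] := subgroupK => Kk Kk'; split=> -[l [l' [y [Kl Kl' Dy e]]]].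
  exists (k^-1 * l)%g, (l' * k'^-1)%g, y; split;
    [exact: KM (KV _ Kk) Kl|exact: KM Kl' (KV _ Kk')|by []|].
  have -> : (k^-1 * l * y * (l' * k'^-1) = k^-1 * (l * y * l') * k'^-1)%g.
    by rewrite !mulgA.
  by rewrite -e -!mulgA mulKg mulgV mulg1.
exists (k * l)%g, (l' * k')%g, y; split; [exact: KM|exact: KM|by []|].
by rewrite e !mulgA.
Qed.

Lemma double_coset_indic D x k k' : K k -> K k' ->
  \1_(double_coset D) (k * x * k')%g = \1_(double_coset D) x :> R.
Proof.
move=> Kk Kk'; rewrite !indicE; congr (_%:R).
have H := double_coset_inv D x Kk Kk'.
have [Dx|nDx] := pselect (double_coset D x).
  by rewrite !mem_set//; exact/H.
by rewrite !memNset// => /H.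
Qed.

(** The transform of h only sees the orthogonal projection p of h onto
    L^2(G//K): cut off by a compact bi-invariant set C that contains the support
    of h, a bounded spherical function belongs to L^2(G//K), so that its inner
    products with h and with p agree. Cutting p off as well makes it integrable,
    so that its transform is continuous and the Plancherel isometry applies. *)
Theorem plancherel_hat h : Ccc h ->
  cmeasurable (hat h : borel (SplusT mu K) -> R[i]) /\
  (energy nu (hat h : borel (SplusT mu K) -> R[i]) <= (sqnorm mu h)%:E)%E.
Proof.
move=> hC; have [ch [D cD hD]] := hC.
have hL := Ccc_L2 hausdorffG haar hC.
pose C := double_coset D; pose c (x : G) : R[i] := (\1_C x)%:C%C.
have cC : compact C by exact: double_coset_compact.
have mC := compact_borel hausdorffG cC.
have iC := integrable_indicator mC (haar_compact haar cC).
have mc : @cmeasurable _ (borel G) R c by apply: cmeasurable_real; exact: measurable_indic.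
have cK x k k' : K k -> K k' -> c (k * x * k')%g = c x.
  by move=> Kk Kk'; rewrite /c double_coset_indic.
have sc x : sqn (c x) = \1_C x.
  by rewrite /sqn !coordE indicE; case: (x \in C); rewrite /= ?expr1n ?expr0n addr0.
have [p pX [pE pe]] := LpK2_projection K hL; have [pL pK] := (LpK2P _ _ _).1 pX.
pose p1 x := p x * c x.
have mp1 : @cmeasurable _ (borel G) R p1 by apply: cmeasurableM => //; case: pL.
have sp1 x : sqn (p1 x) <= sqn (p x).
  rewrite sqnM sc indicE; case: (x \in C); rewrite ?mulr1// mulr0.
  exact: sqn_ge0.
have p1L : L2 mu p1 by apply: L2_dom mp1 (L2_integrable_sqn pL) sp1.
have p1K : biinv_ae mu K p1.
  move=> k k' Kk Kk'; have := pK _ _ Kk Kk'.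
  by apply: ae_mono => x px; rewrite /p1 px cK.
have cL : L2 mu c.
  by apply: (L2_dom (mu := mu) mc iC) => x; rewrite sc.
have p1i : cintegrable mu p1.
  have := L2_mul pL cL; congr (cintegrable mu _); apply/funext => x.
  by rewrite /p1; congr (_ * _); apply: eq_coord; rewrite !coordE ?oppr0.
have p1_1 : LpK mu K 1 p1 by split=> //; apply/isLp1P.
have p1_2 : LpK mu K 2 p1 by apply/LpK2P.
have hatE phi : hat h phi = sft mu p1 (sph phi).
  rewrite -hat_sft.
  pose q x := sph phi x * c x.
  have [M M0 HM] := sph_bounded phi.
  have qX : LpK mu K 2 q.
    apply/LpK2P; split.
      apply: (L2_dom (mu := mu) (b := fun x => M ^+ 2 * \1_C x)).
      - apply: cmeasurableM => //; apply: ccont_cmeasurable; exact: sph_ccont.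
      - rewrite (_ : _ \o _ = fun x => ((M ^+ 2)%:E * (\1_C x)%:E)%E).
          exact: integrableZl.
        by apply/funext => x /=; rewrite EFinM.
      - move=> x; rewrite sqnM sc ler_wpM2r ?indicE// -sqr_normc.
        by rewrite lerXn2r ?nnegrE ?normc_ge0// ltW.
    move=> k k' Kk Kk'; apply: aeW => x; rewrite /q cK// sph_biinv//.
  transitivity (inner mu h q).
    apply: eq_cintegral => x; rewrite /q rmorphM /=.
    have [Cx|nCx] := pselect (C x).
      by rewrite /c indicE mem_set// rmorph1 mulr1.
    by rewrite hD ?mul0r// => /double_coset_sub.
  rewrite -pE//; apply: eq_cintegral => x; rewrite /q /p1 rmorphM /=.
  rewrite mulrA mulrAC; congr (_ * _ * _).
  by apply: eq_coord; rewrite !coordE ?oppr0.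
have hatEf : (hat h : borel (SplusT mu K) -> R[i]) = fun phi => sft mu p1 (sph phi).
  by apply/funext => phi; exact: hatE.
have mhat : cmeasurable (hat h : borel (SplusT mu K) -> R[i]).
  by rewrite hatEf; exact: cmeasurable_sft.
split=> //.
have [F [Fsft Fiso _ _]] := isometry.
have Fae := Fsft _ p1_1 p1_2; have [[mF _] Fn] := Fiso _ p1_2.
have -> : energy nu (hat h : borel (SplusT mu K) -> R[i]) = energy nu (F p1).
  rewrite hatEf; apply: ge0_ae_eq_integral => //.
  - by apply/measurable_EFinP; apply: measurable_sqn; exact: cmeasurable_sft.
  - by apply/measurable_EFinP; apply: measurable_sqn.
  - by move=> phi _; rewrite lee_fin sqn_ge0.
  - by move=> phi _; rewrite lee_fin sqn_ge0.
  - by apply: ae_mono Fae => phi ->.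
rewrite -Lpnorm2X Fn Lpnorm2X sqnormE// lee_fin.
apply: le_trans pe; apply: le_Rintegral => //; exact: L2_integrable_sqn.
Qed.

End PlancherelInequality.

(** * Iterated integrals with a sigma-finite inner support *)

Section IteratedIntegrals.
Context d1 (T1 : measurableType d1) d2 (T2 : measurableType d2) (R : realType).
Variables (m1 : {measure set T1 -> \bar R}) (m2 : {measure set T2 -> \bar R}).

Definition sigma_finite_cover (A : set T1) := exists2 E : nat -> set T1,
  forall k, measurable (E k) /\ (m1 (E k) < +oo)%E & A `<=` \bigcup_k E k.

Lemma sigma_finite_coverS A B : A `<=` B -> sigma_finite_cover B -> sigma_finite_cover A.
Proof. by move=> AB [E EP BE]; exists E => //; exact: subset_trans BE. Qed.

Lemma sigma_finite_cover1 A : measurable A -> (m1 A < +oo)%E -> sigma_finite_cover A.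
Proof. by move=> mA Afin; exists (fun=> A) => // x Ax; exists 0%N. Qed.

Lemma sigma_finite_cover_bigcup (A : nat -> set T1) : (forall n, sigma_finite_cover (A n)) ->
  sigma_finite_cover (\bigcup_n A n).
Proof.
move=> AP; have /choice[E EP] n : exists E : nat -> set T1,
    (forall k, measurable (E k) /\ (m1 (E k) < +oo)%E) /\ A n `<=` \bigcup_k E k.
  by have [E E1 E2] := AP n; exists E.
exists (fun j => if @choice.unpickle (nat * nat)%type j is Some p then E p.1 p.2 else set0).
  move=> j; case: choice.unpickle => [p|]; first exact: (EP p.1).1.
  by split; [exact: measurable0|rewrite measure0].
move=> x [n _ /(EP n).2[k _ Ex]]; exists (choice.pickle (n, k)) => //.
by rewrite choice.pickleK.
Qed.

Definition slices (V : eqType) (z : V) (W : T1 * T2 -> V) :=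
  [set x | exists y, W (x, y) != z].

(** The integral in x is a countable sum of integrals over sets of finite
    measure, for which it is measurable in y. *)
Lemma measurable_inner_integral (F : T1 * T2 -> \bar R) : measurable_fun setT F ->
  (forall p, (0 <= F p)%E) -> sigma_finite_cover (slices 0%E F) ->
  measurable_fun setT (fun y => \int[m1]_x F (x, y))%E.
Proof.
move=> mF F0 [E EP FE]; pose D := seqDU E.
have mE k : measurable (E k) := (EP k).1.
have mD k : measurable (D k) by exact: seqDU_measurable.
have finD k : (m1 (D k) < +oo)%E.
  apply: le_lt_trans (EP k).2.
  exact: (le_measure m1 (mem_set (mD k)) (mem_set (mE k)) (@subset_seqDU _ E k)).
have mFy y : measurable_fun setT (fun x => F (x, y)).
  by apply: (measurableT_comp mF); exact: pair2_measurable.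
pose Fk k p := (F p * (\1_(D k) p.1)%:E)%E.
have mFk k : measurable_fun setT (Fk k).
  apply: emeasurable_funM => //; apply/measurable_EFinP.
  apply: (measurableT_comp (f := \1_(D k) : T1 -> R)); last exact: measurable_fst.
  exact: measurable_indic.
have Fk0 k p : (0 <= Fk k p)%E by rewrite mule_ge0// lee_fin.
have -> : (fun y => \int[m1]_x F (x, y))%E =
    (fun y => \sum_(0 <= k <oo) \int[mfrestr (mD k) (finD k)]_x Fk k (x, y))%E.
  apply/funext => y.
  have -> : (\int[m1]_x F (x, y) = \int[m1]_(x in \bigcup_k D k) F (x, y))%E.
    rewrite [RHS]integral_mkcond; congr (integral _ _ _); apply/funext => x.
    rewrite patchE; case: ifPn => //; rewrite notin_setE -seqDU_bigcup_eq => nEx.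
    by apply/eqP/negPn/negP => Fx; apply: nEx; apply: FE; exists y.
  rewrite ge0_integral_bigcup//.
  - apply: eq_eseriesr => k _.
    rewrite integral_mkcond -integral_mfrestr => [|x nDx].
      apply: eq_integral => x _; rewrite patchE /Fk indicE /=.
      by case: (x \in D k); rewrite ?mule1 ?mule0.
    by rewrite /Fk indicE memNset// mule0.
  - by apply: measurable_funTS.
  - exact: trivIset_seqDU.
apply: ge0_emeasurable_sum => [k y _ _|k _]; first exact: integral_ge0.
exact: (measurable_fun_fubini_tonelli_G (m1 := mfrestr (mD k) (finD k)) (Fk k)).
Qed.

Implicit Types W : T1 * T2 -> R[i].

Lemma cmeasurable_slice W y : cmeasurable W -> cmeasurable (fun x => W (x, y)).
Proof.
move=> [mr mi]; split.
  by apply: (measurableT_comp mr); exact: pair2_measurable.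
by apply: (measurableT_comp mi); exact: pair2_measurable.
Qed.

Lemma cmeasurable_inner_integral W : cmeasurable W -> sigma_finite_cover (slices 0 W) ->
  cmeasurable (fun y => cintegral m1 (fun x => W (x, y))).
Proof.
move=> [mr mi] sW.
have H (r : T1 * T2 -> R) : measurable_fun setT r -> sigma_finite_cover (slices 0 r) ->
    measurable_fun setT (fun y => \int[m1]_x r (x, y)).
  move=> mr' sr; rewrite /Rintegral; apply: measurableT_comp => //.
  have mE : measurable_fun setT (EFin \o r) by exact/measurable_EFinP.
  have -> : (fun y => \int[m1]_x (r (x, y))%:E)%E = (fun y =>
      \int[m1]_x ((EFin \o r)^\+ (x, y)) - \int[m1]_x ((EFin \o r)^\- (x, y)))%E.
    apply/funext => y; rewrite integralE; congr (_ - _)%E; apply: eq_integral => x _.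
      by rewrite !funeposE.
    by rewrite !funenegE.
  apply: emeasurable_funB; apply: measurable_inner_integral => //.
  - exact: measurable_funepos.
  - apply: sigma_finite_coverS sr => x [y]; rewrite funeposE => rxy; exists y.
    by apply: contra_neq rxy => /= ->; rewrite maxxx.
  - exact: measurable_funeneg.
  - apply: sigma_finite_coverS sr => x [y]; rewrite funenegE => rxy; exists y.
    by apply: contra_neq rxy => /= ->; rewrite oppr0 maxxx.
split.
  apply: (H (fun p => rp (W p))) => //; apply: sigma_finite_coverS sW => x [y rxy].
  by exists y; apply: contra_neq rxy => ->.
apply: (H (fun p => ip (W p))) => //; apply: sigma_finite_coverS sW => x [y rxy].
by exists y; apply: contra_neq rxy => ->.
Qed.

Definition iterated_energy W := (\int[m2]_y \int[m1]_x (sqn (W (x, y)))%:E)%E.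

Lemma slices_sqn W : slices 0%E (fun p => (sqn (W p))%:E) `<=` slices 0 W.
Proof.
by move=> x [y Wy]; exists y; move: Wy; apply: contra_neq => ->; rewrite sqn0.
Qed.

Lemma measurable_inner_energy W : cmeasurable W -> sigma_finite_cover (slices 0 W) ->
  measurable_fun setT (fun y => \int[m1]_x (sqn (W (x, y)))%:E)%E.
Proof.
move=> mW sW; apply: (measurable_inner_integral (F := fun p => (sqn (W p))%:E)).
- by apply/measurable_EFinP; exact: measurable_sqn.
- by move=> p; rewrite lee_fin sqn_ge0.
- exact: sigma_finite_coverS (@slices_sqn W) sW.
Qed.

Lemma inner_energy_ge0 W y : (0 <= \int[m1]_x (sqn (W (x, y)))%:E)%E.
Proof. by apply: integral_ge0 => x _; rewrite lee_fin sqn_ge0. Qed.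

(** The sigma-finite support in the inner variable stands in for the
    sigma-finiteness of m1; it passes to pointwise limits and to products. *)
Definition tame W (c : R) :=
  [/\ cmeasurable W, sigma_finite_cover (slices 0 W) & (iterated_energy W <= c%:E)%E].

(** Fatou's lemma, for the inner and then for the outer integral. *)
Lemma tame_limit (Wn : nat -> T1 * T2 -> R[i]) W (cn : nat -> R) c :
  (forall n, tame (Wn n) (cn n)) -> (forall p, ccvg (Wn ^~ p) (W p)) ->
  cn n @[n --> \oo] --> c -> tame W c.
Proof.
move=> tW WnW cnc.
have mWn n : cmeasurable (Wn n) by case: (tW n).
have sWn n : sigma_finite_cover (slices 0 (Wn n)) by case: (tW n).
have mW : cmeasurable W by exact: cmeasurable_cvg WnW.
have sW : sigma_finite_cover (slices 0 W).
  apply: sigma_finite_coverS (sigma_finite_cover_bigcup sWn) => x [y Wxy].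
  apply: contrapT => nWn; move/eqP: Wxy; apply.
  rewrite -(climE (WnW (x, y))) -[RHS](climE (ccvg_cst 0)).
  congr clim; apply/funext => n; apply/eqP/negPn/negP => Wnxy.
  by apply: nWn; exists n => //; exists y.
split=> //.
have mI n := measurable_inner_energy (mWn n) (sWn n).
apply: (@le_trans _ _ (\int[m2]_y limn_einf
    (fun n => \int[m1]_x (sqn (Wn n (x, y)))%:E))%E).
  apply: ge0_le_integral => //.
  - by move=> y _; exact: inner_energy_ge0.
  - exact: measurable_inner_energy.
  - apply: measurableT_comp => //; apply: measurable_fun_limn_esup => n.
    exact: measurableT_comp.
  - move=> y _; rewrite (eq_integral
      (fun x => limn_einf (fun n => (sqn (Wn n (x, y)))%:E))) => [|x _].
      apply: fatou => // n; last by move=> x _; rewrite lee_fin sqn_ge0.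
      apply/measurable_EFinP; apply: measurable_sqn.
      exact: cmeasurable_slice.
    by have [-> _] := cvg_limn_einf_sup (cvg_EFinn (cvg_sqn (WnW (x, y)))).
apply: (@le_trans _ _ (limn_einf (fun n => iterated_energy (Wn n)))).
  by apply: fatou => // n y _; exact: inner_energy_ge0.
apply: limn_einf_le (cvg_EFinn cnc) => n.
by case: (tW n).
Qed.

End IteratedIntegrals.

(** * The energy of a Stockwell transform *)

Lemma integral_finite_map (R : realType) (T : ptopologicalType)
    (mu : {measure set (borel T) -> \bar R}) (C : set (borel T)) (tau : T -> T) :
  measurable C -> finite_map tau ->
  exists s : seq T, forall q : T -> R, (forall y, 0 <= q y) ->
  (\int[mu]_t (\1_C t * q (tau t))%:E =
   \sum_(y <- s) mu (C `&` tau @^-1` [set y]) * (q y)%:E)%E.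
Proof.
move=> mC [[s0 sP] mtau]; exists (undup s0) => q q0; set s := undup s0.
have mCy y : measurable (C `&` tau @^-1` [set y] : set (borel T)).
  exact: measurableI _ _ mC (mtau y).
have mI y : measurable_fun setT (fun t : borel T => ((q y)%:E * (\1_(C `&` tau @^-1` [set y]) t)%:E)%E).
  by apply: emeasurable_funM => //; apply/measurable_EFinP; exact: measurable_indic.
transitivity (\int[mu]_t \sum_(y <- s)
    ((q y)%:E * (\1_(C `&` tau @^-1` [set y]) t)%:E))%E.
  apply: eq_integral => t _.
  rewrite (bigD1_seq (tau t)) ?undup_uniq//=; last by rewrite mem_undup.
  rewrite big1 ?adde0 => [|y yt].
    rewrite -EFinM mulrC; congr ((_ * _)%:E); rewrite !indicE; congr (_%:R).
    have [Ct|nCt] := pselect (C t); first by rewrite !mem_set.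
    by rewrite !memNset// => -[].
  rewrite indicE memNset ?mule0// => -[_ /= ty].
  by move: yt; rewrite ty eqxx.
rewrite ge0_integral_sum//; last first.
  by move=> y t _; rewrite -EFinM lee_fin mulr_ge0.
apply: eq_bigr => y _; rewrite ge0_integralZl ?lee_fin//.
  by rewrite integral_indic// setIT muleC.
by apply/measurable_EFinP; exact: measurable_indic.
Qed.

Section Ambiguity.
Context (R : realType) (G : topologicalGroupType).
Variables (mu : {measure set (borel G) -> \bar R}) (K : set G).
Variable nu : {measure set (borel (SplusT mu K)) -> \bar R}.
Hypothesis hausdorffG : hausdorff_space G.
Hypothesis lcG : locally_compact [set: G].
Hypothesis haar : left_haar mu.
Hypothesis subgroupK : subgroup K.
Hypothesis compactK : compact K.
Hypothesis gelfandGK : gelfand_pair mu K.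
Hypothesis isometry : plancherel_isometry nu.
Implicit Types (f g h : G -> R[i]) (phi : SplusT mu K).

(** The Stockwell transform of f for the window g, before the dilation and its
    normalization; as a function of t and phi it is the ambiguity function of
    signal analysis. *)
Definition ambiguity f g (p : borel G * borel (SplusT mu K)) : R[i] :=
  hat (fun x => f x * (g (p.1^-1 * x)%g)^*) p.2.

Lemma lmul_cjcont f g : ccont f -> ccont g ->
  ccont (fun p : G * G => f p.2 * (g (p.1^-1 * p.2)%g)^*).
Proof.
move=> cf cg; apply: ccontM.
  by apply: (ccont_comp cf) => p; exact: cvg_snd.
apply: ccontJ; apply: (@ccont_comp _ _ _ g (fun p : G * G => (p.1^-1 * p.2)%g) cg).
apply: continuous_mulg => q; last exact: cvg_snd.
by apply: continuous_invg => q'; exact: cvg_fst.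
Qed.

Lemma Cc_sqn f : Ccc f -> Cc (fun x => sqn (f x)).
Proof.
move=> [cf [D cD fD]]; split; first exact: ccont_sqn.
by exists D => // x /fD ->; rewrite sqn0.
Qed.

(** By left invariance the double integral of |f(x)|^2 |g(t^-1 x)|^2 is |f|^2
    times the integral of |g(t^-1)|^2. *)
Lemma lmul_energy f g : Ccc f -> Ccc g ->
  (\int[mu]_t (sqnorm mu (fun x => f x * (g (t^-1 * x)%g)^*))%:E =
   (sqnorm mu f * sqnorm mu g)%:E)%E.
Proof.
move=> fC gC; have fC2 := Cc_sqn fC; have gC2 := Cc_sqn gC.
rewrite EFinM /sqnorm -(unimodular hausdorffG lcG haar subgroupK compactK gelfandGK gC2).
rewrite (integral_lmul_ge0 hausdorffG haar fC2 _ gC2)//; try by move=> x; exact: sqn_ge0.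
apply: eq_integral => t _.
have [cf [D cD fD]] := fC; have [cg _] := gC.
rewrite -(Cc_integralE hausdorffG haar).
  by apply: eq_integral => x _; rewrite sqnM sqnJ.
apply: Cc_sqn; split; last by exists D => // x /fD ->; rewrite mul0r.
apply: ccontM => //; apply: ccontJ.
by apply: (ccont_comp cg (h := fun x => (t^-1 * x)%g)); exact: continuous_lmul.
Qed.

Lemma hatB f g phi : cintegrable mu f -> cintegrable mu g ->
  hat (fun x => f x - g x) phi = hat f phi - hat g phi.
Proof.
move=> fi gi; have gi' := cintegrableZ (-1) (cintegrable_sph phi gi).
rewrite -[in RHS]mulN1r /hat -cintegralZ; last exact: cintegrable_sph.
rewrite -cintegralD//; last exact: cintegrable_sph.
by apply: eq_cintegral => x; rewrite mulrBl mulN1r.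
Qed.

(** Twice the expected bound, since the two coordinates of the integral are
    estimated separately. *)
Lemma hat_bound f phi M (b : \bar R) : cintegrable mu f -> 0 < M ->
  (forall x, normc (sph phi x) <= M) ->
  (\int[mu]_x (normc (f x))%:E <= b)%E ->
  ((normc (hat f phi))%:E <= M%:E * b + M%:E * b)%E.
Proof.
move=> fi M0 HM fb; have fpi := cintegrable_sph phi fi.
have mf := cintegrable_normc fi; have mfp := cintegrable_normc fpi.
have H : (\int[mu]_x (normc (f x * (sph phi x)^*))%:E <= M%:E * b)%E.
  apply: (@le_trans _ _ (M%:E * \int[mu]_x (normc (f x))%:E)%E); last first.
    by apply: lee_wpmul2l => //; rewrite lee_fin ltW.
  rewrite -ge0_integralZl ?lee_fin ?(ltW M0)//; last first.
  - by move=> x _; rewrite lee_fin normc_ge0.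
  - exact: measurable_int mf.
  apply: ge0_le_integral => //.
  - by move=> x _; rewrite lee_fin normc_ge0.
  - exact: measurable_int mfp.
  - by apply: measurable_int (integrableZl _ _ mf).
  - by move=> x _; rewrite -EFinM lee_fin normcM normcJ mulrC ler_wpM2r ?normc_ge0.
apply: le_trans (_ : (_ <= (`|rp (hat f phi)|)%:E + (`|ip (hat f phi)|)%:E)%E) _.
  by rewrite -EFinD lee_fin normc_le_coord.
apply: leeD.
  exact: le_trans (cintegral_rp_le fpi) H.
exact: le_trans (cintegral_ip_le fpi) H.
Qed.

Lemma Ccc_cintegrable f : Ccc f -> cintegrable mu f.
Proof.
move=> [[fr fi] [D cD fD]]; split; apply: (Cc_integrable hausdorffG haar); split=> //;
  by exists D => // x /fD ->.
Qed.

(** The product f(x) g(t^-1 x)^* is approximated by functions that depend on t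
    through finitely many values; for these the integrals in t and in phi are
    exchanged as finite sums, whatever the two measures are. *)
Lemma tame_ambiguity_Ccc f g : Ccc f -> Ccc g ->
  tame mu nu (ambiguity f g) (sqnorm mu f * sqnorm mu g).
Proof.
move=> fC gC; have [cf [D cD fD]] := fC; have [cg [E cE gE]] := gC.
pose Phi (t x : G) : R[i] := f x * (g (t^-1 * x)%g)^*.
have cPhi : ccont (fun p : G * G => Phi p.1 p.2) by exact: lmul_cjcont.
pose C := quotients D E.
have cC : compact C by exact: compact_quotients.
have mC := compact_borel hausdorffG cC.
have mD := compact_borel hausdorffG cD.
have Cfin := haar_compact haar cC; have Dfin := haar_compact haar cD.
have PhiC t x : ~ C t -> Phi t x = 0.
  move=> nCt; have [Dx|nDx] := pselect (D x); last by rewrite /Phi fD// mul0r.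
  rewrite /Phi gE ?rmorph0 ?mulr0// => Etx; apply: nCt.
  exact: quotients_lmul Dx Etx.
have PhiD t : supported (Phi t) D by move=> x nDx; rewrite /Phi fD// mul0r.
have PhiCc t : Ccc (Phi t).
  split; last by exists D.
  apply: (ccont_comp cPhi (h := fun x => (t, x))) => x.
  by apply: cvg_pair; [exact: cvg_cst|exact: cvg_id].
have PhiL t := Ccc_L2 hausdorffG haar (PhiCc t).
have Phii t := Ccc_cintegrable (PhiCc t).
pose Q t := sqnorm mu (Phi t).
have Q0 t : 0 <= Q t by exact: sqnorm_ge0.
have cQ : continuous Q.
  apply: (continuous_integral hausdorffG haar (Phi := fun t x => sqn (Phi t x))).
    exact: (ccont_sqn cPhi).
  by move=> t0; exists D => //; apply: nearW => t x /PhiD ->; rewrite sqn0.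
have /choice[tau tauP] (n : nat) : exists tau : G -> G, finite_map tau /\
    forall t, C t -> (forall x, D x -> normc (Phi t x - Phi (tau t) x) < n.+1%:R^-1) /\
                     `|Q t - Q (tau t)| < n.+1%:R^-1.
  have n0 : 0 < n.+1%:R^-1 :> R by rewrite invr_gt0.
  have n2 : 0 < n.+1%:R^-1 / 2 :> R by rewrite divr_gt0.
  have [|tau ft tE] := finite_selection
    (E := fun s t => (forall x, D x -> normc (Phi t x - Phi s x) < n.+1%:R^-1) /\
                     `|Q t - Q s| < n.+1%:R^-1) cC; last by exists tau.
  move=> s.
  have t1 := jcont_tube (Phi := fun t x => rp (Phi t x)) s cPhi.1 cD n2.
  have t2 := jcont_tube (Phi := fun t x => ip (Phi t x)) s cPhi.2 cD n2.
  have t3 : \forall t \near s, `|Q s - Q t| < n.+1%:R^-1.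
    by have /cvgrPdist_lt/(_ _ n0) := cQ s.
  near=> t.
  have h1 : forall x, D x -> `|rp (Phi t x) - rp (Phi s x)| < n.+1%:R^-1 / 2.
    by near: t; exact: t1.
  have h2 : forall x, D x -> `|ip (Phi t x) - ip (Phi s x)| < n.+1%:R^-1 / 2.
    by near: t; exact: t2.
  split; last by rewrite distrC; near: t; exact: t3.
  move=> x Dx; apply: le_lt_trans (normc_le_coord _) _.
  by rewrite !(rpD, ipD, rpN, ipN) [ltRHS]splitr ltrD ?h1 ?h2.
(* the n-th approximation of the transform, for which t ranges over finitely many
   values; the last term of c n integrates |Q t - Q (tau n t)| over C *)
pose W n (p : borel G * borel (SplusT mu K)) : R[i] :=
  (\1_C p.1)%:C%C * hat (Phi (tau n p.1)) p.2.
pose c n : R := sqnorm mu f * sqnorm mu g + n.+1%:R^-1 * fine (mu C).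
have cE' : c n @[n --> \oo] --> sqnorm mu f * sqnorm mu g.
  rewrite -[X in _ --> X]addr0; apply: cvgD; first exact: cvg_cst.
  by rewrite -[X in _ --> X](mul0r (fine (mu C))); apply: cvgMl; exact: cvg_harmonic.
apply: (tame_limit (Wn := W)) cE'; last first.
  move=> [t phi]; rewrite /W /ambiguity /=.
  have [Ct|nCt] := pselect (C t); last first.
    have -> : hat (fun x => f x * (g (t^-1 * x)%g)^*) phi = 0.
      rewrite /hat; under eq_cintegral do rewrite -/(Phi t _) PhiC// mul0r.
      by apply: eq_coord; rewrite /cintegral /= /Rintegral integral0.
    under eq_fun do rewrite indicE memNset// mul0r.
    exact: ccvg_cst.
  under eq_fun do rewrite indicE mem_set// mul1r.
  have [M M0 HM] := sph_bounded phi.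
  apply: ccvg_normc.
  have b n : normc (hat (Phi (tau n t)) phi - hat (Phi t) phi) <=
      (M * fine (mu D) + M * fine (mu D)) * n.+1%:R^-1.
    rewrite -hatB// mulrDl -!mulrA [fine _ * _]mulrC -lee_fin EFinD !EFinM.
    have hC : Ccc (fun x => Phi (tau n t) x - Phi t x) by exact: CccB.
    apply: (hat_bound _ M0 HM); first exact: Ccc_cintegrable.
    rewrite fineK ?ge0_fin_numE// -(setIT D) -(integral_indic mu measurableT mD).
    have mI : measurable_fun setT (fun x : borel G => (\1_D x : R)%:E).
      by apply/measurable_EFinP; exact: measurable_indic.
    rewrite -ge0_integralZl ?lee_fin//.
    apply: ge0_le_integral => //.
    - by move=> x _; rewrite lee_fin normc_ge0.
    - exact: measurable_int (cintegrable_normc (Ccc_cintegrable hC)).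
    - by apply: emeasurable_funM.
    - move=> x _; rewrite -EFinM lee_fin indicE.
      have [Dx|nDx] := pselect (D x).
        rewrite mem_set// mulr1 ltW// -normcN opprB.
        exact: ((tauP n).2 _ Ct).1.
      by rewrite memNset// mulr0 !PhiD// subrr normcE sqn0 sqrtr0.
  apply: (squeeze_cvgr (f := fun=> 0) (h := fun n =>
     (M * fine (mu D) + M * fine (mu D)) * n.+1%:R^-1)).
  - by apply: nearW => n; rewrite normc_ge0 b.
  - exact: cvg_cst.
  - rewrite -[X in _ --> X](mulr0 (M * fine (mu D) + M * fine (mu D))).
    by apply: cvgMr; exact: cvg_harmonic.
move=> n; have [ftau tauE] := tauP n; split.
- apply: cmeasurableM.
    by apply: cmeasurable_real; exact: measurable_indic_fst.
  apply: (@cmeasurable_finite_map _ _ _ (borel (SplusT mu K)) (tau n)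
    (fun y => hat (Phi y) : borel (SplusT mu K) -> R[i])) => // y.
  exact: (plancherel_hat hausdorffG haar subgroupK compactK isometry (PhiCc y)).1.
- apply: sigma_finite_coverS (sigma_finite_cover1 mC Cfin) => t [phi].
  rewrite /W /= indicE; have [//|nCt] := pselect (C t).
  by rewrite memNset// mul0r eqxx.
- have [s sE] := integral_finite_map mu mC ftau.
  have q0 phi y : 0 <= sqn (hat (Phi y) phi) by exact: sqn_ge0.
  rewrite /iterated_energy.
  under eq_integral => phi _.
    under eq_integral => t _.
      rewrite /W sqnM (_ : sqn (\1_C t)%:C%C = \1_C t); last first.
        by rewrite /sqn !coordE indicE; case: (t \in C); rewrite /= ?expr1n ?expr0n addr0.
      over.
    rewrite (sE _ (q0 phi)); over.
  have mh y : measurable_fun setT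
      (fun phi : borel (SplusT mu K) => (sqn (hat (Phi y) phi))%:E).
    apply/measurable_EFinP; apply: measurable_sqn.
    exact: (plancherel_hat hausdorffG haar subgroupK compactK isometry (PhiCc y)).1.
  rewrite ge0_integral_sum//=; last 2 first.
  + by move=> y; apply: emeasurable_funM.
  + by move=> y phi _; rewrite mule_ge0// lee_fin.
  apply: (@le_trans _ _ (\sum_(y <- s) mu (C `&` tau n @^-1` [set y]) * (Q y)%:E)%E).
    apply: lee_sum => y _; rewrite ge0_integralZl//; last by move=> phi _; rewrite lee_fin.
    apply: lee_wpmul2l => //.
    exact: (plancherel_hat hausdorffG haar subgroupK compactK isometry (PhiCc y)).2.
  rewrite -sE//.
  have mI : measurable_fun setT (fun x : borel G => (\1_C x : R)%:E).
    by apply/measurable_EFinP; exact: measurable_indic.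
  have mQ : measurable_fun setT (fun x : borel G => (Q x)%:E).
    by apply/measurable_EFinP; exact: continuous_borelR.
  have -> : (c n)%:E = (\int[mu]_t ((Q t)%:E + (n.+1%:R^-1)%:E * (\1_C t)%:E))%E.
    rewrite ge0_integralD//.
    - rewrite lmul_energy// ge0_integralZl// integral_indic// setIT.
      have Cfn : mu C \is a fin_num by rewrite ge0_fin_numE.
      by rewrite -[in RHS](fineK Cfn) -EFinM -EFinD.
    - by move=> t _; rewrite lee_fin.
    - by apply: emeasurable_funM.
  apply: ge0_le_integral => //.
  + by move=> t _; rewrite lee_fin mulr_ge0.
  + apply/measurable_EFinP; apply: measurable_funM; first exact: measurable_indic.
    have mQ2 := @measurable_finite_map _ _ _ (borel G) (tau n) (fun y _ => Q y) ftau
      (fun y => measurable_cst (Q y)).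
    apply: (measurableT_comp mQ2 (g := fun t : borel G => (t, t))).
    by apply: measurable_fun_pair; exact: measurable_id.
  + by apply: emeasurable_funD => //; apply: emeasurable_funM.
  + move=> t _; rewrite -EFinM -EFinD lee_fin indicE.
    have [Ct|nCt] := pselect (C t).
      rewrite mem_set// mul1r mulr1; have := (tauE t Ct).2.
      by rewrite distrC ltr_distl => /andP[_ /ltW].
    by rewrite memNset// mul0r mulr0 addr0.
Unshelve. all: by end_near. Qed.

Lemma L2_lmul g (t : G) : L2 mu g ->
  L2 mu (fun x => g (t^-1 * x)%g) /\ sqnorm mu (fun x => g (t^-1 * x)%g) = sqnorm mu g.
Proof.
move=> gL; have [[gr gi] gE] := gL.
have ml := @measurable_lmul G t^-1%g.
have mt : @cmeasurable _ (borel G) R (fun x => g (t^-1 * x)%g).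
  by split; [exact: (measurableT_comp gr ml)|exact: (measurableT_comp gi ml)].
have mE : measurable_fun setT (fun x : borel G => (sqn (g x))%:E).
  by apply/measurable_EFinP; apply: measurable_sqn; case: gL.
have E : energy mu (fun x => g (t^-1 * x)%g) = energy mu g.
  apply: (haar_integral_ge0 haar t^-1%g mE) => y.
  by rewrite lee_fin sqn_ge0.
have L : L2 mu (fun x => g (t^-1 * x)%g) by split=> //; rewrite E.
by split=> //; apply: EFin_inj; rewrite -!sqnormE.
Qed.

Lemma L2_lmul_product f g (t : G) : L2 mu f -> L2 mu g ->
  cintegrable mu (fun x => f x * (g (t^-1 * x)%g)^*).
Proof. by move=> fL gL; apply: L2_mul => //; exact: (L2_lmul t gL).1. Qed.

Lemma ambiguity_bound f g (t : G) phi M s : L2 mu f -> L2 mu g -> 0 < M ->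
  (forall x, normc (sph phi x) <= M) -> 0 < s ->
  normc (ambiguity f g (t, phi)) <= M * (s * sqnorm mu f + s^-1 * sqnorm mu g).
Proof.
move=> fL gL M0 HM s0; have [gtL gtE] := L2_lmul t gL.
have fgi := L2_lmul_product t fL gL.
rewrite -lee_fin.
have half (X : R) : M * X = M * (X / 2) + M * (X / 2) by field.
rewrite half.
rewrite EFinD !EFinM; apply: (hat_bound fgi M0 HM).
rewrite -gtE; exact: L2_mul_normc_le.
Qed.

Lemma L2_dense_seq f : L2 mu f -> exists2 h : nat -> G -> R[i],
  forall n, Ccc (h n) & forall n, sqnorm mu (fun x => h n x - f x) <= 4^-1 ^+ n.
Proof.
move=> fL; have /choice[h hP] (n : nat) : exists h,
    Ccc h /\ sqnorm mu (fun x => h x - f x) <= 4^-1 ^+ n.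
  have [|h hC fh] := L2_dense hausdorffG lcG haar fL (e := 4^-1 ^+ n).
    by rewrite exprn_gt0.
  exists h; split=> //; apply: le_trans (ltW fh).
  rewrite le_eqVlt; apply/orP; left; apply/eqP; apply: eq_Rintegral => x _.
  by rewrite /sqn !coordE; ring.
by exists h => n; case: (hP n).
Qed.

Lemma cvg_half : 2^-1 ^+ n @[n --> \oo] --> (0 : R).
Proof. by apply: cvg_expr; rewrite ger0_norm// invf_lt1// ltr1n. Qed.

(** |b|^2 - |a|^2 = |b - a|^2 + 2 Re <b - a, a> *)
Lemma sqnorm_close (a b : G -> R[i]) n : L2 mu a -> L2 mu b ->
  sqnorm mu (fun x => b x - a x) <= 4^-1 ^+ n ->
  `|sqnorm mu b - sqnorm mu a| <= 2^-1 ^+ n * (2 + sqnorm mu a).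
Proof.
move=> aL bL ba; have dL := L2B bL aL.
have -> : sqnorm mu b - sqnorm mu a =
    sqnorm mu (fun x => b x - a x) + 2 * rp (inner mu (fun x => b x - a x) a).
  have -> : sqnorm mu b = sqnorm mu (fun x => (b x - a x) + a x).
    by congr sqnorm; apply/funext => x; rewrite subrK.
  by rewrite sqnormD//; ring.
have n0 : 0 < 2 ^+ n :> R by rewrite exprn_gt0.
have I := inner_rp_le n0 dL aL.
have h4 : 4^-1 ^+ n = 2^-1 ^+ n * 2^-1 ^+ n :> R.
  by rewrite -exprMn; congr (_ ^+ n); field.
have h2 : 2^-1 ^+ n <= 1 :> R by rewrite exprn_ile1// invf_le1// ler1n.
have h0 : 0 <= 2^-1 ^+ n :> R by rewrite exprn_ge0.
have e0 := sqnorm_ge0 mu a; have d0 := sqnorm_ge0 mu (fun x => b x - a x).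
have dh : 2 ^+ n * sqnorm mu (fun x => b x - a x) <= 2^-1 ^+ n.
  apply: le_trans (ler_wpM2l (ltW n0) ba) _.
  by rewrite h4 mulrA -exprMn divff// expr1n mul1r.
rewrite -exprVn in I.
apply: le_trans (ler_normD _ _) _; rewrite normrM (ger0_norm d0) (ger0_norm (ler0n R 2)).
move: ba; rewrite h4 => ba.
have hh : 2^-1 ^+ n * 2^-1 ^+ n <= 2^-1 ^+ n :> R by rewrite ler_piMr.
move: I dh ba hh; set D := sqnorm mu (fun x => b x - a x); set I := `|_|.
by set q := 2^-1 ^+ n; lra.
Qed.

Lemma sqnorm_dense_cvg f (h : nat -> G -> R[i]) : L2 mu f -> (forall n, L2 mu (h n)) ->
  (forall n, sqnorm mu (fun x => h n x - f x) <= 4^-1 ^+ n) ->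
  sqnorm mu (h n) @[n --> \oo] --> sqnorm mu f.
Proof.
move=> fL hL hf; apply/subr_cvg0/norm_cvg0P.
apply: (squeeze_cvgr (f := fun=> 0) (h := fun n => 2^-1 ^+ n * (2 + sqnorm mu f))).
- by apply: nearW => n; rewrite normr_ge0 sqnorm_close.
- exact: cvg_cst.
- by rewrite -[X in _ --> X](mul0r (2 + sqnorm mu f)); apply: cvgMl; exact: cvg_half.
Qed.

Lemma ambiguityBl f f' g p : L2 mu f -> L2 mu f' -> L2 mu g ->
  ambiguity (fun x => f x - f' x) g p = ambiguity f g p - ambiguity f' g p.
Proof.
move=> fL fL' gL; rewrite /ambiguity -hatB; [|exact: L2_lmul_product..].
by apply: eq_cintegral => x; rewrite mulrBl.
Qed.

Lemma ambiguityBr f g g' p : L2 mu f -> L2 mu g -> L2 mu g' ->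
  ambiguity f (fun x => g x - g' x) p = ambiguity f g p - ambiguity f g' p.
Proof.
move=> fL gL gL'; rewrite /ambiguity -hatB; [|exact: L2_lmul_product..].
by apply: eq_cintegral => x; rewrite rmorphB mulrBr.
Qed.

(** Approximations at the squared distance 4^-n make the transforms converge
    pointwise, by [ambiguity_bound] with the weights 2^n and 2^-n. *)
Theorem tame_ambiguity f g : L2 mu f -> L2 mu g ->
  tame mu nu (ambiguity f g) (sqnorm mu f * sqnorm mu g).
Proof.
move=> fL gL.
have [a aC af] := L2_dense_seq fL; have [b bC bg] := L2_dense_seq gL.
have aL n := Ccc_L2 hausdorffG haar (aC n); have bL n := Ccc_L2 hausdorffG haar (bC n).
apply: (@tame_limit _ _ _ _ _ mu nu (fun n => ambiguity (a n) (b n)) _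
  (fun n => sqnorm mu (a n) * sqnorm mu (b n))).
- by move=> n; exact: tame_ambiguity_Ccc.
- move=> [t phi]; have [M M0 HM] := sph_bounded phi.
  have B n : normc (ambiguity (a n) (b n) (t, phi) - ambiguity f g (t, phi)) <=
      2^-1 ^+ n * (M * (2 + sqnorm mu (b n) + sqnorm mu f)).
    have -> : ambiguity (a n) (b n) (t, phi) - ambiguity f g (t, phi) =
        ambiguity (fun x => a n x - f x) (b n) (t, phi) +
        ambiguity f (fun x => b n x - g x) (t, phi).
      by rewrite ambiguityBl// ambiguityBr//; ring.
    have n0 : 0 < 2 ^+ n :> R by rewrite exprn_gt0.
    have n1 : 0 < 2^-1 ^+ n :> R by rewrite exprn_gt0.
    have B1 := ambiguity_bound t (L2B (aL n) fL) (bL n) M0 HM n0.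
    have B2 := ambiguity_bound t fL (L2B (bL n) gL) M0 HM n1.
    apply: le_trans (normcD_le _ _) _.
    apply: le_trans (lerD B1 B2) _.
    have e4 : 2 ^+ n * 4^-1 ^+ n = 2^-1 ^+ n :> R.
      by rewrite -exprMn; congr (_ ^+ n); field.
    have i1 : (2 ^+ n)^-1 = 2^-1 ^+ n :> R by rewrite exprVn.
    have i2 : (2^-1 ^+ n)^-1 = 2 ^+ n :> R by rewrite exprVn invrK.
    have h1 := ler_wpM2l (ltW n0) (af n); have h2 := ler_wpM2l (ltW n0) (bg n).
    rewrite e4 in h1 h2; rewrite i1 i2 -mulrDr mulrCA ler_wpM2l ?(ltW M0)//.
    by lra.
  apply: ccvg_normc.
  apply: (squeeze_cvgr (f := fun=> 0)
    (h := fun n => 2^-1 ^+ n * (M * (2 + sqnorm mu (b n) + sqnorm mu f)))).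
  + by apply: nearW => n; rewrite normc_ge0 B.
  + exact: cvg_cst.
  + rewrite -[X in _ --> X](mul0r (M * (2 + sqnorm mu g + sqnorm mu f))).
    apply: cvgM; first exact: cvg_half.
    apply: cvgMr; apply: cvgD; last exact: cvg_cst.
    by apply: cvgD; [exact: cvg_cst|exact: sqnorm_dense_cvg].
- by apply: cvgM; exact: sqnorm_dense_cvg.
Qed.

End Ambiguity.

(** * Iterated integrals of products *)

Section IteratedProducts.
Context d1 (T1 : measurableType d1) d2 (T2 : measurableType d2) (R : realType).
Variables (m1 : {measure set T1 -> \bar R}) (m2 : {measure set T2 -> \bar R}).
Implicit Types w A B u : T1 * T2 -> R[i].

Definition inner_mass w y := (\int[m1]_x (normc (w (x, y)))%:E)%E.

Lemma inner_mass_ge0 w y : (0 <= inner_mass w y)%E.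
Proof. by apply: integral_ge0 => x _; rewrite lee_fin normc_ge0. Qed.

Lemma inner_cintegrable w y : cmeasurable w -> (inner_mass w y < +oo)%E ->
  cintegrable m1 (fun x => w (x, y)).
Proof. by move=> mw wy; apply: cintegrableP => //; exact: cmeasurable_slice. Qed.

(** Where the inner integral of |w| is infinite, it bounds the inner integral of
    w trivially, so that the bound holds for every y. *)
Lemma iterated_cintegrable w : iterated_integrable m1 m2 w ->
  cintegrable m2 (fun y => cintegral m1 (fun x => w (x, y))) /\
  ((`|rp (iterated_integral m1 m2 w)|)%:E <= \int[m2]_y inner_mass w y)%E.
Proof.
move=> [mw iw mI].
have rb y : ((`|rp (cintegral m1 (fun x => w (x, y)))|)%:E <= inner_mass w y)%E.
  have [wy|] := ltP (inner_mass w y) +oo%E; last by move=> wy; apply: le_trans wy; rewrite leey.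
  exact: cintegral_rp_le (inner_cintegrable mw wy).
have ib y : ((`|ip (cintegral m1 (fun x => w (x, y)))|)%:E <= inner_mass w y)%E.
  have [wy|] := ltP (inner_mass w y) +oo%E; last by move=> wy; apply: le_trans wy; rewrite leey.
  exact: cintegral_ip_le (inner_cintegrable mw wy).
have ci : cintegrable m2 (fun y => cintegral m1 (fun x => w (x, y))).
  by split; apply: (integrable_dom _ iw) => //; case: mI.
split=> //.
have [ir _] := ci; rewrite /iterated_integral /cintegral /= EFin_normr_Rintegral//.
apply: le_trans (le_abse_integral _ _ _) _ => //; first exact: measurable_int ir.
apply: ge0_le_integral => //.
- by apply: measurableT_comp => //; exact: measurable_int ir.
- exact: measurable_int iw.
- by move=> y _; exact: rb.
Qed.

Lemma cintegral_ae_eq d (T : measurableType d) (m : {measure set T -> \bar R})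
    (f g : T -> R[i]) : cmeasurable f -> cmeasurable g -> aeeq m f g ->
  cintegral m f = cintegral m g.
Proof.
move=> [fr fi] [gr gi] fg; apply: eq_coord; rewrite /cintegral /= /Rintegral;
  congr fine; apply: ae_eq_integral => //; try exact/measurable_EFinP;
  by apply: ae_mono fg => x ->.
Qed.

Lemma iterated_integralDZ w1 w2 (c : R[i]) : iterated_integrable m1 m2 w1 ->
  iterated_integrable m1 m2 w2 -> iterated_integrable m1 m2 (fun p => w1 p + c * w2 p) ->
  iterated_integral m1 m2 (fun p => w1 p + c * w2 p) =
  iterated_integral m1 m2 w1 + c * iterated_integral m1 m2 w2.
Proof.
move=> i1 i2 [_ _ mI12].
have [c1 _] := iterated_cintegrable i1; have [c2 _] := iterated_cintegrable i2.
have [mw1 iw1 mI1] := i1; have [mw2 iw2 mI2] := i2.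
rewrite /iterated_integral -cintegralZ// -cintegralD//; last exact: cintegrableZ.
apply: cintegral_ae_eq => //; first by apply: cmeasurableD => //; exact: cmeasurableZ.
apply: (ae_mono2 _ (integrable_ae measurableT iw1) (integrable_ae measurableT iw2)).
move=> y /(_ I) f1 /(_ I) f2.
have h1 : cintegrable m1 (fun x => w1 (x, y)).
  by apply: inner_cintegrable => //; rewrite -ge0_fin_numE// inner_mass_ge0.
have h2 : cintegrable m1 (fun x => w2 (x, y)).
  by apply: inner_cintegrable => //; rewrite -ge0_fin_numE// inner_mass_ge0.
by rewrite cintegralD ?cintegralZ//; exact: cintegrableZ.
Qed.

(** [normc_mul_le] with the weight M. *)
Lemma iterated_product u A B a b (M : R) : 0 < M -> cmeasurable u ->
  iterated_ae m1 m2 (fun p => ((normc (u p))%:E <= M%:E)%E) ->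
  tame m1 m2 A a -> tame m1 m2 B b ->
  let w p := u p * A p * (B p)^* in
  iterated_integrable m1 m2 w /\
  (\int[m2]_y inner_mass w y <= ((M ^+ 2 * a + b) / 2)%:E)%E.
Proof.
move=> M0 mu_ uM [mA sA eA] [mB sB eB] w.
have mw : cmeasurable w.
  by apply: cmeasurableM; [exact: cmeasurableM|exact: cmeasurableJ].
have sw : sigma_finite_cover m1 (slices 0 w).
  apply: sigma_finite_coverS sA => x [y wxy]; exists y.
  by apply: contra_neq wxy => A0; rewrite /w A0 mulr0 mul0r.
have mmass : measurable_fun setT (inner_mass w).
  apply: (measurable_inner_integral (F := fun p => (normc (w p))%:E)).
  - by apply/measurable_EFinP; exact: measurable_normc.
  - by move=> p; rewrite lee_fin normc_ge0.
  - apply: sigma_finite_coverS sw => x [y wxy]; exists y.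
    by apply: contra_neq wxy => ->; rewrite normcE sqn0 sqrtr0.
have mEA := measurable_inner_energy mA sA; have mEB := measurable_inner_energy mB sB.
pose IA y := (\int[m1]_x (sqn (A (x, y)))%:E)%E.
pose IB y := (\int[m1]_x (sqn (B (x, y)))%:E)%E.
have M20 : 0 <= M ^+ 2 / 2 by rewrite divr_ge0// sqr_ge0.
have H20 : 0 <= 2^-1 :> R by [].
have mAy y : measurable_fun setT (fun x => (sqn (A (x, y)))%:E).
  by apply/measurable_EFinP; apply: measurable_sqn; exact: cmeasurable_slice.
have mBy y : measurable_fun setT (fun x => (sqn (B (x, y)))%:E).
  by apply/measurable_EFinP; apply: measurable_sqn; exact: cmeasurable_slice.
have massle : {ae m2, forall y, (inner_mass w y <=
    (M ^+ 2 / 2)%:E * IA y + (2^-1)%:E * IB y)%E}.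
  apply: ae_mono uM => y uMy.
  rewrite -!ge0_integralZl//; try by move=> x _; rewrite lee_fin sqn_ge0.
  rewrite -ge0_integralD//; first last.
  - by apply: emeasurable_funM.
  - by move=> x _; rewrite -EFinM lee_fin mulr_ge0// sqn_ge0.
  - by apply: emeasurable_funM.
  - by move=> x _; rewrite -EFinM lee_fin mulr_ge0// sqn_ge0.
  apply: ae_ge0_le_integral => //.
  - by move=> x _; rewrite lee_fin normc_ge0.
  - by apply/measurable_EFinP; apply: measurable_normc; exact: cmeasurable_slice.
  - by move=> x _; rewrite -!EFinM -EFinD lee_fin addr_ge0// mulr_ge0// sqn_ge0.
  - by apply: emeasurable_funD; apply: emeasurable_funM.
  - apply: ae_mono uMy => x; rewrite lee_fin => uMx _.
    rewrite -!EFinM -EFinD lee_fin /w -mulrA normcM.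
    apply: le_trans (ler_wpM2r (normc_ge0 _) uMx) _.
    apply: le_trans (ler_wpM2l (ltW M0) (normc_mul_le _ _ M0)) _.
    rewrite sqnJ le_eqVlt; apply/orP; left; apply/eqP.
    by field; rewrite gt_eqF.
have mass_le : (\int[m2]_y inner_mass w y <= ((M ^+ 2 * a + b) / 2)%:E)%E.
  apply: (@le_trans _ _ (\int[m2]_y ((M ^+ 2 / 2)%:E * IA y + (2^-1)%:E * IB y))%E).
    apply: ae_ge0_le_integral => //.
    - by move=> y _; exact: inner_mass_ge0.
    - by move=> y _; rewrite adde_ge0// mule_ge0// ?lee_fin// inner_energy_ge0.
    - by apply: emeasurable_funD; apply: emeasurable_funM.
    - by apply: ae_mono massle.
  rewrite ge0_integralD//; first last.
  - by apply: emeasurable_funM.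
  - by move=> y _; rewrite mule_ge0// ?lee_fin// inner_energy_ge0.
  - by apply: emeasurable_funM.
  - by move=> y _; rewrite mule_ge0// ?lee_fin// inner_energy_ge0.
  rewrite !ge0_integralZl//; try by move=> y _; exact: inner_energy_ge0.
  rewrite (_ : ((M ^+ 2 * a + b) / 2)%:E = (M ^+ 2 / 2)%:E * a%:E + (2^-1)%:E * b%:E)%E.
    by apply: leeD; apply: lee_wpmul2l.
  by rewrite -!EFinM -EFinD; congr EFin; field.
split=> //; split=> //; last exact: cmeasurable_inner_integral.
apply/integrableP; split=> //.
rewrite (eq_integral (inner_mass w)) => [|y _]; last by rewrite gee0_abs// inner_mass_ge0.
by apply: le_lt_trans mass_le _; rewrite ltry.
Qed.

End IteratedProducts.

(** * Localization operators *)

Lemma sqnorm_automorphism (R : realType) (G : topologicalGroupType)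
    (mu : {measure set (borel G) -> \bar R}) (alpha : G -> G) (delta : R)
    (f : G -> R[i]) : topological_automorphism alpha -> modulus mu alpha delta ->
  L2 mu f -> L2 mu (f \o alpha) /\ sqnorm mu (f \o alpha) = delta^-1 * sqnorm mu f.
Proof.
move=> [_ ca [beta [aK bK cb]]] [d0 dA] fL.
have ma : measurable_fun setT (alpha : borel G -> borel G) by exact: continuous_borel.
have [[fr fi] _] := fL.
have mfa : @cmeasurable _ (borel G) R (f \o alpha).
  by split; [exact: (measurableT_comp fr ma)|exact: (measurableT_comp fi ma)].
have di : 0 <= delta^-1 by rewrite invr_ge0 ltW.
have mE : measurable_fun setT (fun x : borel G => (sqn (f x))%:E).
  by apply/measurable_EFinP; apply: measurable_sqn; case: fL.
have E : energy mu (f \o alpha) = ((delta^-1)%:E * energy mu f)%E.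
  rewrite /energy -(ge0_integral_mscale mu measurableT (NngNum di) mE); last first.
    by move=> x _; rewrite lee_fin sqn_ge0.
  apply: (ge0_integral_image ma) => // [A mA|y]; last by rewrite lee_fin sqn_ge0.
  have mpre : measurable (alpha @^-1` A : set (borel G)).
    by rewrite -[X in measurable X]setTI; exact: ma.
  have := dA _ mpre; rewrite image_preimage; last first.
    by apply/seteqP; split=> // x _; exists (beta x).
  move=> e; apply: (@etrans _ _ ((delta^-1)%:E * mu A)%E) => //.
  by rewrite e muleA -EFinM mulVf ?gt_eqF// mul1e.
have L : L2 mu (f \o alpha).
  by split=> //; rewrite E sqnormE// -EFinM ltry.
by split=> //; apply: EFin_inj; rewrite -sqnormE// E sqnormE// EFinM.
Qed.

Lemma iterated_ae_mono d1 (T1 : measurableType d1) d2 (T2 : measurableType d2)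
    (R : realType) (m1 : {measure set T1 -> \bar R}) (m2 : {measure set T2 -> \bar R})
    (P Q : T1 * T2 -> Prop) : (forall p, P p -> Q p) ->
  iterated_ae m1 m2 P -> iterated_ae m1 m2 Q.
Proof. by move=> PQ; apply: ae_mono => y; apply: ae_mono => x /PQ. Qed.

Lemma Linfnorm_lt_bound d1 (T1 : measurableType d1) d2 (T2 : measurableType d2)
    (R : realType) (m1 : {measure set T1 -> \bar R}) (m2 : {measure set T2 -> \bar R})
    (u : T1 * T2 -> R[i]) (M : R) : (Linfnorm m1 m2 u < M%:E)%E ->
  iterated_ae m1 m2 (fun p => ((normc (u p))%:E <= M%:E)%E).
Proof.
move=> /ereal_inf_lt[N [_ uN] NM]; apply: iterated_ae_mono uN => p uN.
exact: le_trans uN (ltW NM).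
Qed.

Lemma Linfnorm_ge0 d1 (T1 : measurableType d1) d2 (T2 : measurableType d2)
    (R : realType) (m1 : {measure set T1 -> \bar R}) (m2 : {measure set T2 -> \bar R})
    (u : T1 * T2 -> R[i]) : (0 <= Linfnorm m1 m2 u)%E.
Proof. by apply/ereal_infP => M []. Qed.

Lemma Linfnorm_bound d1 (T1 : measurableType d1) d2 (T2 : measurableType d2)
    (R : realType) (m1 : {measure set T1 -> \bar R}) (m2 : {measure set T2 -> \bar R})
    (u : T1 * T2 -> R[i]) (e : R) : (Linfnorm m1 m2 u < +oo)%E -> 0 < e ->
  0 < fine (Linfnorm m1 m2 u) + e /\
  iterated_ae m1 m2 (fun p => ((normc (u p))%:E <= (fine (Linfnorm m1 m2 u) + e)%:E)%E).
Proof.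
have u0 := Linfnorm_ge0 m1 m2 u; move=> uoo e0.
split; first by rewrite ltr_wpDl// fine_ge0.
apply: Linfnorm_lt_bound.
by rewrite EFinD fineK ?ge0_fin_numE// lteDl// ?lte_fin// ge0_fin_numE.
Qed.

Section Localization.
Context (R : realType) (G : topologicalGroupType).
Variables (mu : {measure set (borel G) -> \bar R}) (K : set G).
Variable nu : {measure set (borel (SplusT mu K)) -> \bar R}.
Variables (alpha : G -> G) (delta : R) (theta : G -> R[i]).
Variable u : borel G * borel (SplusT mu K) -> R[i].
Hypothesis hausdorffG : hausdorff_space G.
Hypothesis lcG : locally_compact [set: G].
Hypothesis haar : left_haar mu.
Hypothesis subgroupK : subgroup K.
Hypothesis compactK : compact K.
Hypothesis gelfandGK : gelfand_pair mu K.
Hypothesis isometry : plancherel_isometry nu.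
Hypothesis auto_alpha : topological_automorphism alpha.
Hypothesis modulus_alpha : modulus mu alpha delta.
Hypothesis theta_L2 : L2 mu theta.
Hypothesis theta_norm1 : sqnorm mu theta = 1.
Hypothesis measurable_u : cmeasurable u.
Implicit Types (f g h : G -> R[i]) (phi : SplusT mu K).

Let window (x : G) : R[i] := (Num.sqrt delta)%:C%C * theta (alpha x).

Let window_L2 : L2 mu window.
Proof. by apply: L2Z; case: (sqnorm_automorphism auto_alpha modulus_alpha theta_L2). Qed.

Let window_norm1 : sqnorm mu window = 1.
Proof.
have [L E] := sqnorm_automorphism auto_alpha modulus_alpha theta_L2.
have [d0 _] := modulus_alpha.
rewrite /window (sqnormZ _ L) E theta_norm1 mulr1.
rewrite /sqn !coordE expr0n addr0 sqr_sqrtr; last exact: ltW.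
by rewrite mulfV ?gt_eqF.
Qed.

Local Notation atom := (atom alpha delta theta).
Local Notation stockwell := (@stockwell R G mu K alpha delta theta).

Lemma atomE phi t x : atom phi t x = sph phi x * window (t^-1 * x)%g.
Proof. by rewrite /Defs.atom /window; ring. Qed.

Lemma atom_L2 phi t : L2 mu (atom phi t).
Proof.
have [L _] := L2_lmul haar t window_L2; have [M M0 HM] := sph_bounded phi.
rewrite (_ : atom phi t = fun x => sph phi x * window (t^-1 * x)%g); last first.
  by apply/funext => x; exact: atomE.
apply: (L2_dom (mu := mu) (b := fun x => M ^+ 2 * sqn (window (t^-1 * x)%g))).
- by apply: cmeasurableM; [apply: ccont_cmeasurable; exact: sph_ccont|case: L].
- rewrite (_ : _ \o _ = fun x => ((M ^+ 2)%:E * (sqn (window (t^-1 * x)%g))%:E)%E).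
    by apply: integrableZl => //; exact: L2_integrable_sqn L.
  by apply/funext => x /=; rewrite EFinM.
- move=> x; rewrite sqnM ler_wpM2r ?sqn_ge0// -sqr_normc.
  by rewrite lerXn2r ?nnegrE ?normc_ge0// ltW.
Qed.

Lemma stockwell_ambiguity f p : stockwell f p = ambiguity f window p.
Proof.
by apply: eq_cintegral => x; rewrite atomE rmorphM /= mulrA mulrAC.
Qed.

Lemma tame_stockwell f : L2 mu f -> tame mu nu (stockwell f) (sqnorm mu f).
Proof.
move=> fL.
have := tame_ambiguity hausdorffG lcG haar subgroupK compactK gelfandGK isometry fL window_L2.
rewrite window_norm1 mulr1; congr (tame _ _ _ _).
by apply/funext => p; rewrite stockwell_ambiguity.
Qed.

Lemma stockwellDZ f g (c : R[i]) p : L2 mu f -> L2 mu g ->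
  stockwell (fun x => f x + c * g x) p = stockwell f p + c * stockwell g p.
Proof.
move=> fL gL; have aL := atom_L2 p.2 p.1.
by rewrite /Defs.stockwell innerDl ?innerZl//; exact: L2Z.
Qed.

Lemma inner_atom g p : L2 mu g -> inner mu (atom p.2 p.1) g = (stockwell g p)^*.
Proof. by move=> gL; rewrite (innerJ gL (atom_L2 p.2 p.1)). Qed.

Let integrand f g p : R[i] := u p * stockwell f p * inner mu (atom p.2 p.1) g.

Let pairing f g : R[i] := iterated_integral mu nu (integrand f g).

Section Bound.
Variable M : R.
Hypothesis M0 : 0 < M.
Hypothesis uM : iterated_ae mu nu (fun p => ((normc (u p))%:E <= M%:E)%E).

Lemma integrand_bound f g : L2 mu f -> L2 mu g ->
  iterated_integrable mu nu (integrand f g) /\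
  `|rp (pairing f g)| <= (M ^+ 2 * sqnorm mu f + sqnorm mu g) / 2.
Proof.
move=> fL gL.
have [wi wb] := iterated_product M0 measurable_u uM (tame_stockwell fL) (tame_stockwell gL).
have wE : (fun p => u p * stockwell f p * (stockwell g p)^*) = integrand f g.
  by apply/funext => p; rewrite /integrand inner_atom.
rewrite wE in wi wb; split=> //.
by rewrite -lee_fin; apply: le_trans (iterated_cintegrable wi).2 wb.
Qed.

Lemma pairingDZr f g h (c : R[i]) : L2 mu f -> L2 mu g -> L2 mu h ->
  pairing f (fun x => g x + c * h x) = pairing f g + c^* * pairing f h.
Proof.
move=> fL gL hL; have cL := L2D gL (L2Z c hL).
have wE : integrand f (fun x => g x + c * h x) =
    fun p => integrand f g p + c^* * integrand f h p.
  apply/funext => p; rewrite /integrand !inner_atom// stockwellDZ//.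
  by rewrite rmorphD rmorphM /=; ring.
rewrite /pairing wE; apply: iterated_integralDZ;
  [exact: (integrand_bound fL gL).1|exact: (integrand_bound fL hL).1|].
by rewrite -wE; exact: (integrand_bound fL cL).1.
Qed.

Lemma pairingDZl f g h (c : R[i]) : L2 mu f -> L2 mu g -> L2 mu h ->
  pairing (fun x => c * f x + g x) h = c * pairing f h + pairing g h.
Proof.
move=> fL gL hL; have cL := L2D gL (L2Z c fL).
rewrite (_ : (fun x => c * f x + g x) = fun x => g x + c * f x); last first.
  by apply/funext => x; rewrite addrC.
have wE : integrand (fun x => g x + c * f x) h =
    fun p => integrand g h p + c * integrand f h p.
  by apply/funext => p; rewrite /integrand stockwellDZ//; ring.
rewrite /pairing wE addrC; apply: iterated_integralDZ;
  [exact: (integrand_bound gL hL).1|exact: (integrand_bound fL hL).1|].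
by rewrite -wE; exact: (integrand_bound cL hL).1.
Qed.

(** The functional g |-> Re <L f, g> is represented by [riesz], whose
    boundedness hypothesis is the inequality of [integrand_bound]. *)
Lemma exists_localization_operator :
  exists L, is_localization_operator nu alpha delta theta u L.
Proof.
have X := LpK2_subspace mu K; have [XL X0 XD _] := X.
suff /choice[L HL] f : exists h, LpK mu K 2 f ->
    weak_integral nu (fun p => u p * stockwell f p) atom h by exists L.
have [fX|nfX] := pselect (LpK mu K 2 f); last by exists f.
have fL := XL _ fX.
have [h hX hE] : exists2 h, LpK mu K 2 h &
    forall g, LpK mu K 2 g -> rp (inner mu h g) = rp (pairing f g).
  apply: (riesz (B := M ^+ 2 * sqnorm mu f) X) => [r g k gX kX|g gX].
    rewrite pairingDZr//; [|exact: XL..].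
    by move: (pairing f g) (pairing f k) => a b; rewrite !coordE; ring.
  have [_] := integrand_bound fL (XL _ gX).
  by have := ler_norm (rp (pairing f g)); lra.
exists h => _; split=> // g gX; have gL := XL _ gX; split.
  exact: (integrand_bound fL gL).1.
(* the imaginary part is the real part of the same identity for i g *)
apply: (@eq_coord _ _ (pairing f g)); first exact: hE.
have hL := XL _ hX; have zL := XL _ X0.
have := hE _ (XD iunit _ _ X0 gX); rewrite pairingDZr//.
rewrite innerDr//; last exact: L2Z.
rewrite innerZr// rpD [RHS]rpD (hE _ X0) => /addrI.
by move: (inner mu h g) (pairing f g) => a b; rewrite !coordE; lra.
Qed.

Variable L : (G -> R[i]) -> G -> R[i].
Hypothesis locL : is_localization_operator nu alpha delta theta u L.

Let LpK2_L2 f : LpK mu K 2 f -> L2 mu f.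
Proof. by move=> /LpK2P[]. Qed.

Lemma localization_LpK f : LpK mu K 2 f -> LpK mu K 2 (L f).
Proof. by move=> /locL[]. Qed.

Lemma inner_localization f g : LpK mu K 2 f -> LpK mu K 2 g ->
  inner mu (L f) g = pairing f g.
Proof. by move=> /locL[_ H] /H[]. Qed.

(** The difference k of the two sides satisfies <k, k> = 0, since <k, g> vanishes
    for all g of L^2(G//K). *)
Lemma localization_linear (a : R[i]) f g : LpK mu K 2 f -> LpK mu K 2 g ->
  aeeq mu (L (fun x => a * f x + g x)) (fun x => a * L f x + L g x).
Proof.
move=> fX gX; have [_ _ XD _] := LpK2_subspace mu K.
have fgX : LpK mu K 2 (fun x => a * f x + g x).
  rewrite (_ : (fun x => a * f x + g x) = fun x => g x + a * f x); first exact: XD.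
  by apply/funext => x; rewrite addrC.
have LfX := localization_LpK fX; have LgX := localization_LpK gX.
have LfgX := localization_LpK fgX.
pose k x := (L (fun x => a * f x + g x) x + (- a) * L f x) + (- 1) * L g x.
have k1X := XD (- a) _ _ LfgX LfX; have kX : LpK mu K 2 k := XD (- 1) _ _ k1X LgX.
have kL := LpK2_L2 kX.
have k0 : inner mu k k = 0.
  rewrite /k innerDl; [|exact: LpK2_L2 k1X|by apply: L2Z; exact: LpK2_L2|exact: kL].
  rewrite innerDl; [|exact: LpK2_L2|by apply: L2Z; exact: LpK2_L2|exact: kL].
  rewrite !innerZl; [|exact: LpK2_L2|exact: kL|exact: LpK2_L2|exact: kL].
  rewrite !inner_localization// pairingDZl; [|exact: LpK2_L2..|exact: kL].
  by move: (pairing f k) (pairing g k) => b c; ring.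
have : sqnorm mu k = 0 by have := congr1 (@complex.Re R) k0; rewrite inner_self.
move=> /(sqnorm_eq0 kL); apply: ae_mono => x kx.
by apply/eqP; rewrite -subr_eq0 -kx /k; apply/eqP; ring.
Qed.

(** [integrand_bound] for g := L f reads |L f|^2 <= (M^2 |f|^2 + |L f|^2) / 2. *)
Lemma localization_sqnorm_le f : LpK mu K 2 f -> sqnorm mu (L f) <= M ^+ 2 * sqnorm mu f.
Proof.
move=> fX; have LX := localization_LpK fX.
have [_] := integrand_bound (LpK2_L2 fX) (LpK2_L2 LX).
rewrite -inner_localization// inner_self rpC.
by have := ler_norm (sqnorm mu (L f)); lra.
Qed.

Lemma localization_norm_le f : LpK mu K 2 f ->
  (Lpnorm mu 2 (L f) <= M%:E * Lpnorm mu 2 f)%E.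
Proof.
move=> fX; rewrite !Lpnorm2E; [|exact: LpK2_L2|by apply: LpK2_L2; exact: localization_LpK].
rewrite -EFinM lee_fin -[X in X * _](ger0_norm (ltW M0)) -sqrtr_sqr.
by rewrite -sqrtrM ?sqr_ge0// ler_wsqrtr// localization_sqnorm_le.
Qed.

End Bound.

Section Conclusion.
Hypothesis u_Linf : (Linfnorm mu nu u < +oo)%E.

Lemma bounded_localization_operator L :
  is_localization_operator nu alpha delta theta u L -> bounded_operator mu K L.
Proof.
have [M0 uM] := Linfnorm_bound u_Linf ltr01.
move=> locL; split.
- exact: (localization_LpK locL).
- exact: (localization_linear M0 uM locL).
- eexists => f; exact: (localization_norm_le M0 uM locL).
Qed.

Lemma opnorm_localization_le L :
  is_localization_operator nu alpha delta theta u L ->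
  (opnorm mu K L <= Linfnorm mu nu u)%E.
Proof.
move=> locL; apply: ge_ereal_sup => _ [f [fX f1] <-].
apply/lee_addgt0Pr => e e0; have [M0 uM] := Linfnorm_bound u_Linf e0.
apply: le_trans (localization_norm_le M0 uM locL fX) _.
rewrite EFinD fineK ?ge0_fin_numE ?Linfnorm_ge0//.
rewrite -[leRHS]mule1; apply: lee_wpmul2l => //.
by rewrite adde_ge0 ?Linfnorm_ge0 ?lee_fin ?ltW.
Qed.

End Conclusion.

End Localization.

Theorem theorem4p4 (R : realType) (G : topologicalGroupType)
    (mu : {measure set (borel G) -> \bar R}) (K : set G)
    (nu : {measure set (borel (SplusT mu K)) -> \bar R})
    (alpha : G -> G) (delta : R) (theta : G -> R[i])
    (u : borel G * borel (SplusT mu K) -> R[i])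
    (hausdorffG : hausdorff_space G)
    (locally_compactG : locally_compact [set: G])
    (haar_mu : left_haar mu)
    (subgroupK : subgroup K) (compactK : compact K)
    (gelfandGK : gelfand_pair mu K)
    (plancherel_nu : plancherel_measure nu)
    (auto_alpha : topological_automorphism alpha)
    (modulus_alpha : modulus mu alpha delta)
    (theta_L2 : LpK mu K 2 theta) (theta_norm1 : Lpnorm mu 2 theta = 1%E)
    (u_Linf : isLinf mu nu u) :
  (exists L, is_localization_operator nu alpha delta theta u L) /\
  (forall L, is_localization_operator nu alpha delta theta u L ->
     bounded_operator mu K L /\ (opnorm mu K L <= Linfnorm mu nu u)%E).
Proof.
have [thetaL _] := (LpK2P mu K theta).1 theta_L2.
have theta1 : sqnorm mu theta = 1.
  move: theta_norm1; rewrite Lpnorm2E// => -[] /(congr1 (fun x => x ^+ 2)).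
  by rewrite sqr_sqrtr ?sqnorm_ge0// expr1n.
have [_ _ isometry] := plancherel_nu; have [mu_ u_fin] := u_Linf.
split.
  have [M0 uM] := Linfnorm_bound u_fin ltr01.
  exact: exists_localization_operator M0 uM.
move=> L locL; split.
  exact: bounded_localization_operator locL.
exact: opnorm_localization_le locL.
Qed.
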